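(* Let $(X,\omega)$ be a (not necessarily compact) Hermitian manifold of dimension $n$, let $\Sigma$ be a smooth analytic hypersurface of $X$, let $t>0$ be a fixed real number, and let $(L,h)$ be a singular Hermitian holomorphic line bundle on $X$ with singular metric $h$ which has locally bounded weights. Then for any compact set $E\subset X$ there exist a neighborhood $W$ of the compact set $\Sigma\cap E$ (the one associated in the context to a finite cover $\mathcal{W}$ of $\Sigma\cap E$) and a constant $A\geq1$ such that for every $x\in W$ and $p\geq1$, $$P_{0,p}(x)\leq\big(Ae^{\varrho(x)}\big)^{2\lfloor tp\rfloor}e^{4p\|h\|_\infty}.$$ The constant $A$ depends only on $\varrho$ and $\mathcal{W}$.
   Context: $S_\Sigma\in H^0(X,\mathcal{O}(\Sigma))$ is a canonical holomorphic section of $\mathcal{O}(\Sigma)$, vanishing to first order on $\Sigma$, $h_\Sigma$ is a fixed smooth Hermitian metric on $\mathcal{O}(\Sigma)$, and $\varrho:=\log|S_\Sigma|_{h_\Sigma}$, where $h_\Sigma$ is chosen so that $\varrho<0$ in a neighborhood of $E$. Cover: for a coordinate chart with coordinates $z=(z_1,\dots,z_n)$, $\Delta^n(y,r)=\{z:|z_j-y_j|\leq r,\ j=1,\dots,n\}$ is the closed polydisk. $\mathcal{W}=\{W_j\}_{1\leq j\leq N}$ is an open cover of $\Sigma\cap E$ by Stein contractible coordinate neighborhoods $W_j$ centered at points $y_j\in\Sigma$, such that $\Delta^n(y_j,2)\subset W_j$ and $\Sigma\cap W_j=\{z\in W_j:z_1=0\}$ for all $j$, where $z=(z_1,\dots,z_n)$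 are the coordinates on $W_j$, and such that $W:=\bigcup_{j=1}^N\Delta^n(y_j,1)$ is a neighborhood of $\Sigma\cap E$. Weights: on each $W_j$ fix a holomorphic frame $e_j$ of $L|_{W_j}$ and let $\varphi_j$ be the corresponding weight of $h$, $|e_j|_h=e^{-\varphi_j}$ (locally bounded weights means each such weight is locally bounded). Set $\|\varphi_j\|_{\infty,W_j}=\sup\{|\varphi_j(w)|:w\in\Delta^n(y_j,2)\}$ and $\|h\|_\infty:=\max\{1,\|\varphi_j\|_{\infty,W_j}:1\leq j\leq N\}$. Sections: $L^p=L^{\otimes p}$, $h_p=h^{\otimes p}$. $H^0_{(2)}(X,L^p)$ is the Bergman space of holomorphic sections $S$ of $L^p$ with $\int_X|S|^2_{h_p}\frac{\omega^n}{n!}<\infty$, with inner product $(S,S')_p=\int_X\langle S,S'\rangle_{h_p}\frac{\omega^n}{n!}$. $H^0_{(2),0}(X,L^p)\subset H^0_{(2)}(X,L^p)$ is the subspace of sections vanishing to order at least $\lfloor tp\rfloor$ along $\Sigma$ ($\lfloor\cdot\rfloor$ the integral part); it may be infinite dimensional. $P_{0,p}(x)=\sum_j|S_j(x)|^2_{h_p}$ for any (at most countable) orthonormal basis $\{S_j\}$ of $H^0_{(2),0}(X,L^p)$.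
   Formalization: As printed the bound fails for arbitrary frames (scale ω down, ⌊tp⌋=0). Proved: for all p≥1 with A depending only on ρ and the cover, after multiplying the frames in ‖h‖_∞ by a constant (depending on ω, L, h, frames); and for arbitrary frames when tp≥1, with A depending also on ω. *)

(* Defs.v *)
From HB Require Import structures.
From mathcomp Require Import all_boot all_order all_algebra.
From mathcomp Require Import complex.
From mathcomp Require Import all_classical all_reals all_analysis.

Set Implicit Arguments.
Unset Strict Implicit.
Unset Printing Implicit Defensive.

Import Order.TTheory GRing.Theory Num.Theory numFieldNormedType.Exports.

Local Open Scope ring_scope.
Local Open Scope classical_set_scope.

(* [R[i]] at a structure type from which the topology, the norm and
   [differentiable] are inferred.  [differentiable] is then differentiability
   over the complex numbers. *)
Notation cplx R := (R[i]%type : numClosedFieldType).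

(* A point of C^n is given by its real coordinates (x_k, y_k), k < n. *)
Section LebesgueCn.
Variable R : realType.

Definition cpair := (measurableTypeR R * measurableTypeR R)%type.

Definition consC n (q : n.-tuple cpair * measurableTypeR R * measurableTypeR R) :
  n.+1.-tuple cpair := [tuple of (q.1.2, q.2) :: q.1.1].

Lemma measurable_consC n : measurable_fun setT (@consC n).
Proof.
apply: measurable_cons.
  apply: measurable_fun_pair; last exact: measurable_snd.
  apply: measurableT_comp; [exact: measurable_snd | exact: measurable_fst].
apply: measurableT_comp; exact: measurable_fst.
Qed.

Fixpoint lebesgueC n : {measure set (n.-tuple cpair) -> \bar R} :=
  if n is n'.+1 then
    measure_function_pushforward__canonical__measure_function_Measure
      ((lebesgueC n' \x @lebesgue_measure R) \x @lebesgue_measure R)%E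
      (@measurable_consC n')
  else \d_ [tuple].

Definition vecC n (t : n.-tuple cpair) : 'rV[cplx R]_n :=
  \row_k ((tnth t k).1 +i* (tnth t k).2)%C.

End LebesgueCn.

Section FunctionsCn.
Variables (R : realType) (n : nat).

Definition real_line (g : 'rV[cplx R]_n -> R) (z v : 'rV[cplx R]_n) : R -> R :=
  fun t => g (z + (t%:C)%C *: v).

Fixpoint Ck (k : nat) (O : set 'rV[cplx R]_n) (g : 'rV[cplx R]_n -> R) : Prop :=
  (forall z, O z -> {for z, continuous g}) /\
  if k is k'.+1 then
    forall v, (forall z, O z -> derivable (real_line g z v) 0 1) /\
              Ck k' O (fun z => derive1 (real_line g z v) 0)
  else True.

Definition Cinfty (O : set 'rV[cplx R]_n) (g : 'rV[cplx R]_n -> R) :=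
  forall k, Ck k O g.

End FunctionsCn.

Section Manifolds.
Variables (R : realType) (n : nat) (X : ptopologicalType).

(* Outside [chart_dom], resp. the image of [chart_dom], the values of
   [chart_map], resp. [chart_inv], are irrelevant. *)
Record chart := Chart {
  chart_dom : set X ;
  chart_map :> X -> 'rV[cplx R]_n ;
  chart_inv : 'rV[cplx R]_n -> X ;
  chart_dom_open : open chart_dom ;
  chart_cod_open : open (chart_map @` chart_dom) ;
  chart_mapK : {in chart_dom, cancel chart_map chart_inv} ;
  chart_map_cont : forall x, chart_dom x -> {for x, continuous chart_map} ;
  chart_inv_cont : forall z, (chart_map @` chart_dom) z ->
    {for z, continuous chart_inv} }.

Definition chart_cod (c : chart) : set 'rV[cplx R]_n := c @` chart_dom c.

Definition transition (c c' : chart) : 'rV[cplx R]_n -> 'rV[cplx R]_n :=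
  c \o chart_inv c'.

Definition compatible (c c' : chart) := forall x,
  chart_dom c x -> chart_dom c' x -> differentiable (transition c c') (c' x).

Record complex_manifold := ComplexManifold {
  atlas : set chart ;
  atlas_cover : forall x, exists2 c, atlas c & chart_dom c x ;
  atlas_compatible : forall c c', atlas c -> atlas c' -> compatible c c' ;
  atlas_maximal : forall c,
    (forall c', atlas c' -> compatible c c' /\ compatible c' c) -> atlas c ;
  manifold_hausdorff : hausdorff_space X ;
  manifold_second_countable : @second_countable X }.

Variable M : complex_manifold.

Definition holomorphic_on (U : set X) (f : X -> cplx R) := forall c x,
  atlas M c -> chart_dom c x -> U x ->
  differentiable (f \o chart_inv c : 'rV[cplx R]_n -> cplx R) (c x).

Definition smooth_on (U : set X) (f : X -> R) := forall c,
  atlas M c -> Cinfty (c @` (chart_dom c `&` U)) (f \o chart_inv c).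

Definition holomorphic_hull (U K : set X) : set X :=
  [set x | U x /\ forall f, holomorphic_on U f -> forall r : R,
    (forall y, K y -> Normc.normc (f y) <= r) -> Normc.normc (f x) <= r].

Definition stein (U : set X) :=
  [/\ open U,
      forall K, K `<=` U -> compact K -> compact (holomorphic_hull U K) &
      forall x y, U x -> U y -> x <> y ->
        exists2 f, holomorphic_on U f & f x <> f y].

Definition contractible (U : set X) :=
  exists (x0 : X) (H : R * X -> X),
    [/\ {within [set q | 0 <= q.1 <= 1 /\ U q.2], continuous H},
        forall t x, 0 <= t <= 1 -> U x -> U (H (t, x)),
        forall x, U x -> H (0, x) = x,
        forall x, U x -> H (1, x) = x0 & U x0].

(* [herm_mx c z] is the matrix (g_jk) of the metric in the chart [c], with the
   normalization omega = (i/2) \sum_jk g_jk dz_j /\ d(conj z_k), for which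
   omega^n / n! = det (g_jk) dx_1 dy_1 ... dx_n dy_n. *)
Record hermitian_metric := HermitianMetric {
  herm_mx : chart -> 'rV[cplx R]_n -> 'M[cplx R]_n ;
  herm_sym : forall c z, atlas M c -> chart_cod c z ->
    (herm_mx c z)^T = map_mx conjc (herm_mx c z) ;
  herm_pos : forall c z (v : 'rV[cplx R]_n), atlas M c -> chart_cod c z -> v != 0 ->
    0 < (v *m herm_mx c z *m (map_mx conjc v)^T) 0 0 ;
  herm_smooth : forall c j k, atlas M c ->
    Cinfty (chart_cod c) (fun z => complex.Re (herm_mx c z j k)) /\
    Cinfty (chart_cod c) (fun z => complex.Im (herm_mx c z j k)) ;
  (* [jacobian f z] has entry d f_j / d z_k in row k and column j. *)
  herm_transform : forall c c' x, atlas M c -> atlas M c' ->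
    chart_dom c x -> chart_dom c' x ->
    let J := jacobian (transition c c') (c' x) in
    herm_mx c' (c' x) = J *m herm_mx c (c x) *m (map_mx conjc J)^T }.

Definition borel : measurableType _ := g_sigma_algebraType (@open X).

(* [vol] is the measure omega^n / n!; these conditions determine it, since
   countably many charts cover the manifold. *)
Definition volume_measure (omega : hermitian_metric)
    (vol : {measure set borel -> \bar R}) :=
  forall c (B : set borel), atlas M c -> measurable B -> B `<=` chart_dom c ->
    vol B = (\int[lebesgueC R n]_(t in vecC (n := n) @^-1` (c @` B))
              (complex.Re (\det (herm_mx omega c (vecC t))))%:E)%E.

(* A section is a family (s_i) with s_i = g_ij s_j, so the local frames satisfy
   e_j = g_ij e_i.  [lb_at] selects a trivialization at each point; nothing
   below depends on the selection. *)
Record line_bundle := LineBundle {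
  lb_idx : Type ;
  lb_dom : lb_idx -> set X ;
  lb_tr : lb_idx -> lb_idx -> X -> cplx R ;
  lb_at : X -> lb_idx ;
  lb_dom_open : forall i, open (lb_dom i) ;
  lb_atP : forall x, lb_dom (lb_at x) x ;
  lb_tr_holo : forall i j, holomorphic_on (lb_dom i `&` lb_dom j) (lb_tr i j) ;
  lb_tr1 : forall i x, lb_dom i x -> lb_tr i i x = 1 ;
  lb_trM : forall i j k x, lb_dom i x -> lb_dom j x -> lb_dom k x ->
    lb_tr i j x * lb_tr j k x = lb_tr i k x }.

Lemma holomorphic_onX (U : set X) (f : X -> cplx R) p :
  holomorphic_on U f -> holomorphic_on U (fun x => f x ^+ p).
Proof.
move=> hf c x Mc cx Ux; have df := hf c x Mc cx Ux.
elim: p => [|p IHp]; first exact: differentiable_cst.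
pose g : 'rV[cplx R]_n -> cplx R := (fun y => f y ^+ p) \o chart_inv c.
rewrite (_ : _ \o _ = (f \o chart_inv c : 'rV[cplx R]_n -> cplx R) * g).
  exact: differentiableM.
by apply: funext => z; rewrite /= exprS.
Qed.

Section Powers.
Variables (L : line_bundle) (p : nat).

Lemma lb_pow_tr_holo i j : holomorphic_on (lb_dom i `&` lb_dom j)
  (fun x => @lb_tr L i j x ^+ p).
Proof. exact/holomorphic_onX/lb_tr_holo. Qed.

Lemma lb_pow_tr1 i x : lb_dom i x -> @lb_tr L i i x ^+ p = 1.
Proof. by move=> ix; rewrite lb_tr1// expr1n. Qed.

Lemma lb_pow_trM i j k x : lb_dom i x -> lb_dom j x -> lb_dom k x ->
  @lb_tr L i j x ^+ p * @lb_tr L j k x ^+ p = @lb_tr L i k x ^+ p.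
Proof. by move=> ix jx kx; rewrite -exprMn lb_trM. Qed.

Definition lb_pow : line_bundle :=
  LineBundle (@lb_dom_open L) (@lb_atP L) lb_pow_tr_holo lb_pow_tr1 lb_pow_trM.

End Powers.

Definition sect (L : line_bundle) := lb_idx L -> X -> cplx R.

Definition holomorphic_section (L : line_bundle) (U : set X) (s : sect L) :=
  (forall i, holomorphic_on (U `&` lb_dom i) (s i)) /\
  (forall i j x, U x -> lb_dom i x -> lb_dom j x ->
     s i x = lb_tr i j x * s j x).

Definition holomorphic_frame (L : line_bundle) (U : set X) (e : sect L) :=
  holomorphic_section U e /\
  (forall i x, U x -> lb_dom i x -> e i x != 0).

Definition scale_sect (L : line_bundle) (a : R) (s : sect L) : sect L :=
  fun i x => (a%:C)%C * s i x.

(* The weights are finite everywhere, as is the case for locally bounded ones;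
   |e_i|_h = exp (- weight i). *)
Record lb_metric (L : line_bundle) := Metric {
  weight : lb_idx L -> X -> R ;
  weight_compat : forall i j x, lb_dom i x -> lb_dom j x ->
    expR (- weight j x) = Normc.normc (lb_tr i j x) * expR (- weight i x) }.

Lemma metric_pow_compat (L : line_bundle) (h : lb_metric L) (p : nat)
    (i j : lb_idx (lb_pow L p)) x : lb_dom i x -> lb_dom j x ->
  expR (- (p%:R * weight h j x)) =
  Normc.normc (lb_tr i j x) * expR (- (p%:R * weight h i x)).
Proof.
move=> ix jx.
have normcX (a : R[i]) q : Normc.normc (a ^+ q) = Normc.normc a ^+ q.
  by elim: q => [|q IHq]; rewrite ?expr0 ?Normc.normc1// !exprS Normc.normcM IHq.
rewrite normcX -!mulrN !expRM_natl -exprMn.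
by congr (_ ^+ _); apply: weight_compat.
Qed.

Definition metric_pow (L : line_bundle) (h : lb_metric L) (p : nat) :
  lb_metric (lb_pow L p) := Metric (@metric_pow_compat L h p).

Definition smooth_metric (L : line_bundle) (h : lb_metric L) :=
  forall i, smooth_on (lb_dom i) (weight h i).

Definition locally_bounded_weights (L : line_bundle) (h : lb_metric L) :=
  forall i x, lb_dom i x -> exists V (b : R),
    nbhs x V /\ forall y, V y -> lb_dom i y -> `|weight h i y| <= b.

(* Lebesgue measurability: Borel up to a set which is Lebesgue null in charts. *)
Definition measurable_weights (L : line_bundle) (h : lb_metric L) :=
  forall i, exists2 psi : borel -> R,
    measurable_fun (lb_dom i : set borel) psi &
    forall c, atlas M c -> (lebesgueC R n).-negligible
      (vecC (n := n) @^-1`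
        (c @` [set x | [/\ chart_dom c x, lb_dom i x & weight h i x <> psi x]])).

Definition hnorm (L : line_bundle) (h : lb_metric L) (s : sect L) (x : X) : R :=
  Normc.normc (s (lb_at L x) x) * expR (- weight h (lb_at L x) x).

Definition hinner (L : line_bundle) (h : lb_metric L) (s s' : sect L) (x : X) :
    cplx R :=
  s (lb_at L x) x * conjc (s' (lb_at L x) x)
    * ((expR (- weight h (lb_at L x) x) ^+ 2)%:C)%C.

End Manifolds.

Section Hypersurfaces.
Variables (R : realType) (n : nat) (X : ptopologicalType).
Variable M : complex_manifold R n.+1 X.

Definition adapted (Sigma : set X) (c : chart R n.+1 X) :=
  Sigma `&` chart_dom c = [set x | chart_dom c x /\ c x 0 0 = 0].

Definition smooth_hypersurface (Sigma : set X) :=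
  closed Sigma /\
  forall x, Sigma x -> exists c, [/\ atlas M c, chart_dom c x & adapted Sigma c].

(* [S] is a holomorphic section of [O] whose divisor is [Sigma] with
   multiplicity one, so that [O], [S] are O(Sigma), S_Sigma. *)
Definition canonical_section (Sigma : set X) (O : line_bundle M) (S : sect O) :=
  [/\ holomorphic_section setT S,
      forall i x, lb_dom i x -> (S i x = 0 <-> Sigma x) &
      forall i c x, atlas M c -> chart_dom c x -> lb_dom i x -> Sigma x ->
        exists v, 'D_v (S i \o chart_inv c : 'rV[cplx R]_n.+1 -> cplx R) (c x)
                  != 0].

(* log |S|, equal to -oo on Sigma. *)
Definition log_norm (O : line_bundle M) (h : lb_metric O) (S : sect O) (x : X) :
  \bar R := lne (hnorm h S x)%:E.

(* Divisibility by the [k]-th power of the ideal of [Sigma], in every chart in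
   which [Sigma] is [z_1 = 0]. *)
Definition vanishes_to_order (Sigma : set X) (L : line_bundle M) (s : sect L)
    (k : nat) :=
  forall c i, atlas M c -> adapted Sigma c ->
    exists2 g, holomorphic_on M (chart_dom c `&` lb_dom i) g &
      forall x, chart_dom c x -> lb_dom i x -> s i x = c x 0 0 ^+ k * g x.

Section Bergman.
Variable vol : {measure set (borel X) -> \bar R}.
Variables (L : line_bundle M) (h : lb_metric L).

Definition bergman_space (s : sect L) :=
  holomorphic_section setT s /\
  (\int[vol]_x (hnorm h s x ^+ 2)%:E < +oo)%E.

Definition bergman_inner (s s' : sect L) : cplx R :=
  ((\int[vol]_x complex.Re (hinner h s s' x)) +i*
   (\int[vol]_x complex.Im (hinner h s s' x)))%C.

(* The family [S], indexed by the (at most countable) set [J] of naturals, is a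
   Hilbert basis of the space [H]. *)
Definition orthonormal_basis (H : set (sect L)) (J : set nat)
    (S : nat -> sect L) :=
  [/\ forall j, J j -> H (S j),
      forall j k, J j -> J k -> bergman_inner (S j) (S k) = (j == k)%:R &
      forall s, H s -> (forall j, J j -> bergman_inner s (S j) = 0) ->
        forall i x, lb_dom i x -> s i x = 0].

Definition kernel_function (J : set nat) (S : nat -> sect L) (x : X) : \bar R :=
  \esum_(j in J) (hnorm h (S j) x ^+ 2)%:E.

End Bergman.

Definition restricted_space (vol : {measure set (borel X) -> \bar R})
    (L : line_bundle M) (h : lb_metric L) (Sigma : set X) (t : R) (p : nat) :
    set (sect (lb_pow L p)) :=
  [set s | bergman_space vol (metric_pow h p) s /\
           vanishes_to_order Sigma s (Num.truncn (t * p%:R))].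

Arguments restricted_space vol {L} h Sigma t p.

Definition polydisk (c : chart R n.+1 X) (y : X) (r : R) : set X :=
  [set x | chart_dom c x /\ forall k, Normc.normc (c x 0 k - c y 0 k) <= r].

Record hyp_cover (Sigma E : set X) := Cover {
  cover_size : nat ;
  cover_chart : 'I_cover_size -> chart R n.+1 X ;
  cover_center : 'I_cover_size -> X ;
  cover_atlas : forall j, atlas M (cover_chart j) ;
  cover_stein : forall j, stein M (chart_dom (cover_chart j)) ;
  cover_contractible : forall j, contractible R (chart_dom (cover_chart j)) ;
  cover_centerP : forall j,
    [/\ Sigma (cover_center j), chart_dom (cover_chart j) (cover_center j) &
        cover_chart j (cover_center j) = 0] ;
  (* [polydisk] only sees points of the chart domain, so that the inclusion of
     the polydisk of radius 2 is a condition in C^n. *)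
  cover_polydisk : forall j (z : 'rV[cplx R]_n.+1),
    (forall k, Normc.normc (z 0 k - cover_chart j (cover_center j) 0 k) <= 2) ->
    chart_cod (cover_chart j) z ;
  cover_adapted : forall j, adapted Sigma (cover_chart j) ;
  cover_covers : Sigma `&` E `<=` \bigcup_j chart_dom (cover_chart j) ;
  cover_nbhd : Sigma `&` E `<=`
    (\bigcup_j polydisk (cover_chart j) (cover_center j) 1)° }.

Definition cover_set (Sigma E : set X) (W : hyp_cover Sigma E) : set X :=
  \bigcup_(j : 'I_(cover_size W)) polydisk (cover_chart j) (cover_center j) 1.

Section Frames.
Variables (Sigma E : set X) (W : hyp_cover Sigma E) (L : line_bundle M).

Definition frames_over (e : 'I_(cover_size W) -> sect L) :=
  forall j : 'I_(cover_size W), holomorphic_frame (chart_dom (cover_chart j)) (e j).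

Definition frame_weight (h : lb_metric L) (e : sect L) (x : X) : R :=
  - ln (hnorm h e x).

Definition metric_sup (h : lb_metric L) (e : 'I_(cover_size W) -> sect L) : R :=
  \big[Num.max/1]_(j < cover_size W)
    sup [set `|frame_weight h (e j) w|
        | w in polydisk (cover_chart j) (cover_center j) 2].

End Frames.

Definition kernel_bound (rho : X -> \bar R)
    (vol : {measure set (borel X) -> \bar R}) (Sigma E : set X)
    (W : hyp_cover Sigma E) (L : line_bundle M) (h : lb_metric L)
    (e : 'I_(cover_size W) -> sect L) (A t : R) (p : nat) :=
  forall (J : set nat) (B : nat -> sect (lb_pow L p)),
    orthonormal_basis vol (metric_pow h p)
      (restricted_space vol h Sigma t p) J B ->
    forall x, cover_set W x ->
      (kernel_function (metric_pow h p) J B x <=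
        (A%:E * expeR (rho x)) ^+ (2 * Num.truncn (t * p%:R))
        * (expR (4 * p%:R * metric_sup h e))%:E)%E.

End Hypersurfaces.

(* Main.v *)
(* On a chart of the cover, a section of [L^p] which vanishes to order [m] along
   Sigma is [f e^p] with [f] divisible by [z_1^m].  A mean value inequality in each
   variable, over a square frame on which the variable has modulus at least one,
   bounds [|f / z_1^m|^2] at a point of the unit polydisk by the L^2 norm of [f] on
   the polydisk of radius 2: dividing by [z_1^m] costs nothing there.  Comparing
   weights on that polydisk costs [e^(4 p ||h||)], and [|z_1| <= A e^rho] because
   S_Sigma vanishes to first order.  Hence
     |s(x)|^2 <= D (A e^rho(x))^(2 m) e^(4 p ||h||) ||s||^2,
   and each partial sum of the kernel at [x] is [|s(x)|^2 / ||s||^2] for one section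
   [s] of the space.  The constant [D] comes from comparing the volume with Lebesgue
   measure; it is absorbed by multiplying the frames by a large constant, or into [A]
   when [m >= 1].

   Holomorphic means complex differentiable, so the mean value inequality is derived
   from Goursat's bisection applied to [(u z - u x0) / (z - x0)]; the
   origin is a second exceptional point, where the quotient of S_Sigma by [z_1] is
   only known to extend continuously. *)

From HB Require Import structures.
Require Import Defs.
From mathcomp Require Import all_boot all_order all_algebra.
From mathcomp Require Import complex.
From mathcomp Require Import all_classical all_reals all_analysis measurable_realfun.
From mathcomp Require Import spectral.
From mathcomp Require Import ring lra.

Set Implicit Arguments.
Unset Strict Implicit.
Unset Printing Implicit Defensive.

Import Order.TTheory GRing.Theory Num.Theory numFieldNormedType.Exports.

Local Open Scope ring_scope.
Local Open Scope classical_set_scope.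

(** * Goursat's theorem and Cauchy estimates on squares *)

(** Neither a winding number nor Cauchy's formula is computed. A rotation makes [u x0] a real
    [T >= 0]; then only the imaginary part of the integral of [(u z - T) / (z - x0)] matters, whence
    Goursat's theorem for real forms [al dx + be dy]. On every edge the angular form
    [Im (dz / (z - x0))] has a positive lower bound, so the vanishing of the integral bounds [T] by
    the mean of [|u|] over the edges.

    Since [u] is controlled only in L^2 on a frame, the rectangle is not fixed: each edge is chosen
    by Chebyshev's inequality in a strip of width 1/5.

    The weights are only Lebesgue measurable, so norms of sections need not be Borel functions.
    Integrals are therefore handled off one Borel null set, common to all powers and all sections.

    When the integral part of [t * p] is 0, the power of [A] is 1 and cannot absorb the volume
    constant; it can only go into the exponential, and scaling the frames enlarges the exponent. *)

Section Bisection.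
Variable R : realType.
Implicit Types (a b c d x y e : R).

Lemma nested_intervals (u v : nat -> R) :
  (forall k, u k <= u k.+1) -> (forall k, v k.+1 <= v k) ->
  (forall k, u k <= v k) ->
  exists x, forall k, u k <= x <= v k.
Proof.
move=> uS vS uv.
have u_le k j : (k <= j)%N -> u k <= u j.
  by apply: (homo_leq (f := u) (r := <=%R)) => //; exact: le_trans.
have v_le k j : (k <= j)%N -> v j <= v k.
  move=> kj; rewrite -lerN2; apply: (homo_leq (f := fun i => - v i) (r := <=%R)) kj.
  - by [].
  - exact: le_trans.
  - by move=> i; rewrite lerN2.
have ub k : ubound (range u) (v k).
  move=> _ [j _ <-]; case: (leqP k j) => kj.
    exact: le_trans (uv j) (v_le _ _ kj).
  exact: le_trans (u_le _ _ (ltnW kj)) (uv k).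
exists (sup (range u)) => k; apply/andP; split.
  by apply: ub_le_sup; [exists (v 0%N); exact: ub|exists k].
by apply: ge_sup; [exists (u 0%N), 0%N|exact: ub].
Qed.

(** All rectangles of the nested sequence keep the proportions of the first, so one ratio [r], a
    power of 1/2, measures both width and height. *)
Lemma bisect_rectangle (P : R -> R -> R -> R -> Prop) a b c d :
  a <= b -> c <= d -> P a b c d ->
  (forall a b c d, a <= b -> c <= d -> P a b c d ->
     let m := (a + b) / 2 in let l := (c + d) / 2 in
     [\/ P a m c l, P m b c l, P a m l d | P m b l d]) ->
  exists x y, forall e, 0 < e -> exists a' b' c' d' (r : R),
    [/\ P a' b' c' d', a <= a' <= x /\ x <= b' <= b,
        c <= c' <= y /\ y <= d' <= d, 0 < r < e &
        b' - a' = (b - a) * r /\ d' - c' = (d - c) * r].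
Proof.
move=> ab cd Pabcd quarter.
pose good (q : R * R * R * R) :=
  [/\ q.1.1.1 <= q.1.1.2, q.1.2 <= q.2 & P q.1.1.1 q.1.1.2 q.1.2 q.2].
pose sub (q q' : R * R * R * R) :=
  [/\ good q', q.1.1.1 <= q'.1.1.1 /\ q'.1.1.2 <= q.1.1.2,
      q.1.2 <= q'.1.2 /\ q'.2 <= q.2 &
      q'.1.1.2 - q'.1.1.1 = (q.1.1.2 - q.1.1.1) / 2 /\
      q'.2 - q'.1.2 = (q.2 - q.1.2) / 2].
(* A rectangle that is not [good] is sent to itself, so that [next] is total and can be iterated;
   [good_q] shows that this default never occurs. *)
have next q : {q' | good q -> sub q q'}.
  apply: cid; have [gq|] := pselect (good q); last by exists q.
  move: q gq => [[[a1 b1] c1] d1] [/= ab1 cd1 P1].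
  have /= := quarter _ _ _ _ ab1 cd1 P1.
  set m := (a1 + b1) / 2; set l := (c1 + d1) / 2.
  have ? : a1 <= m <= b1 by rewrite /m; apply/andP; split; lra.
  have ? : c1 <= l <= d1 by rewrite /l; apply/andP; split; lra.
  case=> H; [exists (a1, m, c1, l)|exists (m, b1, c1, l)|exists (a1, m, l, d1)|
    exists (m, b1, l, d1)] => _; split; rewrite /good/=; split => //; rewrite /m /l; lra.
pose q := fix q k := if k is k'.+1 then projT1 (next (q k')) else (a, b, c, d).
have good_q k : good (q k).
  elim: k => [|k IH]; first by split.
  by rewrite /=; case: (next (q k)) => q' /= /(_ IH) [].
have sub_q k : sub (q k) (q k.+1).
  by rewrite /=; case: (next (q k)) => q' /= /(_ (good_q k)).
have size_q k : (q k).1.1.2 - (q k).1.1.1 = (b - a) * 2^-1 ^+ k /\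
                (q k).2 - (q k).1.2 = (d - c) * 2^-1 ^+ k.
  elim: k => [|k [IH1 IH2]]; first by rewrite !expr0 !mulr1.
  by case: (sub_q k) => _ _ _ [-> ->]; rewrite IH1 IH2 !exprSr !mulrA.
have [x xP] : exists x, forall k, (q k).1.1.1 <= x <= (q k).1.1.2.
  by apply: nested_intervals => k; [case: (sub_q k) => _ []|
    case: (sub_q k) => _ []|case: (good_q k)].
have [y yP] : exists y, forall k, (q k).1.2 <= y <= (q k).2.
  by apply: nested_intervals => k; [case: (sub_q k) => _ _ []|
    case: (sub_q k) => _ _ []|case: (good_q k)].
exists x, y => e e0.
have bnd k : [/\ a <= (q k).1.1.1, (q k).1.1.2 <= b, c <= (q k).1.2 & (q k).2 <= d].
  elim: k => [|k [? ? ? ?]]; first by split.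
  by case: (sub_q k) => _ [? ?] [? ?] _; split; apply: le_trans; eassumption.
have : (fun k => (2^-1 : R) ^+ k) @ \oo --> (0 : R).
  by apply: cvg_expr; rewrite ger0_norm ?invr_ge0// invf_lt1// ltr1n.
move=> /cvgrPdist_lt /(_ _ e0) [k _ /(_ k (leqnn k))].
rewrite /= sub0r normrN ger0_norm; last by rewrite exprn_ge0// invr_ge0.
move=> ke; exists (q k).1.1.1, (q k).1.1.2, (q k).1.2, (q k).2, (2^-1 ^+ k).
have [? ? ? ?] := bnd k; have /andP[? ?] := xP k; have /andP[? ?] := yP k.
split; first by case: (good_q k).
- by split; apply/andP.
- by split; apply/andP.
- by rewrite ke exprn_gt0// invr_gt0.
- exact: size_q.
Qed.

End Bisection.

(** * Integrals along the edges of a rectangle *)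

Section EdgeIntegral.
Variable R : realType.
Implicit Types (a b c d x y e : R) (f g : R -> R).

Definition edge_int a b f : R := \int[lebesgue_measure]_(x in `[a, b]) f x.

Lemma continuous_itv_integrable a b f : {within `[a, b], continuous f} ->
  lebesgue_measure.-integrable `[a, b] (EFin \o f).
Proof. by move=> cf; apply: continuous_compact_integrable => //; exact: segment_compact. Qed.

Lemma edge_int_split a m b f : a <= m <= b -> {within `[a, b], continuous f} ->
  edge_int a b f = edge_int a m f + edge_int m b f.
Proof.
move=> /andP[am mb] cf; have intf := continuous_itv_integrable cf.
rewrite /edge_int -(Rintegral_itv_obnd_cbnd (r := m)); last first.
  apply: integrableS intf => //; by apply: subset_itvr; rewrite bnd_simp.
have := Rintegral_itvB (x := m) intf; rewrite !bnd_simp => /(_ am mb) <-.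
by rewrite addrC subrK.
Qed.

Lemma edge_intD a b f g : {within `[a, b], continuous f} ->
  {within `[a, b], continuous g} ->
  edge_int a b (fun x => f x + g x) = edge_int a b f + edge_int a b g.
Proof. by move=> cf cg; apply: RintegralD => //; exact: continuous_itv_integrable. Qed.

Lemma edge_intB a b f g : {within `[a, b], continuous f} ->
  {within `[a, b], continuous g} ->
  edge_int a b (fun x => f x - g x) = edge_int a b f - edge_int a b g.
Proof. by move=> cf cg; apply: RintegralB => //; exact: continuous_itv_integrable. Qed.

Lemma edge_int_cst a b k : a <= b -> edge_int a b (fun=> k) = k * (b - a).
Proof.
move=> ab; rewrite /edge_int Rintegral_cst//= lebesgue_measure_itv/= lte_fin.
by move: ab; rewrite le_eqVlt => /predU1P[->|->]//=; rewrite ltxx subrr.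
Qed.

Lemma le_edge_int a b f g : {within `[a, b], continuous f} ->
  {within `[a, b], continuous g} -> (forall x, a <= x <= b -> f x <= g x) ->
  edge_int a b f <= edge_int a b g.
Proof.
by move=> cf cg fg; apply: le_Rintegral => //; exact: continuous_itv_integrable.
Qed.

Lemma edge_int_near_cst a b f k e : a <= b -> {within `[a, b], continuous f} ->
  (forall x, a <= x <= b -> `|f x - k| <= e) ->
  `|edge_int a b f - k * (b - a)| <= e * (b - a).
Proof.
move=> ab cf fe; have cst_c k' : {within `[a, b], continuous (fun=> k' : R)}.
  by apply: continuous_subspaceT => ?; exact: cvg_cst.
rewrite ler_distl; apply/andP; split.
  rewrite -mulrBl -edge_int_cst//; apply: le_edge_int => // x /fe.
  by rewrite ler_distl => /andP[].
rewrite -mulrDl -edge_int_cst//; apply: le_edge_int => // x /fe.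
by rewrite ler_distl => /andP[].
Qed.

End EdgeIntegral.

Section Goursat.
Variable R : realType.
Implicit Types (a b c d x y e : R) (f g : R -> R) (F mu al be : R -> R -> R -> R -> R).

(** Additivity of [mu] replaces the factor 4^k of the usual bisection: if [|F| <= e * mu] fails on a
    rectangle, it fails on one of its quarters, hence on arbitrarily small rectangles around some
    point, against the local smallness of [F]. *)
Lemma small_additive_rectangle F mu a b c d : a <= b -> c <= d ->
  (forall a' b' c' d', a <= a' <= b' -> b' <= b -> c <= c' <= d' -> d' <= d ->
     let m := (a' + b') / 2 in let l := (c' + d') / 2 in
     F a' b' c' d' = F a' m c' l + F m b' c' l + F a' m l d' + F m b' l d' /\
     mu a' b' c' d' = mu a' m c' l + mu m b' c' l + mu a' m l d' + mu m b' l d') ->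
  (forall x y e, a <= x <= b -> c <= y <= d -> 0 < e -> exists2 dl, 0 < dl &
     forall a' b' c' d' r, a <= a' <= x -> x <= b' <= b -> c <= c' <= y -> y <= d' <= d ->
       0 < r < dl -> b' - a' = (b - a) * r -> d' - c' = (d - c) * r ->
       `|F a' b' c' d'| <= e * mu a' b' c' d') ->
  F a b c d = 0.
Proof.
move=> ab cd Fmu small.
have H e : 0 < e -> `|F a b c d| <= e * mu a b c d.
  move=> e0; rewrite leNgt; apply/negP => bad.
  pose P a' b' c' d' := [/\ a <= a' /\ b' <= b, c <= c' /\ d' <= d &
    e * mu a' b' c' d' < `|F a' b' c' d'|].
  have PQ : P a b c d by split.
  have quarter a' b' c' d' : a' <= b' -> c' <= d' -> P a' b' c' d' ->
    let m := (a' + b') / 2 in let l := (c' + d') / 2 in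
    [\/ P a' m c' l, P m b' c' l, P a' m l d' | P m b' l d'].
    move=> ab' cd' [[aa bb] [cc dd] bad'] m l.
    have ? : a' <= m <= b' by rewrite /m; apply/andP; split; lra.
    have ? : c' <= l <= d' by rewrite /l; apply/andP; split; lra.
    have [||FE muE] := Fmu a' b' c' d' _ bb _ dd; try by apply/andP.
    have [?|h1] := ltP (e * mu a' m c' l) (`|F a' m c' l|).
      by apply: Or41; split => //; lra.
    have [?|h2] := ltP (e * mu m b' c' l) (`|F m b' c' l|).
      by apply: Or42; split => //; lra.
    have [?|h3] := ltP (e * mu a' m l d') (`|F a' m l d'|).
      by apply: Or43; split => //; lra.
    have [?|h4] := ltP (e * mu m b' l d') (`|F m b' l d'|).
      by apply: Or44; split => //; lra.
    exfalso; move: bad'; rewrite muE FE ltNge => /negP; apply.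
    apply: (le_trans (ler_normD _ _)); rewrite [leRHS]mulrDr lerD//.
    apply: (le_trans (ler_normD _ _)); rewrite [leRHS]mulrDr lerD//.
    by apply: (le_trans (ler_normD _ _)); rewrite [leRHS]mulrDr lerD.
  have [x [y xy]] := bisect_rectangle ab cd PQ quarter.
  have xQ : a <= x <= b.
    by have [? [? [? [? [? [_ [/andP[? ?] /andP[? ?]] _ _ _]]]]]] := xy 1 ltr01;
      apply/andP; split; lra.
  have yQ : c <= y <= d.
    by have [? [? [? [? [? [_ _ [/andP[? ?] /andP[? ?]] _ _]]]]]] := xy 1 ltr01;
      apply/andP; split; lra.
  have [dl dl0 Hdl] := small x y e xQ yQ e0.
  have [a' [b' [c' [d' [r [[_ _ bad'] [/andP[? ?] /andP[? ?]] [/andP[? ?] /andP[? ?]] rdl [rw rh]]]]]]] := xy _ dl0.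
  have : `|F a' b' c' d'| <= e * mu a' b' c' d'.
    by apply: Hdl rdl rw rh; apply/andP.
  by rewrite leNgt bad'.
apply/eqP; rewrite -normr_le0; apply/ler_addgt0Pr => e e0; rewrite add0r.
have m0 : 0 < `|mu a b c d| + 1 by rewrite ltr_wpDl.
apply: (le_trans (H (e / (`|mu a b c d| + 1)) _)); first by rewrite divr_gt0.
rewrite -mulrA; apply: ler_piMr; first exact: ltW.
rewrite ler_pdivrMl// mulr1.
by rewrite (le_trans (ler_norm _))// lerDl.
Qed.

(* [signed_root4] makes the interval function [root4_weight] additive, at least
   the length, and of order [(b - a) ^ (1/4)] when the interval contains [p] or
   [q]: products of such weights dominate the perimeter of small rectangles
   around a point where the form is merely bounded. *)
Definition signed_root4 x : R := Num.sg x * Num.sqrt (Num.sqrt `|x|).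

Lemma signed_root4_homo x y : x <= y -> signed_root4 x <= signed_root4 y.
Proof.
move=> xy; rewrite /signed_root4.
have [x0|x0|x0] := ltgtP x 0; have [y0|y0|y0] := ltgtP y 0;
  rewrite ?x0 ?y0 ?(gtr0_sg x0) ?(ltr0_sg x0) ?(gtr0_sg y0) ?(ltr0_sg y0)
    ?sgr0 ?mul0r ?mul1r ?mulN1r ?oppr_le0 ?sqrtr_ge0//.
all: try by lra.
- by rewrite lerN2 ler_wsqrtr// ler_wsqrtr// !ltr0_norm// lerN2.
- by rewrite (le_trans (y := 0)) ?oppr_le0 ?sqrtr_ge0.
- by rewrite ler_wsqrtr// ler_wsqrtr// !gtr0_norm.
Qed.

(** The longer of the two parts into which 0 cuts the interval has length at least [(y - x) / 2],
    and its contribution alone is enough. *)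
Lemma signed_root4_diff x y : x <= 0 <= y ->
  Num.sqrt (Num.sqrt ((y - x) / 2)) <= signed_root4 y - signed_root4 x.
Proof.
move=> /andP[x0 y0].
have s0 : signed_root4 0 = 0 by rewrite /signed_root4 sgr0 mul0r.
have sx := signed_root4_homo x0; have sy := signed_root4_homo y0.
rewrite s0 in sx sy.
have [yx|xy] := lerP (- x) y.
  have {1}-> : signed_root4 y = Num.sqrt (Num.sqrt y).
    rewrite /signed_root4 (ger0_norm y0); move: y0; rewrite le_eqVlt.
    by move=> /predU1P[<-|y0]; rewrite ?sqrtr0 ?mulr0// gtr0_sg// mul1r.
  rewrite (@le_trans _ _ (Num.sqrt (Num.sqrt y)))// ?lerDl ?oppr_ge0//.
  by rewrite ler_wsqrtr// ler_wsqrtr//; lra.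
have {1}-> : signed_root4 x = - Num.sqrt (Num.sqrt (- x)).
  rewrite /signed_root4 (ler0_norm x0); move: x0; rewrite le_eqVlt.
  move=> /predU1P[->|x0]; first by rewrite oppr0 !sqrtr0 mulr0 oppr0.
  by rewrite ltr0_sg// mulN1r.
rewrite opprK (@le_trans _ _ (Num.sqrt (Num.sqrt (- x))))// ?lerDr//.
by rewrite ler_wsqrtr// ler_wsqrtr//; lra.
Qed.

Definition root4_weight (p q : R) a b : R := b - a +
  (signed_root4 (b - p) - signed_root4 (a - p)) +
  (signed_root4 (b - q) - signed_root4 (a - q)).

Lemma root4_weight_ge p q a b : a <= b -> b - a <= root4_weight p q a b.
Proof.
move=> ab; rewrite /root4_weight.
have := @signed_root4_homo (a - p) (b - p); have := @signed_root4_homo (a - q) (b - q).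
rewrite !lerD2r => /(_ ab) ? /(_ ab) ?; lra.
Qed.

Lemma root4_weight_ge_root4 p q z a b : z = p \/ z = q -> a <= z <= b ->
  Num.sqrt (Num.sqrt ((b - a) / 2)) <= root4_weight p q a b.
Proof.
move=> zpq /andP[az zb]; have ab := le_trans az zb; rewrite /root4_weight.
have := @signed_root4_homo (a - p) (b - p); have := @signed_root4_homo (a - q) (b - q).
rewrite !lerD2r => /(_ ab) hq /(_ ab) hp.
have := @signed_root4_diff (a - z) (b - z); rewrite subr_ge0 subr_le0 az zb => /(_ isT).
rewrite (_ : b - z - (a - z) = b - a); last by ring.
by case: zpq => -> ?; lra.
Qed.

End Goursat.

(** * Goursat's bisection for real 1-forms *)

Section GoursatForms.
Variable R : realType.
Implicit Types (a b c d x y e : R) (al be : R -> R -> R).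

(** The integral of the form [al dx + be dy] along the boundary, counterclockwise. *)
Definition bd_int al be a b c d : R :=
  edge_int a b (al^~ c) + edge_int c d (be b)
  - edge_int a b (al^~ d) - edge_int c d (be a).

Lemma continuous_itv_sub (f : R -> R) a b a' b' : a <= a' -> b' <= b ->
  {within `[a, b], continuous f} -> {within `[a', b'], continuous f}.
Proof.
move=> aa bb; apply: continuous_subspaceW => x /=; rewrite !in_itv/= => /andP[? ?].
by apply/andP; split; [exact: le_trans aa _|exact: le_trans bb].
Qed.

Lemma itv_trans a b a' b' x : a <= a' -> b' <= b -> a' <= x <= b' -> a <= x <= b.
Proof. by move=> aa bb /andP[/(le_trans aa) -> /le_trans]; exact. Qed.

Lemma itv_dist a b x y : a <= x -> x <= b -> a <= y <= b -> `|y - x| <= b - a.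
Proof. by move=> ax xb /andP[ay yb]; rewrite ler_norml; apply/andP; split; lra. Qed.

Lemma bd_int_quarter al be a b c d m l : a <= m <= b -> c <= l <= d ->
  (forall y, c <= y <= d -> {within `[a, b], continuous (al^~ y)}) ->
  (forall x, a <= x <= b -> {within `[c, d], continuous (be x)}) ->
  bd_int al be a b c d = bd_int al be a m c l + bd_int al be m b c l +
    bd_int al be a m l d + bd_int al be m b l d.
Proof.
move=> amb cld ca cb; have /andP[am mb] := amb; have /andP[cl ld] := cld.
have Ha y : c <= y <= d -> edge_int a b (al^~ y) = edge_int a m (al^~ y) + edge_int m b (al^~ y).
  by move=> ?; apply: edge_int_split => //; exact: ca.
have Hb x : a <= x <= b -> edge_int c d (be x) = edge_int c l (be x) + edge_int l d (be x).
  by move=> ?; apply: edge_int_split => //; exact: cb.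
rewrite /bd_int !Ha ?lexx ?(le_trans cl) // !Hb ?lexx ?(le_trans am)//.
ring.
Qed.

(** The comparison form [(P x + q * y) dx + (q * x + S y) dy] is closed: [P] and [S] cancel between
    opposite edges, and the two contributions of [q] cancel each other. Only the error [e] is left
    on the boundary. *)
Lemma bd_int_near_closed al be (P S : R -> R) (q e : R) a b c d :
  a <= b -> c <= d ->
  (forall y, c <= y <= d -> {within `[a, b], continuous (al^~ y)}) ->
  (forall x, a <= x <= b -> {within `[c, d], continuous (be x)}) ->
  (forall x y, a <= x <= b -> c <= y <= d ->
     `|al x y - (P x + q * y)| <= e /\ `|be x y - (q * x + S y)| <= e) ->
  `|bd_int al be a b c d| <= 2 * e * (b - a + (d - c)).
Proof.
move=> ab cd ca cb near.
have aE : edge_int a b (al^~ c) - edge_int a b (al^~ d) =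
    edge_int a b (fun x => al x c - al x d).
  by rewrite edge_intB//; apply: ca; rewrite lexx ?cd.
have bE : edge_int c d (be b) - edge_int c d (be a) =
    edge_int c d (fun y => be b y - be a y).
  by rewrite edge_intB//; apply: cb; rewrite lexx ?ab.
have ha : `|edge_int a b (fun x => al x c - al x d) - q * (c - d) * (b - a)|
    <= 2 * e * (b - a).
  apply: edge_int_near_cst => //.
    by apply: within_continuousB; apply: ca; rewrite lexx ?cd.
  have cc : c <= c <= d by rewrite lexx.
  have dd : c <= d <= d by rewrite lexx cd.
  move=> x xab; have [h1 _] := near x c xab cc; have [h2 _] := near x d xab dd.
  rewrite (_ : _ - _ = al x c - (P x + q * c) - (al x d - (P x + q * d))); last by ring.
  by apply: (le_trans (ler_normB _ _)); rewrite mulrDl mul1r lerD.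
have hb : `|edge_int c d (fun y => be b y - be a y) - q * (b - a) * (d - c)|
    <= 2 * e * (d - c).
  apply: edge_int_near_cst => //.
    by apply: within_continuousB; apply: cb; rewrite lexx ?ab.
  have aa : a <= a <= b by rewrite lexx.
  have bb : a <= b <= b by rewrite lexx ab.
  move=> y ycd; have [_ h1] := near b y bb ycd; have [_ h2] := near a y aa ycd.
  rewrite (_ : _ - _ = be b y - (q * b + S y) - (be a y - (q * a + S y))); last by ring.
  by apply: (le_trans (ler_normB _ _)); rewrite mulrDl mul1r lerD.
rewrite (_ : bd_int _ _ _ _ _ _ = (edge_int a b (fun x => al x c - al x d) - q * (c - d) * (b - a)) +
  (edge_int c d (fun y => be b y - be a y) - q * (b - a) * (d - c))); last first.
  by rewrite -aE -bE /bd_int; ring.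
by apply: (le_trans (ler_normD _ _)); rewrite [leRHS]mulrDr lerD.
Qed.

(* Goursat's bisection for a form that is only required to be continuous at the
   two exceptional points. *)
Lemma goursat al be a b c d (p1 p2 q1 q2 : R) : a < b -> c < d ->
  (forall y, c <= y <= d -> {within `[a, b], continuous (al^~ y)}) ->
  (forall x, a <= x <= b -> {within `[c, d], continuous (be x)}) ->
  (forall x y, a <= x <= b -> c <= y <= d ->
    ((x = p1 /\ y = p2) \/ (x = q1 /\ y = q2)) -> exists M dl, 0 < dl /\
    forall x' y', a <= x' <= b -> c <= y' <= d -> `|x' - x| < dl -> `|y' - y| < dl ->
      `|al x' y'| <= M /\ `|be x' y'| <= M) ->
  (forall x y, a <= x <= b -> c <= y <= d ->
    ~ ((x = p1 /\ y = p2) \/ (x = q1 /\ y = q2)) ->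
    exists (P S : R -> R) (q : R), forall e, 0 < e -> exists2 dl, 0 < dl &
    forall x' y', a <= x' <= b -> c <= y' <= d -> `|x' - x| < dl -> `|y' - y| < dl ->
      `|al x' y' - (P x' + q * y')| <= e * (`|x' - x| + `|y' - y|) /\
      `|be x' y' - (q * x' + S y')| <= e * (`|x' - x| + `|y' - y|)) ->
  bd_int al be a b c d = 0.
Proof.
move=> ab cd ca cb Hexc Hreg.
pose W := b - a; pose H := d - c.
have W0 : 0 < W by rewrite subr_gt0.
have H0 : 0 < H by rewrite subr_gt0.
pose mu a b c d := root4_weight p1 q1 a b * root4_weight p2 q2 c d.
apply: (@small_additive_rectangle _ _ mu) (ltW ab) (ltW cd) _ _.
  move=> a' b' c' d' /andP[aa' ab'] b'b /andP[cc' cd'] d'd m l.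
  have mP : a' <= m <= b' by rewrite /m; apply/andP; split; lra.
  have lP : c' <= l <= d' by rewrite /l; apply/andP; split; lra.
  split; last by rewrite /mu /root4_weight; ring.
  apply: bd_int_quarter => // z /andP[? ?].
    apply: (@continuous_itv_sub _ a b) => //; apply: ca; apply/andP; split; lra.
  by apply: (@continuous_itv_sub _ c d) => //; apply: cb; apply/andP; split; lra.
move=> x y e xab ycd e0.
have [exc|reg] := pselect ((x = p1 /\ y = p2) \/ (x = q1 /\ y = q2)).
  have [M0 [dl [dl0 HM0]]] := Hexc x y xab ycd exc.
  pose M := `|M0| + 1.
  have M_gt0 : 0 < M by rewrite ltr_wpDl.
  have HM x' y' : a <= x' <= b -> c <= y' <= d -> `|x' - x| < dl -> `|y' - y| < dl ->
      `|al x' y'| <= M /\ `|be x' y'| <= M.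
    move=> h1 h2 h3 h4; have [? ?] := HM0 x' y' h1 h2 h3 h4.
    by have := ler_norm M0; rewrite /M; split; lra.
  (* With [s := sqrt (r * K)], the boundary integral is at most [2 * M * (W + H) / K * s ^+ 2],
     whereas the root weights give [mu >= s]. Hence [s < t] suffices, which is what the radius
     [t ^+ 2 / K] ensures; the radius [dl / (W + H)] keeps the rectangle where [M] is a bound. *)
  pose K := Num.min W H / 2.
  have K0 : 0 < K by rewrite divr_gt0// lt_min W0.
  have KW : K <= W / 2 by rewrite ler_pM2r// ge_min lexx.
  have KH : K <= H / 2 by rewrite ler_pM2r// ge_min lexx orbT.
  pose t := e * K / (2 * M * (W + H)).
  have WH : 0 < W + H by rewrite addr_gt0.
  have MWH : 0 < 2 * M * (W + H) by rewrite mulr_gt0// mulr_gt0.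
  have t0 : 0 < t by rewrite divr_gt0// mulr_gt0.
  exists (Num.min (dl / (W + H)) (t ^+ 2 / K)).
    by rewrite lt_min (divr_gt0 dl0 WH) divr_gt0// exprn_gt0.
  move=> a' b' c' d' r /andP[aa' a'x] /andP[xb' b'b] /andP[cc' c'y] /andP[yd' d'd].
  rewrite lt_min => /and3P[r0]; rewrite ltr_pdivlMr// => rdl.
  rewrite ltr_pdivlMr// => rt wE hE.
  have ab' := le_trans a'x xb'.
  have cd' := le_trans c'y yd'.
  have rW : 0 < r * W by rewrite mulr_gt0.
  have rH : 0 < r * H by rewrite mulr_gt0.
  have wE' : b' - a' = r * W by rewrite wE mulrC.
  have hE' : d' - c' = r * H by rewrite hE mulrC.
  have rdl' : r * W + r * H < dl by rewrite -mulrDr.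
  have small_bd : `|bd_int al be a' b' c' d'| <= 2 * M * (b' - a' + (d' - c')).
    apply: (@bd_int_near_closed _ _ (fun=> 0) (fun=> 0) 0) => //.
    - by move=> z zz; apply: (@continuous_itv_sub _ a b) => //; apply: ca; exact: itv_trans cc' d'd zz.
    - by move=> z zz; apply: (@continuous_itv_sub _ c d) => //; apply: cb; exact: itv_trans aa' b'b zz.
    move=> x' y' x'r y'r; rewrite !mul0r !addr0 !subr0.
    apply: (HM x' y' (itv_trans aa' b'b x'r) (itv_trans cc' d'd y'r)).
      apply: le_lt_trans (itv_dist a'x xb' x'r) _.
      by rewrite wE'; apply: le_lt_trans rdl'; rewrite lerDl ltW.
    apply: le_lt_trans (itv_dist c'y yd' y'r) _.
    by rewrite hE'; apply: le_lt_trans rdl'; rewrite lerDr ltW.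
  apply: (le_trans small_bd).
  have : Num.sqrt (r * K) <= mu a' b' c' d'.
    rewrite -[X in X <= _]sqr_sqrtr ?sqrtr_ge0// expr2 /mu.
    apply: ler_pM; rewrite ?sqrtr_ge0//.
      apply: le_trans (@root4_weight_ge_root4 _ p1 q1 x _ _ _ _); last 2 first.
      + by case: exc => -[? ?]; [left|right].
      + by apply/andP.
      apply/ler_wsqrtr/ler_wsqrtr; rewrite wE' -mulrA ler_pM2l//.
    apply: le_trans (@root4_weight_ge_root4 _ p2 q2 y _ _ _ _); last 2 first.
    + by case: exc => -[? ?]; [left|right].
    + by apply/andP.
    by apply/ler_wsqrtr/ler_wsqrtr; rewrite hE' -mulrA ler_pM2l.
  move=> /(ler_wpM2l (ltW e0)) h; apply: le_trans h.
  rewrite wE' hE' -mulrDr.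
  have rK0 : 0 < r * K by rewrite mulr_gt0.
  have sqrtK : Num.sqrt (r * K) < t.
    by rewrite -(ltr_pXn2r (n := 2)) ?nnegrE ?sqrtr_ge0 ?(ltW t0)// sqr_sqrtr// ltW.
  have rE : r = Num.sqrt (r * K) ^+ 2 / K by rewrite sqr_sqrtr ?ltW// mulfK// gt_eqF.
  set s := Num.sqrt (r * K) in sqrtK rE *.
  have s0 : 0 < s by rewrite sqrtr_gt0.
  rewrite (_ : 2 * M * _ = (2 * M * (W + H) / K * s) * s); last first.
    by rewrite {1}rE; field; rewrite gt_eqF.
  rewrite ler_pM2r// -ler_pdivlMl ?(divr_gt0 MWH)//.
  apply: (le_trans (ltW sqrtK)); rewrite /t le_eqVlt; apply/orP; left; apply/eqP.
  by field; rewrite ?gt_eqF.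
have [P [S [q loc]]] := Hreg x y xab ycd reg.
have WH : 0 < W + H by rewrite addr_gt0.
(* With this value the bound [2 * e' * (r * (W + H)) ^+ 2] is [e] times the area of the rectangle,
   and the area is at most [mu]. *)
pose e' := e * (W * H) / (2 * (W + H) ^+ 2).
have e'0 : 0 < e'.
  by rewrite divr_gt0 ?mulr_gt0 ?exprn_gt0// mulr_gt0.
have [dl dl0 Hdl] := loc e' e'0.
exists (dl / (W + H)); first by rewrite divr_gt0.
move=> a' b' c' d' r /andP[aa' a'x] /andP[xb' b'b] /andP[cc' c'y] /andP[yd' d'd].
move=> /andP[r0]; rewrite ltr_pdivlMr// => rdl wE hE.
have ab' := le_trans a'x xb'.
have cd' := le_trans c'y yd'.
have rW : 0 < r * W by rewrite mulr_gt0.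
have rH : 0 < r * H by rewrite mulr_gt0.
have wE' : b' - a' = r * W by rewrite wE mulrC.
have hE' : d' - c' = r * H by rewrite hE mulrC.
have rdl' : r * W + r * H < dl by rewrite -mulrDr.
have small_bd : `|bd_int al be a' b' c' d'| <= 2 * (e' * (r * (W + H))) * (b' - a' + (d' - c')).
  apply: (@bd_int_near_closed _ _ P S q) => //.
  - by move=> z zz; apply: (@continuous_itv_sub _ a b) => //; apply: ca; exact: itv_trans cc' d'd zz.
  - by move=> z zz; apply: (@continuous_itv_sub _ c d) => //; apply: cb; exact: itv_trans aa' b'b zz.
  move=> x' y' x'r y'r.
  have xx : `|x' - x| <= r * W by rewrite -wE'; exact: itv_dist.
  have yy : `|y' - y| <= r * H by rewrite -hE'; exact: itv_dist.
  have xdl : `|x' - x| < dl by apply: le_lt_trans xx (le_lt_trans _ rdl'); rewrite lerDl ltW.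
  have ydl : `|y' - y| < dl by apply: le_lt_trans yy (le_lt_trans _ rdl'); rewrite lerDr ltW.
  have [h1 h2] := Hdl x' y' (itv_trans aa' b'b x'r) (itv_trans cc' d'd y'r) xdl ydl.
  have le_e : e' * (`|x' - x| + `|y' - y|) <= e' * (r * (W + H)).
    by rewrite ler_pM2l// mulrDr lerD.
  by split; [exact: le_trans h1 _|exact: le_trans h2 _].
apply: (le_trans small_bd).
rewrite (@le_trans _ _ (e * ((b' - a') * (d' - c'))))//.
  rewrite wE' hE' /e' le_eqVlt; apply/orP; left; apply/eqP.
  by field; rewrite gt_eqF.
rewrite ler_pM2l// /mu; apply: ler_pM; rewrite ?subr_ge0//; exact: root4_weight_ge.
Qed.

End GoursatForms.

(** * The topology of C and C^n through the real-valued modulus *)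

Section ComplexTopology.
Variable R : realType.
Local Notation C := (cplx R).

(* The values of [Normc.normc] live in the rcfType underlying [R], on which
   rewriting with lemmas about [R] does not fire. *)
Definition cnorm (z : C) : R := Normc.normc z.

Implicit Types (z w : C) (e : R).

Lemma cnormE z : cnorm z = Num.sqrt (complex.Re z ^+ 2 + complex.Im z ^+ 2).
Proof. by case: z. Qed.

Lemma normr_cnorm z : `|z| = ((cnorm z)%:C)%C.
Proof. by case: z. Qed.

Lemma cnorm_ge0 z : 0 <= cnorm z.
Proof. by rewrite cnormE sqrtr_ge0. Qed.

Lemma cnorm0 : cnorm 0 = 0. Proof. exact: Normc.normc0. Qed.

Lemma cnorm1 : cnorm 1 = 1. Proof. exact: Normc.normc1. Qed.

Lemma cnorm_eq0 z : (cnorm z == 0) = (z == 0).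
Proof. by apply/eqP/eqP => [/Normc.eq0_normc|->]; rewrite ?cnorm0. Qed.

Lemma cnorm_gt0 z : (0 < cnorm z) = (z != 0).
Proof. by rewrite lt_def cnorm_ge0 andbT cnorm_eq0. Qed.

Lemma cnormM z w : cnorm (z * w) = cnorm z * cnorm w.
Proof. exact: Normc.normcM. Qed.

Lemma cnormV z : cnorm z^-1 = (cnorm z)^-1.
Proof. exact: Normc.normcV. Qed.

Lemma cnormX z k : cnorm (z ^+ k) = cnorm z ^+ k.
Proof. by elim: k => [|k IH]; rewrite ?expr0 ?cnorm1// !exprS cnormM IH. Qed.

Lemma cnormN z : cnorm (- z) = cnorm z.
Proof. exact: normcN. Qed.

Lemma cnormD z w : cnorm (z + w) <= cnorm z + cnorm w.
Proof. exact: le_normcD. Qed.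

Lemma cdistC z w : cnorm (z - w) = cnorm (w - z).
Proof. by rewrite -cnormN opprB. Qed.

Lemma cnorm_real e : cnorm (e%:C)%C = `|e|.
Proof. by rewrite cnormE/= expr0n addr0 sqrtr_sqr. Qed.

Lemma ler_cdist z w : `|cnorm z - cnorm w| <= cnorm (z - w).
Proof.
have h1 : cnorm z <= cnorm (z - w) + cnorm w by rewrite -{1}(subrK w z) cnormD.
have h2 : cnorm w <= cnorm (z - w) + cnorm z.
  by rewrite -{1}(subrK z w) cdistC cnormD.
by rewrite ler_norml; apply/andP; split; lra.
Qed.

Lemma Re_le_cnorm z : `|complex.Re z| <= cnorm z.
Proof. have -> : `|complex.Re z| = Num.sqrt (complex.Re z ^+ 2) :> R by rewrite sqrtr_sqr.
by rewrite cnormE; apply: (@ler_wsqrtr R); rewrite lerDl sqr_ge0. Qed.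

Lemma Im_le_cnorm z : `|complex.Im z| <= cnorm z.
Proof. have -> : `|complex.Im z| = Num.sqrt (complex.Im z ^+ 2) :> R by rewrite sqrtr_sqr.
by rewrite cnormE; apply: (@ler_wsqrtr R); rewrite lerDr sqr_ge0. Qed.

Lemma cnorm_le_ReIm z : cnorm z <= `|complex.Re z| + `|complex.Im z|.
Proof.
case: z => a b; rewrite cnormE/=.
have -> : `|a| + `|b| = Num.sqrt ((`|a| + `|b|) ^+ 2).
  by rewrite sqrtr_sqr (ger0_norm (addr_ge0 (normr_ge0 a) (normr_ge0 b))).
apply: ler_wsqrtr; rewrite sqrrD !real_normK ?num_real// lerD2r lerDl.
by rewrite mulrn_wge0 ?mulr_ge0.
Qed.

Lemma gt0_realC (e : C) : 0 < e -> exists2 r : R, 0 < r & e = (r%:C)%C.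
Proof. by case: e => a b; rewrite ltcE/= => /andP[/eqP -> a0]; exists a. Qed.

Lemma nbhs_cnormP z (A : set C) :
  nbhs z A <-> exists2 r : R, 0 < r & forall w, cnorm (w - z) < r -> A w.
Proof.
split=> [/nbhs_ballP[e /= /gt0_realC[r r0 ->]] eA|[r r0 rA]].
  exists r => // w wz; apply: eA.
  by rewrite -ball_normE /ball_/= normr_cnorm ltcR cdistC.
apply/nbhs_ballP; exists (r%:C)%C; first by rewrite /= ltcR.
move=> w; rewrite -ball_normE /ball_/= normr_cnorm ltcR => wz; apply: rA.
by rewrite cdistC.
Qed.

Lemma nbhs_rowP n (z : 'rV[C]_n) (A : set 'rV[C]_n) :
  nbhs z A <-> exists2 r : R, 0 < r &
    forall w : 'rV[C]_n, (forall k, cnorm (w 0 k - z 0 k) < r) -> A w.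
Proof.
split=> [/nbhs_ballP[e /= /gt0_realC[r r0 ->]] eA|[r r0 rA]].
  exists r => // w wz; apply: eA; split=> [|i j]; first by rewrite ltcR.
  by rewrite ord1 -ball_normE /ball_/= normr_cnorm ltcR cdistC.
apply/nbhs_ballP; exists (r%:C)%C; first by rewrite /= ltcR.
move=> w [_ wz]; apply: rA => k; have := wz 0 k.
by rewrite -ball_normE /ball_/= normr_cnorm ltcR cdistC.
Qed.

Lemma continuous_cnormP (T : topologicalType) (f : T -> C) t :
  {for t, continuous f} <->
  forall e, 0 < e -> \forall s \near t, cnorm (f s - f t) < e.
Proof.
split=> [cf e e0|H].
  have : nbhs (f t) [set w | cnorm (w - f t) < e] by apply/nbhs_cnormP; exists e.
  exact: cf.
move=> A /nbhs_cnormP[r r0 rA].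
by have := H r r0; apply: filterS => s /rA.
Qed.

Lemma continuous_cnorm_comp (T : topologicalType) (f : T -> C) t :
  {for t, continuous f} -> {for t, continuous (fun s => cnorm (f s))}.
Proof.
move=> /continuous_cnormP cf; apply/cvgrPdist_lt => e e0.
have := cf e e0; apply: filterS => s; apply: le_lt_trans.
by rewrite cdistC ler_cdist.
Qed.

Lemma continuous_Re_comp (T : topologicalType) (f : T -> C) t :
  {for t, continuous f} -> {for t, continuous (fun s => complex.Re (f s))}.
Proof.
move=> /continuous_cnormP cf; apply/cvgrPdist_lt => e e0.
have := cf e e0; apply: filterS => s; apply: le_lt_trans.
rewrite cdistC (le_trans _ (Re_le_cnorm _))//.
by case: (f t) (f s) => [? ?] [? ?].
Qed.

Lemma continuous_Im_comp (T : topologicalType) (f : T -> C) t :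
  {for t, continuous f} -> {for t, continuous (fun s => complex.Im (f s))}.
Proof.
move=> /continuous_cnormP cf; apply/cvgrPdist_lt => e e0.
have := cf e e0; apply: filterS => s; apply: le_lt_trans.
rewrite cdistC (le_trans _ (Im_le_cnorm _))//.
by case: (f t) (f s) => [? ?] [? ?].
Qed.

Lemma derivable_cnormP (f : C -> C) z : derivable f z 1 ->
  forall e, 0 < e -> exists2 r : R, 0 < r & forall w, cnorm w < r ->
    cnorm (f (z + w) - f z - 'D_1 f z * w) <= e * cnorm w.
Proof.
move=> df e e0; set d := 'D_1 f z.
have {}df : h^-1 *: ((f \o shift z) (h *: 1) - f z) @[h --> 0^'] --> d by exact: df.
have : nbhs d [set w | cnorm (w - d) < e] by apply/nbhs_cnormP; exists e.
move=> /df; rewrite /nbhs/= => /nbhs_cnormP[r' r'0 Hr].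
exists r' => // w wr; have [->|w0] := eqVneq w 0.
  by rewrite addr0 subrr mulr0 subrr cnorm0 mulr0.
have := Hr w; rewrite subr0 => /(_ wr) /(_ w0) /=.
rewrite [w *: 1]mulr1 (addrC w) => /ltW.
rewrite (_ : f (z + w) - f z - d * w = (w^-1 *: (f (z + w) - f z) - d) * w); last first.
  by rewrite mulrBl [_ *: _]mulrC -mulrA mulVf// mulr1.
by rewrite cnormM => h; rewrite ler_wpM2r ?cnorm_ge0.
Qed.

Lemma continuous_complex_re (y x : R) : {for x, continuous (fun s : R => (s +i* y)%C : C)}.
Proof.
apply/continuous_cnormP => e e0; near=> s.
apply: (le_lt_trans (cnorm_le_ReIm _)); rewrite /= subrr normr0 addr0.
by near: s; apply/nbhs_ballP; exists e => // u /=; rewrite /ball/= distrC.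
Unshelve. all: by end_near. Qed.

Lemma continuous_complex_im (x y : R) : {for y, continuous (fun s : R => (x +i* s)%C : C)}.
Proof.
apply/continuous_cnormP => e e0; near=> s.
apply: (le_lt_trans (cnorm_le_ReIm _)); rewrite /= subrr normr0 add0r.
by near: s; apply/nbhs_ballP; exists e => // u /=; rewrite /ball/= distrC.
Unshelve. all: by end_near. Qed.

Lemma within_horizontal (g : C -> R) (a b y : R) :
  (forall x, a <= x <= b -> {for (x +i* y)%C, continuous g}) ->
  {within `[a, b], continuous (fun x => g (x +i* y)%C)}.
Proof.
move=> cg; apply: continuous_in_subspaceT => x; rewrite inE/= in_itv/= => xab.
apply: (@continuous_comp _ _ _ (fun s : R => (s +i* y)%C : C) g); last exact: cg.
exact: continuous_complex_re.
Qed.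

Lemma within_vertical (g : C -> R) (c d x : R) :
  (forall y, c <= y <= d -> {for (x +i* y)%C, continuous g}) ->
  {within `[c, d], continuous (fun y => g (x +i* y)%C)}.
Proof.
move=> cg; apply: continuous_in_subspaceT => y; rewrite inE/= in_itv/= => ycd.
apply: (@continuous_comp _ _ _ (fun s : R => (x +i* s)%C : C) g); last exact: cg.
exact: continuous_complex_im.
Qed.

End ComplexTopology.

(** * Continuity and derivability rules in one complex variable *)

Section ComplexCalculus.
Variable R : realType.
Local Notation C := (cplx R).

Lemma near_eq_continuous (T U : topologicalType) (f g : T -> U) t :
  {near t, f =1 g} -> {for t, continuous f} -> {for t, continuous g}.
Proof.
move=> fg cf; rewrite /prop_for /continuous_at -(nbhs_singleton fg).
exact: cvg_trans (near_eq_cvg fg) cf.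
Qed.

Lemma ccontinuous_cst (T : topologicalType) (c : C) (t : T) :
  {for t, continuous (fun=> c)}.
Proof. exact: cvg_cst. Qed.

Lemma ccontinuous_id (z : C) : {for z, continuous (fun s => s)}.
Proof. exact: cvg_id. Qed.

Lemma ccontinuousM (T : topologicalType) (f g : T -> C) t :
  {for t, continuous f} -> {for t, continuous g} ->
  {for t, continuous (fun s => f s * g s)}.
Proof. exact: continuousM. Qed.

Lemma ccontinuousB (T : topologicalType) (f g : T -> C) t :
  {for t, continuous f} -> {for t, continuous g} ->
  {for t, continuous (fun s => f s - g s)}.
Proof. exact: continuousB. Qed.

Lemma ccontinuousD (T : topologicalType) (f g : T -> C) t :
  {for t, continuous f} -> {for t, continuous g} ->
  {for t, continuous (fun s => f s + g s)}.
Proof. exact: continuousD. Qed.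

Lemma ccontinuousV (T : topologicalType) (f : T -> C) t : f t != 0 ->
  {for t, continuous f} -> {for t, continuous (fun s => (f s)^-1)}.
Proof. exact: continuousV. Qed.

Lemma ccontinuousX (T : topologicalType) (f : T -> C) t k :
  {for t, continuous f} -> {for t, continuous (fun s => f s ^+ k)}.
Proof.
move=> cf; elim: k => [|k IH].
  have -> : (fun s => f s ^+ 0) = (fun=> 1) by apply/funext => s; rewrite expr0.
  exact: cvg_cst.
have -> : (fun s => f s ^+ k.+1) = (fun s => f s * f s ^+ k).
  by apply/funext => s; rewrite exprS.
exact: (ccontinuousM cf IH).
Qed.

Lemma cderivableM (f g : C -> C) z : derivable f z 1 -> derivable g z 1 ->
  derivable (fun s => f s * g s) z 1.
Proof. exact: derivableM. Qed.

Lemma cderivableB (f g : C -> C) z : derivable f z 1 -> derivable g z 1 ->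
  derivable (fun s => f s - g s) z 1.
Proof. exact: derivableB. Qed.

Lemma cderivableV (f : C -> C) z : f z != 0 -> derivable f z 1 ->
  derivable (fun s => (f s)^-1) z 1.
Proof. exact: derivableV. Qed.

Lemma cderivable_cst (c z : C) : derivable (fun=> c) z 1.
Proof. exact: derivable_cst. Qed.

Lemma cderivable_id (z : C) : derivable (fun s => s) z 1.
Proof. exact: derivable_id. Qed.

Lemma cderivableX (f : C -> C) z k : derivable f z 1 ->
  derivable (fun s => f s ^+ k) z 1.
Proof.
move=> df; elim: k => [|k IH].
  have -> : (fun s => f s ^+ 0) = (fun=> 1) by apply/funext => s; rewrite expr0.
  exact: cderivable_cst.
have -> : (fun s => f s ^+ k.+1) = (fun s => f s * f s ^+ k).
  by apply/funext => s; rewrite exprS.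
exact: (cderivableM df IH).
Qed.

Lemma cderivable_continuous (f : C -> C) z : derivable f z 1 -> {for z, continuous f}.
Proof. by move=> /derivable1_diffP /differentiable_continuous. Qed.

End ComplexCalculus.

Arguments ccontinuous_cst {R T} c t.
Arguments ccontinuous_id {R} z.
Arguments cderivable_cst {R} c z.
Arguments cderivable_id {R} z.
Arguments continuous_complex_re {R} y x.
Arguments continuous_complex_im {R} x y.
Arguments cnorm : simpl never.

(** * The difference quotient as a Cauchy kernel *)

Section CauchyKernel.
Variable R : realType.
Local Notation C := (cplx R).
Implicit Types (z w : C) (u : C -> C).

Definition rectangle (a b c d : R) : set C :=
  [set z | a <= complex.Re z <= b /\ c <= complex.Im z <= d].

(** Since [Im (u dz) = Im u dx + Re u dy], this is the vanishing of the imaginary part of the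
    integral of [u dz]. *)
Lemma goursat_complex u (p q : C) a b c d : a < b -> c < d ->
  (forall z, rectangle a b c d z -> {for z, continuous u}) ->
  (forall z, rectangle a b c d z -> z <> p -> z <> q -> derivable u z 1) ->
  bd_int (fun x y => complex.Im (u (x +i* y)%C)) (fun x y => complex.Re (u (x +i* y)%C))
    a b c d = 0.
Proof.
move=> ab cd cu du.
have Pab x y : a <= x <= b -> c <= y <= d -> rectangle a b c d (x +i* y)%C by [].
apply: (@goursat _ _ _ _ _ _ _ (complex.Re p) (complex.Im p) (complex.Re q) (complex.Im q)) => //.
- move=> y ycd; apply: (within_horizontal (g := fun z => complex.Im (u z))) => x xab.
  by apply: continuous_Im_comp; exact/cu/Pab.
- move=> x xab; apply: (within_vertical (g := fun z => complex.Re (u z))) => y ycd.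
  by apply: continuous_Re_comp; exact/cu/Pab.
- move=> x y xab ycd _; exists (cnorm (u (x +i* y)%C) + 1).
  have /continuous_cnormP/(_ 1 ltr01)/nbhs_cnormP[r r0 Hr] := cu _ (Pab _ _ xab ycd).
  exists (r / 2); split; first by rewrite divr_gt0.
  move=> x' y' _ _ xx yy.
  have : cnorm (u (x' +i* y')%C) <= cnorm (u (x +i* y)%C) + 1.
    have /ltW h : cnorm (u (x' +i* y')%C - u (x +i* y)%C) < 1.
      apply: Hr; apply: (le_lt_trans (cnorm_le_ReIm _)); rewrite /=; lra.
    by rewrite -lerBlDl (le_trans _ h)// (le_trans (ler_norm _))// ler_cdist.
  by move=> h; split; apply: le_trans h; rewrite ?Im_le_cnorm ?Re_le_cnorm.
move=> x y xab ycd reg.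
have [k Hk] : exists k : C, forall e : R, 0 < e -> exists2 r : R, 0 < r & forall w, cnorm w < r ->
    cnorm (u ((x +i* y)%C + w) - u (x +i* y)%C - k * w) <= e * cnorm w.
  exists ('D_1 u (x +i* y)%C); apply: derivable_cnormP; apply: du; first exact: Pab.
    by move=> xyp; apply: reg; left; rewrite -xyp.
  by move=> xyq; apply: reg; right; rewrite -xyq.
(* The imaginary and real parts of the affine approximation of [u], grouped as [P x' + q * y'] and
   [q * x' + S y'] with [q := Re k]. That the same [q] occurs in both is the Cauchy-Riemann
   equation. *)
exists (fun x' => complex.Im (u (x +i* y)%C) + complex.Im k * (x' - x) - complex.Re k * y).
exists (fun y' => complex.Re (u (x +i* y)%C) - complex.Re k * x - complex.Im k * (y' - y)).
exists (complex.Re k) => e e0; have [r r0 Hr] := Hk e e0.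
exists (r / 2); first by rewrite divr_gt0.
move=> x' y' _ _ xx yy.
pose w : C := ((x' - x) +i* (y' - y))%C.
have nw : cnorm w <= `|x' - x| + `|y' - y| by exact: cnorm_le_ReIm.
have {Hr} : cnorm (u ((x +i* y)%C + w) - u (x +i* y)%C - k * w) <= e * (`|x' - x| + `|y' - y|).
  apply: (le_trans (Hr w _)); last by rewrite ler_pM2l.
  by apply: (le_lt_trans nw); lra.
rewrite (_ : (x +i* y)%C + w = (x' +i* y')%C); last first.
  by apply/eqP; rewrite eq_complex/= !subrKC !eqxx.
move=> h; split; apply: le_trans h.
  apply: le_trans (Im_le_cnorm _); rewrite le_eqVlt; apply/orP; left; apply/eqP; congr (`| _ |).
  case: (u _) (u _) (k) => [? ?] [? ?] [? ?] /=; ring.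
apply: le_trans (Re_le_cnorm _); rewrite le_eqVlt; apply/orP; left; apply/eqP; congr (`| _ |).
case: (u _) (u _) (k) => [? ?] [? ?] [? ?] /=; ring.
Qed.

(* [d] is the derivative of [u] at [x0]. *)
Definition cauchy_kernel u (x0 d z : C) : C :=
  if z == x0 then d else (u z - u x0) / (z - x0).

Lemma cauchy_kernel_near u (x0 d z : C) : z != x0 ->
  {near z, (fun s => (u s - u x0) * (s - x0)^-1) =1 cauchy_kernel u x0 d}.
Proof.
move=> zx0; apply/nbhs_cnormP; exists (cnorm (z - x0)).
  by rewrite cnorm_gt0 subr_eq0.
move=> s szx; rewrite /cauchy_kernel ifF//; apply/eqP => sx0.
by move: szx; rewrite sx0 cdistC ltxx.
Qed.

(** At [x0] the kernel is only shown to be continuous; one of the two exceptional points of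
    Goursat's theorem is spent there. *)
Lemma continuous_cauchy_kernel u (x0 : C) : derivable u x0 1 ->
  let K := cauchy_kernel u x0 ('D_1 u x0) in
  (forall z, {for z, continuous u} -> {for z, continuous K}) /\
  (forall z, z <> x0 -> derivable u z 1 -> derivable K z 1).
Proof.
move=> du K; rewrite /K {K}; have Hd := derivable_cnormP du.
set d := 'D_1 u x0 in Hd *; split=> z.
  have [->|zx0] := eqVneq z x0.
    move=> _; apply/continuous_cnormP => e e0.
    have e20 : 0 < e / 2 by rewrite divr_gt0.
    have [r r0 Hr] := Hd _ e20.
    apply/nbhs_cnormP; exists r => // s sr; rewrite /cauchy_kernel eqxx.
    case: eqVneq => [_|sx0]; first by rewrite subrr cnorm0.
    have sx00 : s - x0 != 0 by rewrite subr_eq0.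
    have := Hr _ sr; rewrite subrKC => h.
    rewrite (_ : _ - _ = (u s - u x0 - d * (s - x0)) / (s - x0)); last by field.
    rewrite cnormM cnormV ltr_pdivrMr ?cnorm_gt0//.
    by apply: (le_lt_trans h); rewrite ltr_pM2r ?cnorm_gt0//; lra.
  move=> cu; apply: (near_eq_continuous (cauchy_kernel_near u d zx0)).
  have c1 := ccontinuousB cu (ccontinuous_cst (u x0) (z : C)).
  have c2 := ccontinuousB (ccontinuous_id z) (ccontinuous_cst x0 (z : C)).
  by apply: (ccontinuousM c1 (ccontinuousV _ c2)); rewrite subr_eq0.
move=> /eqP zx0 dz; apply: near_eq_derivable (cauchy_kernel_near u d zx0) _.
have d1 := cderivableB dz (cderivable_cst (u x0) z).
have d2 := cderivableB (cderivable_id z) (cderivable_cst x0 z).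
by apply: (cderivableM d1 (cderivableV _ d2)); rewrite subr_eq0.
Qed.

End CauchyKernel.

Section CauchyEstimate.
Variable R : realType.
Local Notation C := (cplx R).
Implicit Types (z w v : C) (u : C -> C) (a b c d T : R).

(** Here [D] is the distance from [x0] to the line carrying an edge. It is at least 6/5 - 1 = 1/5,
    and coordinates differ by at most 7/5 + 1 = 12/5, so [X ^+ 2 + Y ^+ 2 <= 288 / 25] and [D / (X
    ^+ 2 + Y ^+ 2) >= 5 / 288 >= 1 / 60]. *)
Lemma kernel_part_le v T (X Y D : R) : 0 <= T ->
  1 / 5 <= D -> D <= 12 / 5 -> D = `|X| \/ D = `|Y| -> `|X| <= 12 / 5 -> `|Y| <= 12 / 5 ->
  cnorm (v / (X +i* Y)%C) <= 5 * cnorm v /\ T / 60 <= T * (D / (X ^+ 2 + Y ^+ 2)).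
Proof.
move=> T0 D1 D2 DXY X1 Y1.
have X2 : X ^+ 2 <= 144 / 25 by rewrite -(real_normK (num_real X)); have := normr_ge0 X; nra.
have Y2 : Y ^+ 2 <= 144 / 25 by rewrite -(real_normK (num_real Y)); have := normr_ge0 Y; nra.
have D2' : D ^+ 2 <= X ^+ 2 + Y ^+ 2.
  by case: DXY => ->; rewrite real_normK ?num_real// ?lerDl ?lerDr sqr_ge0.
have rho0 : 0 < X ^+ 2 + Y ^+ 2 by nra.
split.
  rewrite cnormM cnormV mulrC; apply: ler_wpM2r; first exact: cnorm_ge0.
  have D0 : 0 < D by lra.
  have Dle : D <= cnorm (X +i* Y)%C.
    rewrite cnormE/=; have {1}-> : D = Num.sqrt (D ^+ 2) by rewrite sqrtr_sqr gtr0_norm.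
    exact: (@ler_wsqrtr R).
  rewrite -[5]invrK lef_pV2 ?posrE//; last exact: lt_le_trans Dle.
  by apply: le_trans Dle; lra.
apply: ler_wpM2l => //; rewrite ler_pdivlMr// mulrC ler_pdivrMr//; lra.
Qed.

Lemma ImRe_kernel v T (X Y : R) : X ^+ 2 + Y ^+ 2 != 0 ->
  complex.Im ((v - (T%:C)%C) / (X +i* Y)%C) =
    complex.Im (v / (X +i* Y)%C) + T * (Y / (X ^+ 2 + Y ^+ 2)) /\
  complex.Re ((v - (T%:C)%C) / (X +i* Y)%C) =
    complex.Re (v / (X +i* Y)%C) - T * (X / (X ^+ 2 + Y ^+ 2)).
Proof. by case: v => p q ?; split=> /=; field. Qed.

Lemma far_side (s x : R) : 6 / 5 <= s <= 7 / 5 -> -1 <= x <= 1 ->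
  1 / 5 <= s - x <= 12 / 5 /\ `|s - x| = s - x.
Proof.
move=> /andP[s1 s2] /andP[x1 x2]; split; first by apply/andP; split; lra.
by rewrite ger0_norm//; lra.
Qed.

Lemma near_side (s t s' x : R) : - (7 / 5) <= s -> t <= 7 / 5 -> s <= s' <= t ->
  -1 <= x <= 1 -> `|s' - x| <= 12 / 5.
Proof.
by move=> ? ? /andP[? ?] /andP[? ?]; rewrite ler_norml; apply/andP; split; lra.
Qed.

Definition side a : Prop := 6 / 5 <= a <= 7 / 5.

Local Notation box := (@rectangle R (- (7 / 5)) (7 / 5) (- (7 / 5)) (7 / 5)).

(** On each edge, run counterclockwise, the form [Im (K dz)] is at most [5 * |u| - T / 60] per unit
    length. Its integral is 0 and the perimeter is at least 48/5, so [T * (48 / 5) / 60] is at most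
    5 times the sum of the edge integrals; this gives the constant 25 * 5 / 4 < 32. *)
Lemma cauchy_edges u (x0 : C) a b c d :
  side (- a) -> side b -> side (- c) -> side d ->
  `|complex.Re x0| <= 1 -> `|complex.Im x0| <= 1 ->
  (forall z, box z -> {for z, continuous u}) ->
  (forall z, box z -> z <> 0 -> derivable u z 1) -> derivable u x0 1 ->
  cnorm (u x0) <= 32 * (edge_int a b (fun x => cnorm (u (x +i* c)%C)) +
    edge_int c d (fun y => cnorm (u (b +i* y)%C)) +
    edge_int a b (fun x => cnorm (u (x +i* d)%C)) +
    edge_int c d (fun y => cnorm (u (a +i* y)%C))).
Proof.
case: x0 => X0 Y0 a12 b12 c12 d12 /= x1 y1 cu du.
have /andP[a1 a2] := a12; have /andP[b1 b2] := b12.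
have /andP[c1 c2] := c12; have /andP[d1 d2] := d12.
set x0 : C := (X0 +i* Y0)%C => dx0.
have ab : a < b by lra.
have cd : c < d by lra.
have sub z : rectangle a b c d z -> box z.
  by move=> [/andP[? ?] /andP[? ?]]; split; apply/andP; split; lra.
pose k := 'D_1 u x0; have [ck dk] := continuous_cauchy_kernel dx0; rewrite -/k in ck dk.
set T := cnorm (u x0); have T0 : 0 <= T by exact: cnorm_ge0.
(* A rotation with [r * u x0 = T]; when [u x0 = 0] any unit serves. *)
pose r : C := if u x0 == 0 then 1 else (T%:C)%C / u x0.
have r1 : cnorm r = 1.
  rewrite /r; case: eqVneq => [_|ux0]; first exact: cnorm1.
  by rewrite cnormM cnormV cnorm_real ger0_norm// divff// cnorm_eq0.
have ru : r * u x0 = (T%:C)%C.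
  rewrite /r; case: eqVneq => [ux0|ux0]; last by rewrite divfK.
  by rewrite mul1r /T ux0 cnorm0.
pose K z := r * cauchy_kernel u x0 k z.
have cK z : rectangle a b c d z -> {for z, continuous K}.
  by move=> /sub zb; exact: (ccontinuousM (ccontinuous_cst r z) (ck _ (cu _ zb))).
have K0 : bd_int (fun x y => complex.Im (K (x +i* y)%C))
    (fun x y => complex.Re (K (x +i* y)%C)) a b c d = 0.
  (* Derivability may fail at 0, where [u] is only assumed continuous, and at [x0], where the
     quotient is filled in. *)
  apply: (goursat_complex (p := 0) (q := x0) ab cd cK) => z /sub zb z0 zx0.
  exact: (cderivableM (cderivable_cst r z) (dk _ zx0 (du _ zb z0))).
have Kxy (x y : R) : (x +i* y)%C != x0 ->
    K (x +i* y)%C = (r * u (x +i* y)%C - (T%:C)%C) /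
      ((x - X0) +i* (y - Y0))%C.
  move=> xy; rewrite /K /cauchy_kernel (negbTE xy) -ru mulrA mulrBr; congr (_ / _).
have nr z : cnorm (r * u z) = cnorm (u z) by rewrite cnormM r1 mul1r.
have cux y : c <= y <= d -> {within `[a, b], continuous (fun x => cnorm (u (x +i* y)%C))}.
  move=> ycd; apply: (within_horizontal (g := fun z => cnorm (u z))) => x xab.
  by apply: continuous_cnorm_comp; exact/cu/sub.
have cuy x : a <= x <= b -> {within `[c, d], continuous (fun y => cnorm (u (x +i* y)%C))}.
  move=> xab; apply: (within_vertical (g := fun z => cnorm (u z))) => y ycd.
  by apply: continuous_cnorm_comp; exact/cu/sub.
have cKx y : c <= y <= d -> {within `[a, b], continuous (fun x => complex.Im (K (x +i* y)%C))}.
  move=> ycd; apply: (within_horizontal (g := fun z => complex.Im (K z))) => x xab.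
  exact: (continuous_Im_comp (cK (x +i* y)%C (conj xab ycd))).
have cKy x : a <= x <= b -> {within `[c, d], continuous (fun y => complex.Re (K (x +i* y)%C))}.
  move=> xab; apply: (within_vertical (g := fun z => complex.Re (K z))) => y ycd.
  exact: (continuous_Re_comp (cK (x +i* y)%C (conj xab ycd))).
have edge (f g : R -> R) s s' : s <= s' -> {within `[s, s'], continuous f} ->
    {within `[s, s'], continuous g} ->
    (forall x, s <= x <= s' -> f x <= 5 * g x - T / 60) ->
    edge_int s s' f <= 5 * edge_int s s' g - T / 60 * (s' - s).
  move=> ss cf cg fg.
  have c5 : {within `[s, s'], continuous (fun x => 5 * g x)}.
    by move=> x; apply: (@continuousM R (subspace `[s, s']) (fun=> 5) g); [exact: cvg_cst|exact: cg].
  have cT : {within `[s, s'], continuous (fun=> T / 60)}.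
    by apply: continuous_subspaceT => ?; exact: cvg_cst.
  rewrite -edge_int_cst// -RintegralZl//; last exact: continuous_itv_integrable.
  rewrite -edge_intB//; apply: le_edge_int => //.
  exact: within_continuousB.
have cc : c <= c <= d by rewrite lexx ltW.
have dd : c <= d <= d by rewrite lexx ltW.
have aa : a <= a <= b by rewrite lexx ltW.
have bb : a <= b <= b by rewrite lexx ltW.
have edgeN (f : R -> R) s s' : {within `[s, s'], continuous f} ->
    edge_int s s' (fun x => - f x) = - edge_int s s' f.
  move=> cf; rewrite /edge_int -mulN1r -RintegralZl//; last exact: continuous_itv_integrable.
  by congr Rintegral; apply/funext => x; rewrite mulN1r.
have ptw (x y D : R) : 1 / 5 <= D <= 12 / 5 ->
    D = `|x - X0| \/ D = `|y - Y0| ->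
    `|x - X0| <= 12 / 5 -> `|y - Y0| <= 12 / 5 ->
    let S := (x - X0) ^+ 2 + (y - Y0) ^+ 2 in
    let B := 5 * cnorm (u (x +i* y)%C) in
    [/\ `|complex.Im (K (x +i* y)%C) - T * ((y - Y0) / S)| <= B,
        `|complex.Re (K (x +i* y)%C) + T * ((x - X0) / S)| <= B &
        T / 60 <= T * (D / S)].
  move=> /andP[D1 D2] DE X1 Y1 S B.
  have xy : (x +i* y)%C != x0.
    apply/eqP => E; case: E => Ex Ey; move: DE; rewrite Ex Ey !subrr normr0.
    by move=> -[] D0; move: D1; rewrite D0; clear; lra.
  have S0 : S != 0.
    rewrite /S paddr_eq0 ?sqr_ge0// !expf_eq0/=; apply/negP => /andP[/eqP E1 /eqP E2].
    by move: DE; rewrite E1 E2 normr0 => -[] D0; move: D1; rewrite D0; clear; lra.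
  have [h1 h2] := kernel_part_le (r * u (x +i* y)%C) T0 D1 D2 DE X1 Y1.
  have [k1 k2] := ImRe_kernel (r * u (x +i* y)%C) T S0.
  rewrite nr in h1; split; last exact: h2.
    by rewrite Kxy// k1 addrK; apply: le_trans h1; exact: Im_le_cnorm.
  by rewrite Kxy// k2 subrK; apply: le_trans h1; exact: Re_le_cnorm.
have a5 : - (7 / 5) <= a by rewrite lerNl.
have c5 : - (7 / 5) <= c by rewrite lerNl.
have x11 : -1 <= X0 <= 1 by rewrite -ler_norml.
have y11 : -1 <= Y0 <= 1 by rewrite -ler_norml.
have Nx11 : -1 <= - X0 <= 1 by rewrite -ler_norml normrN.
have Ny11 : -1 <= - Y0 <= 1 by rewrite -ler_norml normrN.
have [c3 c4] := far_side c12 Ny11; have [b3 b4] := far_side b12 x11.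
have [d3 d4] := far_side d12 y11; have [a3 a4] := far_side a12 Nx11.
have e1 : edge_int a b (fun x => complex.Im (K (x +i* c)%C)) <=
    5 * edge_int a b (fun x => cnorm (u (x +i* c)%C)) - T / 60 * (b - a).
  apply: edge; [exact: ltW|exact: cKx|exact: cux|move=> x xab].
  have YE : `|c - Y0| = - c - - Y0 by rewrite -c4 -normrN; congr (`|_|); ring.
  have [||||h _ h'] := ptw x c (- c - - Y0); [exact: c3|by right|exact: near_side a5 b2 xab x11| |].
    by rewrite YE; case/andP: c3.
  move: h h'; rewrite ler_norml => /andP[_ h].
  rewrite (_ : - c - - Y0 = - (c - Y0)) ?mulNr ?mulrN; last by ring.
  by move: (T * _) (complex.Im _) h => ? ?; clear; lra.
have e2 : edge_int c d (fun y => complex.Re (K (b +i* y)%C)) <=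
    5 * edge_int c d (fun y => cnorm (u (b +i* y)%C)) - T / 60 * (d - c).
  apply: edge; [exact: ltW|exact: cKy|exact: cuy|move=> y ycd].
  have [||||_ h h'] := ptw b y (b - X0); [exact: b3|by left| |exact: near_side c5 d2 ycd y11|].
    by rewrite b4; case/andP: b3.
  move: h h'; rewrite ler_norml => /andP[_ h].
  by move: (T * _) (complex.Re _) h => ? ?; clear; lra.
have e3 : edge_int a b (fun x => - complex.Im (K (x +i* d)%C)) <=
    5 * edge_int a b (fun x => cnorm (u (x +i* d)%C)) - T / 60 * (b - a).
  apply: edge; [exact: ltW|by move=> x; apply: (@continuousN R R (subspace `[a, b])); exact: cKx
    |exact: cux|move=> x xab].
  have [||||h _ h'] := ptw x d (d - Y0); [exact: d3|by right|exact: near_side a5 b2 xab x11| |].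
    by rewrite d4; case/andP: d3.
  move: h h'; rewrite ler_norml => /andP[h _].
  by move: (T * _) (complex.Im _) h => ? ?; clear; lra.
have e4 : edge_int c d (fun y => - complex.Re (K (a +i* y)%C)) <=
    5 * edge_int c d (fun y => cnorm (u (a +i* y)%C)) - T / 60 * (d - c).
  apply: edge; [exact: ltW|by move=> x; apply: (@continuousN R R (subspace `[c, d])); exact: cKy
    |exact: cuy|move=> y ycd].
  have YE : `|a - X0| = - a - - X0 by rewrite -a4 -normrN; congr (`|_|); ring.
  have [||||_ h h'] := ptw a y (- a - - X0); [exact: a3|by left| |exact: near_side c5 d2 ycd y11|].
    by rewrite YE; case/andP: a3.
  move: h h'; rewrite ler_norml => /andP[h _].
  rewrite (_ : - a - - X0 = - (a - X0)) ?mulNr ?mulrN; last by ring.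
  by move: (T * _) (complex.Re _) h => ? ?; clear; lra.
rewrite edgeN in e3; last exact: cKx.
rewrite edgeN in e4; last exact: cKy.
move: e1 e2 e3 e4 K0 a1 b1 c1 d1 T0; rewrite /bd_int.
set I1 := edge_int a b (fun x => complex.Im (K (x +i* c)%C)).
set I2 := edge_int c d (fun y => complex.Re (K (b +i* y)%C)).
set I3 := edge_int a b (fun x => complex.Im (K (x +i* d)%C)).
set I4 := edge_int c d (fun y => complex.Re (K (a +i* y)%C)).
move: (edge_int _ _ _) (edge_int _ _ _) (edge_int _ _ _) (edge_int _ _ _).
move: (T) (I1) (I2) (I3) (I4); clear => T' I1 I2 I3 I4 J1 J2 J3 J4 *; nra.
Qed.

End CauchyEstimate.

Section CauchyBounds.
Variable R : realType.
Local Notation C := (cplx R).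
Local Notation box := (@rectangle R (- (7 / 5)) (7 / 5) (- (7 / 5)) (7 / 5)).
Local Notation mu := (@lebesgue_measure R).
Implicit Types (z w : C) (u : C -> C) (a b c d T : R).

(** The values 6/5 and 7/5 put the frame at distance at least 1/5 from the unit square that contains
    [x0], outside the open unit disk, and inside the disk of radius 2, as 7/5 times the square root
    of 2 is less than 2. *)
Definition box_frame : set C :=
  [set z | box z /\ (6 / 5 <= `|complex.Re z| \/ 6 / 5 <= `|complex.Im z|)].

Lemma box_cnorm z : box z -> cnorm z <= 2.
Proof.
move=> [/andP[x1 x2] /andP[y1 y2]].
rewrite cnormE; move: (complex.Re z) (complex.Im z) x1 x2 y1 y2 => x y *.
have -> : (2 : R) = Num.sqrt (2 ^+ 2) by rewrite sqrtr_sqr ger0_norm.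
by apply: ler_wsqrtr; nra.
Qed.

Lemma box_frame_cnorm z : box_frame z -> 1 <= cnorm z <= 2.
Proof.
move=> [bz far]; rewrite box_cnorm// andbT.
by case: far => h; apply: le_trans (le_trans h _); rewrite ?Re_le_cnorm ?Im_le_cnorm//; lra.
Qed.

Lemma edge_frame a b c d x y : side (- a) -> side b -> side (- c) -> side d ->
  (a <= x <= b /\ (y = c \/ y = d)) \/ (c <= y <= d /\ (x = a \/ x = b)) ->
  box_frame (x +i* y)%C.
Proof.
move=> /andP[? ?] /andP[? ?] /andP[? ?] /andP[? ?].
have fa : 6 / 5 <= `|a| by rewrite ler0_norm; lra.
have fb : 6 / 5 <= `|b| by rewrite ger0_norm; lra.
have fc : 6 / 5 <= `|c| by rewrite ler0_norm; lra.
have fd : 6 / 5 <= `|d| by rewrite ger0_norm; lra.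
by case=> [[/andP[? ?]]|[/andP[? ?]]] [] ->; (split;
  [by split=> /=; apply/andP; split; lra|by [left|right]]).
Qed.

(** The four sides of the inner square of the frame, each of length 12/5, give the factor 32 * 4 *
    12/5 < 400. *)
Lemma cauchy_sup u (x0 : C) M : `|complex.Re x0| <= 1 -> `|complex.Im x0| <= 1 ->
  (forall z, box z -> {for z, continuous u}) ->
  (forall z, box z -> z <> 0 -> derivable u z 1) -> derivable u x0 1 ->
  (forall z, box_frame z -> cnorm (u z) <= M) -> cnorm (u x0) <= 400 * M.
Proof.
move=> x1 y1 cu du dx0 uM.
have s65 : side (6 / 5 : R) by apply/andP; split; lra.
have Ns65 : side (- - (6 / 5) : R) by rewrite opprK.
have ab : - (6 / 5) <= 6 / 5 :> R by lra.
have M0 : 0 <= M.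
  apply: le_trans (uM (0 +i* (6 / 5))%C _); first exact: cnorm_ge0.
  by apply: (edge_frame Ns65 s65 Ns65 s65); left; split; [apply/andP; split; lra|right].
have edge (f : R -> C) : (forall x, - (6 / 5) <= x <= 6 / 5 -> box_frame (f x)) ->
    (forall x, - (6 / 5) <= x <= 6 / 5 -> {for x, continuous f}) ->
    edge_int (- (6 / 5)) (6 / 5) (fun x => cnorm (u (f x))) <= M * (12 / 5).
  move=> fA cf; rewrite (_ : 12 / 5 = 6 / 5 - - (6 / 5) :> R); last by lra.
  rewrite -edge_int_cst//; apply: le_edge_int.
  - apply: continuous_in_subspaceT => x; rewrite inE/= in_itv/= => xab.
    apply: continuous_cnorm_comp; apply: (@continuous_comp _ _ _ f u); first exact: cf.
    by apply: cu; case: (fA x xab).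
  - by apply: continuous_subspaceT => ?; exact: cvg_cst.
  - by move=> x xab; exact/uM/fA.
apply: (le_trans (cauchy_edges Ns65 s65 Ns65 s65 x1 y1 cu du dx0)).
have -> : 400 * M = 32 * (M * (25 / 2)) by lra.
rewrite ler_pM2l//.
have e1 := edge (fun x => (x +i* - (6 / 5))%C) _ (fun x _ => continuous_complex_re (- (6 / 5)) x).
have e2 := edge (fun x => (x +i* (6 / 5))%C) _ (fun x _ => continuous_complex_re (6 / 5) x).
have e3 := edge (fun y => (- (6 / 5) +i* y)%C) _ (fun y _ => continuous_complex_im (- (6 / 5)) y).
have e4 := edge (fun y => ((6 / 5) +i* y)%C) _ (fun y _ => continuous_complex_im (6 / 5) y).
have {}e1 : _ := e1 (fun x xab => edge_frame Ns65 s65 Ns65 s65 (or_introl (conj xab (or_introl erefl)))).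
have {}e2 : _ := e2 (fun x xab => edge_frame Ns65 s65 Ns65 s65 (or_introl (conj xab (or_intror erefl)))).
have {}e3 : _ := e3 (fun x xab => edge_frame Ns65 s65 Ns65 s65 (or_intror (conj xab (or_introl erefl)))).
have {}e4 : _ := e4 (fun x xab => edge_frame Ns65 s65 Ns65 s65 (or_intror (conj xab (or_intror erefl)))).
move: e1 e2 e3 e4 M0; move: (edge_int _ _ _) (edge_int _ _ _) (edge_int _ _ _) (edge_int _ _ _).
by clear; move: M => M *; lra.
Qed.

(** The weights of the inequality are chosen so that the terms in [T ^+ 2] of four edges, multiplied
    by 32, add up to 0.448 times [T ^+ 2], which leaves room for the integrals of [f ^+ 2]. *)
Lemma edge_AMGM a b f T : a <= b -> b - a <= 14 / 5 -> {within `[a, b], continuous f} ->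
  T * edge_int a b f <= 7 / (2 * 10 ^+ 3) * T ^+ 2 + 200 * edge_int a b (fun x => f x ^+ 2).
Proof.
move=> ab ba cf.
have cf2 : {within `[a, b], continuous (fun x => f x ^+ 2)}.
  by move=> x; apply: (@continuousM R (subspace `[a, b]) f f); exact: cf.
have cZ k (g : R -> R) : {within `[a, b], continuous g} ->
    {within `[a, b], continuous (fun x => k * g x)}.
  by move=> cg x; apply: (@continuousM R (subspace `[a, b]) (fun=> k) g); [exact: cvg_cst|exact: cg].
have cc k : {within `[a, b], continuous (fun=> k : R)}.
  by apply: continuous_subspaceT => ?; exact: cvg_cst.
rewrite /edge_int -!RintegralZl//; try exact: continuous_itv_integrable.
apply: (@le_trans _ _ (edge_int a b (fun x => T ^+ 2 / 800 + 200 * f x ^+ 2))).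
  apply: le_edge_int; [exact: cZ|exact: within_continuousD (cc _) (cZ _ _ cf2)|].
  by move=> x _; rewrite -subr_ge0 (_ : _ - _ = 2 * (T / 40 - 10 * f x) ^+ 2); [rewrite mulr_ge0// sqr_ge0|field].
rewrite edge_intD//; last exact: cZ.
by rewrite lerD2r edge_int_cst//; have := sqr_ge0 T; nra.
Qed.

End CauchyBounds.

Section CauchyL2.
Variable R : realType.
Local Notation C := (cplx R).
Local Notation box := (@rectangle R (- (7 / 5)) (7 / 5) (- (7 / 5)) (7 / 5)).
Local Notation mu := (@lebesgue_measure R).
Implicit Types (u : C -> C) (a b c d T k : R).

Lemma integral_ge_itv (F : measurableTypeR R -> \bar R) a b k : a <= b -> 0 <= k ->
  measurable_fun setT F -> (forall x, 0 <= F x)%E ->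
  (forall x, a <= x <= b -> (k%:E <= F x)%E) ->
  ((k * (b - a))%:E <= \int[mu]_x F x)%E.
Proof.
move=> ab k0 mF F0 kF.
apply: (@le_trans _ _ (\int[mu]_(x in `[a, b]) F x)%E); last first.
  by apply: ge0_subset_integral => //.
apply: (@le_trans _ _ (\int[mu]_(x in `[a, b]) k%:E)%E).
  rewrite integral_cst//= lebesgue_measure_itv/= lte_fin.
  by move: ab; rewrite le_eqVlt => /predU1P[->|->]//; rewrite ltxx subrr mulr0 mule0.
by apply: ge0_le_integral => //; exact: measurable_funTS.
Qed.

Lemma edge_int_lt a b (f : R -> R) (F : measurableTypeR R -> \bar R) k :
  {within `[a, b], continuous f} -> (forall x, a <= x <= b -> 0 <= f x) ->
  measurable_fun setT F -> (forall x, 0 <= F x)%E ->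
  (forall x, a <= x <= b -> ((f x)%:E <= F x)%E) ->
  (\int[mu]_x F x < k%:E)%E -> edge_int a b f < k.
Proof.
move=> cf f0 mF F0 fF Fk; have intf := continuous_itv_integrable cf.
rewrite -lte_fin; apply: le_lt_trans Fk.
rewrite /edge_int /Rintegral fineK; last exact: integrable_fin_num.
apply: (@le_trans _ _ (\int[mu]_(x in `[a, b]) F x)%E); last first.
  by apply: ge0_subset_integral.
apply: ge0_le_integral => //.
- by case/integrableP: intf.
- exact: measurable_funTS.
Qed.

(** By Chebyshev, if some strip of width 1/5 contains no line on which [phi] integrates to less than
    [k := T ^+ 2 / 10 ^+ 5], then the double integral is at least [k / 5], which is the claim.
    Otherwise the four lines found bound a rectangle on which the edge estimate forces [T = 0]. *)
Lemma cauchy_L2 u (x0 : C) (phi : measurableTypeR R * measurableTypeR R -> \bar R) :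
  `|complex.Re x0| <= 1 -> `|complex.Im x0| <= 1 ->
  (forall z, box z -> {for z, continuous u}) ->
  (forall z, box z -> z <> 0 -> derivable u z 1) -> derivable u x0 1 ->
  measurable_fun setT phi -> (forall q, 0 <= phi q)%E ->
  (forall x y : R, box_frame (x +i* y)%C -> ((cnorm (u (x +i* y)%C) ^+ 2)%:E <= phi (x, y))%E) ->
  ((cnorm (u x0) ^+ 2)%:E <= (5 * 10 ^+ 5)%:E * \int[mu]_x \int[mu]_y phi (x, y))%E.
Proof.
move=> x1 y1 cu du dx0 mphi phi0 uphi.
set T := cnorm (u x0); have T0 : 0 <= T by exact: cnorm_ge0.
pose F (x : measurableTypeR R) := (\int[mu]_y phi (x, y))%E.
pose G (y : measurableTypeR R) := (\int[mu]_x phi (x, y))%E.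
have mF : measurable_fun setT F.
  exact: (measurable_fun_fubini_tonelli_F (m2 := mu) phi mphi phi0).
have mG : measurable_fun setT G.
  exact: (measurable_fun_fubini_tonelli_G (m1 := mu) phi mphi phi0).
have F0 x : (0 <= F x)%E by apply: integral_ge0.
have G0 y : (0 <= G y)%E by apply: integral_ge0.
have FG : (\int[mu]_x F x = \int[mu]_y G y)%E.
  by rewrite /F /G -(fubini_tonelli1 (m1 := mu) (m2 := mu) phi mphi phi0)
    -(fubini_tonelli2 (m1 := mu) (m2 := mu) phi mphi phi0).
set I := (\int[mu]_x F x)%E in FG *.
pose k := T ^+ 2 / 10 ^+ 5.
have k0 : 0 <= k by rewrite divr_ge0 ?sqr_ge0 ?exprn_ge0.
have conclude : ((k / 5)%:E <= I)%E -> ((T ^+ 2)%:E <= (5 * 10 ^+ 5)%:E * I)%E.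
  move=> kI; apply: (@le_trans _ _ ((5 * 10 ^+ 5)%:E * (k / 5)%:E)%E).
    by rewrite -EFinM lee_fin /k; lra.
  by apply: lee_wpmul2l.
have strip (H : measurableTypeR R -> \bar R) s t : t = s + 1 / 5 ->
    (\int[mu]_x H x = I)%E -> measurable_fun setT H -> (forall x, 0 <= H x)%E ->
    (exists2 x, s <= x <= t & (H x < k%:E)%E) \/ ((T ^+ 2)%:E <= (5 * 10 ^+ 5)%:E * I)%E.
  move=> st HI mH H0.
  have [?|nex] := pselect (exists2 x, s <= x <= t & (H x < k%:E)%E); [by left|right].
  apply: conclude; rewrite -HI; have -> : k / 5 = k * (t - s) by rewrite st; lra.
  apply: integral_ge_itv => //; first lra.
  by move=> x xst; rewrite leNgt; apply/negP => Hx; apply: nex; exists x.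
have [[b b1 Fb]|//] := strip F (6 / 5) (7 / 5) ltac:(lra) erefl mF F0.
have [[a a1 Fa]|//] := strip F (- (7 / 5)) (- (6 / 5)) ltac:(lra) erefl mF F0.
have [[d d1 Gd]|//] := strip G (6 / 5) (7 / 5) ltac:(lra) (esym FG) mG G0.
have [[c c1 Gc]|//] := strip G (- (7 / 5)) (- (6 / 5)) ltac:(lra) (esym FG) mG G0.
have sa : side (- a) by move: a1 => /andP[? ?]; apply/andP; split; lra.
have sc : side (- c) by move: c1 => /andP[? ?]; apply/andP; split; lra.
have [ab ba] : a <= b /\ b - a <= 14 / 5.
  by case/andP: a1 => ? ?; case/andP: b1 => ? ?; split; lra.
have [cd dc] : c <= d /\ d - c <= 14 / 5.
  by case/andP: c1 => ? ?; case/andP: d1 => ? ?; split; lra.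
have frame x y := @edge_frame R a b c d x y sa b1 sc d1.
have chor y : y = c \/ y = d -> {within `[a, b], continuous (fun x => cnorm (u (x +i* y)%C))}.
  move=> ycd; apply: (within_horizontal (g := fun z => cnorm (u z))) => x xab.
  by apply: continuous_cnorm_comp; apply: cu; case: (frame x y); [left|].
have cver x : x = a \/ x = b -> {within `[c, d], continuous (fun y => cnorm (u (x +i* y)%C))}.
  move=> xab; apply: (within_vertical (g := fun z => cnorm (u z))) => y ycd.
  by apply: continuous_cnorm_comp; apply: cu; case: (frame x y); [right|].
have csq s t (f : R -> R) : {within `[s, t], continuous f} ->
    {within `[s, t], continuous (fun x => f x ^+ 2)}.
  by move=> cf x; apply: (@continuousM R (subspace `[s, t]) f f); exact: cf.
have hor y : y = c \/ y = d -> (G y < k%:E)%E ->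
    T * edge_int a b (fun x => cnorm (u (x +i* y)%C)) <= 7 / (2 * 10 ^+ 3) * T ^+ 2 + 200 * k.
  move=> ycd Gy; apply: le_trans (edge_AMGM T ab ba (chor y ycd)) _.
  rewrite lerD2l ler_pM2l//; apply/ltW.
  apply: (@edge_int_lt a b _ (fun x => phi (x, y))) Gy => //; first exact/csq/chor.
  - by move=> x _; rewrite sqr_ge0.
  - exact: measurableT_comp mphi (measurable_pair2 y).
  - by move=> x xab; apply: uphi; apply: frame; left.
have ver x : x = a \/ x = b -> (F x < k%:E)%E ->
    T * edge_int c d (fun y => cnorm (u (x +i* y)%C)) <= 7 / (2 * 10 ^+ 3) * T ^+ 2 + 200 * k.
  move=> xab Fx; apply: le_trans (edge_AMGM T cd dc (cver x xab)) _.
  rewrite lerD2l ler_pM2l//; apply/ltW.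
  apply: (@edge_int_lt c d _ (fun y => phi (x, y))) Fx => //; first exact/csq/cver.
  - by move=> y _; rewrite sqr_ge0.
  - exact: measurableT_comp mphi (measurable_pair1 x).
  - by move=> y ycd; apply: uphi; apply: frame; right.
have := cauchy_edges sa b1 sc d1 x1 y1 cu du dx0; rewrite -/T.
have := hor c (or_introl erefl) Gc; have := hor d (or_intror erefl) Gd.
have := ver a (or_introl erefl) Fa; have := ver b (or_intror erefl) Fb.
move: (edge_int _ _ _) (edge_int _ _ _) (edge_int _ _ _) (edge_int _ _ _) => J1 J2 J3 J4.
move=> h1 h2 h3 h4 h5.
(* The edge estimates give [T ^+ 2 <= 32 * 4 * (7 / 2000 + 200 / 10 ^+ 5) * T ^+ 2], and the factor
   is 0.704 < 1. *)
suff T00 : T ^+ 2 = 0.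
  by rewrite T00 mule_ge0// integral_ge0.
move: h1 h2 h3 h4 h5 T0; rewrite /k; clear; move: T => T *.
have : T * T <= T * (32 * (J4 + J1 + J3 + J2)) by rewrite ler_wpM2l//; lra.
rewrite -expr2; have := sqr_ge0 T; rewrite !mulrDr => *; lra.
Qed.

End CauchyL2.

(** * Integration over C^n *)

Section SigmaFinitePacking.
Context d (T : measurableType d) (R : realType) (m : {measure set T -> \bar R}).
Hypothesis m_sigma_finite : sigma_finite setT m.

(** A copy of [m] under a new name, to which sigma-finiteness, known for [m] only as a proposition,
    is attached as a structure for Fubini's theorem. *)
Definition pack_measure : set T -> \bar R := m.

HB.instance Definition _ := Measure.on pack_measure.
HB.instance Definition _ :=
  Measure_isSigmaFinite.Build _ _ _ pack_measure m_sigma_finite.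

Definition sigma_finite_pack : {sigma_finite_measure set T -> \bar R} := pack_measure.

End SigmaFinitePacking.

Lemma sigma_finite_product d1 d2 (T1 : measurableType d1) (T2 : measurableType d2)
    (R : realType) (m1 : {sigma_finite_measure set T1 -> \bar R})
    (m2 : {sigma_finite_measure set T2 -> \bar R}) :
  sigma_finite setT (m1 \x m2)%E.
Proof.
have [F FT Ffin] : sigma_finite setT m1 by exact: sigma_finiteT.
have [G GT Gfin] : sigma_finite setT m2 by exact: sigma_finiteT.
(* Numbers that encode no pair fall back on [(0, 0)], which only repeats a set of the covering. *)
pose ij k : nat * nat := odflt (0%N, 0%N) (unpickle k).
exists (fun k => F (ij k).1 `*` G (ij k).2).
  apply/seteqP; split=> // -[x y] _.
  have [i _ Fx] : (\bigcup_i F i) x by rewrite -FT.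
  have [j _ Gy] : (\bigcup_i G i) y by rewrite -GT.
  by exists (pickle (i, j)) => //; rewrite /ij pickleK.
move=> k; have [mF fF] := Ffin (ij k).1; have [mG fG] := Gfin (ij k).2.
split; first exact: measurableX.
by rewrite product_measure1E// lte_mul_pinfty// ge0_fin_numE.
Qed.

Section LebesgueCn.
Variable R : realType.
Local Notation mu := (@lebesgue_measure R).

Lemma lebesgueC_sigma_finite n : sigma_finite setT (lebesgueC R n).
Proof.
elim: n => [|n IH].
  exists (fun=> setT); first by rewrite bigcup_const.
  move=> _; split; first exact: measurableT.
  by rewrite /= diracT ltry.
pose m := sigma_finite_pack IH.
pose m1 := sigma_finite_pack (sigma_finite_product m mu).
have [F FT Ffin] : sigma_finite setT (m1 \x mu)%E by exact: sigma_finite_product.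
pose unconsC (t : n.+1.-tuple (cpair R)) :=
  (([tuple of behead t], (tnth t ord0).1), (tnth t ord0).2).
have munconsC : measurable_fun setT unconsC.
  have m0 : measurable_fun [set: n.+1.-tuple (cpair R)] (fun t => tnth t ord0).
    exact: measurable_tnth.
  apply: measurable_fun_pair.
    apply: measurable_fun_pair; first exact: measurable_behead.
    exact: measurableT_comp measurable_fst m0.
  exact: measurableT_comp measurable_snd m0.
exists (fun k => unconsC @^-1` F k).
  by rewrite -preimage_bigcup -FT preimage_setT.
move=> k; have [mFk finFk] := Ffin k; split.
  by rewrite -[X in measurable X]setTI; exact: munconsC.
rewrite /= /pushforward /=.
have unconsCK w : unconsC (consC w) = w.
  case: w => [[s x] y]; rewrite /unconsC.
  by have -> : [tuple of behead (consC (s, x, y))] = s by exact/val_inj.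
rewrite (_ : (@consC R n) @^-1` _ = F k)//.
by apply/seteqP; split=> w; rewrite /preimage/= unconsCK.
Qed.

Definition lebesgueC_sf n := sigma_finite_pack (lebesgueC_sigma_finite n).

Lemma measurable_integral_consC n (g : n.+1.-tuple (cpair R) -> \bar R) :
  measurable_fun setT g -> (forall t, 0 <= g t)%E ->
  measurable_fun setT (fun s => \int[mu]_x \int[mu]_y g (consC ((s, x), y)))%E.
Proof.
move=> mg g0; have mgc := measurableT_comp mg (@measurable_consC R n).
pose g1 (w : n.-tuple (cpair R) * measurableTypeR R) := (\int[mu]_y g (consC (w, y)))%E.
have mg1 : measurable_fun setT g1.
  by apply: (measurable_fun_fubini_tonelli_F (m2 := mu) (g \o @consC R n) mgc) => w; exact: g0.
apply: (measurable_fun_fubini_tonelli_F (m2 := mu) g1 mg1) => w.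
by apply: integral_ge0.
Qed.

Lemma integral_lebesgueC_cons n (g : n.+1.-tuple (cpair R) -> \bar R) :
  measurable_fun setT g -> (forall t, 0 <= g t)%E ->
  (\int[lebesgueC R n.+1]_t g t =
   \int[lebesgueC R n]_s \int[mu]_x \int[mu]_y g (consC ((s, x), y)))%E.
Proof.
move=> mg g0; have mgc := measurableT_comp mg (@measurable_consC R n).
pose g1 (w : n.-tuple (cpair R) * measurableTypeR R) := (\int[mu]_y g (consC (w, y)))%E.
have mg1 : measurable_fun setT g1.
  by apply: (measurable_fun_fubini_tonelli_F (m2 := mu) (g \o @consC R n) mgc) => w; exact: g0.
have g10 w : (0 <= g1 w)%E by apply: integral_ge0.
rewrite -(fubini_tonelli1 (m1 := lebesgueC_sf n) (m2 := mu) g1 mg1 g10).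
transitivity (\int[((lebesgueC_sf n \x mu) \x mu)]_w (g \o @consC R n) w)%E.
  rewrite -[RHS](@ge0_integral_pushforward _ _ _ _ R (@consC R n) (@measurable_consC R n)
    ((lebesgueC_sf n \x mu) \x mu)%E setT g)//.
rewrite (fubini_tonelli1 (m1 := sigma_finite_pack (sigma_finite_product (lebesgueC_sf n) mu)) (m2 := mu) (g \o @consC R n) mgc)//.
by move=> w; exact: g0.
Qed.

End LebesgueCn.

Lemma measurable_patch d (T : measurableType d) (R : realType) (D : set T) (f : T -> \bar R) :
  measurable D -> measurable_fun setT f -> measurable_fun setT (f \_ D).
Proof.
by move=> mD mf; apply/(measurable_restrictT f mD); apply: measurable_funS mf.
Qed.

(** * The mean value inequality, one variable after another *)

Section IteratedBound.
Variable R : realType.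
Local Notation mu := (@lebesgue_measure R).
Local Notation cpair := (cpair R).

Definition pointC (q : cpair) : cplx R := (q.1 +i* q.2)%C.

Definition in_box (q : cpair) : Prop :=
  rectangle (- (7 / 5)) (7 / 5) (- (7 / 5)) (7 / 5) (pointC q).

Definition in_frame (q : cpair) : Prop := box_frame (pointC q).

Definition in_unit (q : cpair) : Prop := `|q.1| <= 1 /\ `|q.2| <= 1.

Lemma in_frame_box q : in_frame q -> in_box q.
Proof. by case. Qed.

Lemma in_unit_box q : in_unit q -> in_box q.
Proof.
rewrite /in_unit !ler_norml => -[/andP[? ?] /andP[? ?]].
by split=> /=; apply/andP; split; lra.
Qed.

Definition boxes n : set (n.-tuple cpair) := [set t | forall k, in_box (tnth t k)].

Definition frames n : set (n.-tuple cpair) := [set t | forall k, in_frame (tnth t k)].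

Arguments boxes n : clear implicits.
Arguments frames n : clear implicits.

Lemma measurable_in_box : measurable [set q : cpair | in_box q].
Proof.
rewrite (_ : [set q | _] = fst @^-1` `[- (7 / 5), 7 / 5]%classic `&` snd @^-1` `[- (7 / 5), 7 / 5]%classic).
  apply: measurableI; rewrite -[X in measurable X]setTI.
    by apply: measurable_fst => //; exact: measurable_itv.
  by apply: measurable_snd => //; exact: measurable_itv.
by apply/seteqP; split=> q /=; rewrite !in_itv.
Qed.

Lemma measurable_in_frame : measurable [set q : cpair | in_frame q].
Proof.
rewrite (_ : [set q | _] = [set q | in_box q] `&`
    (fst @^-1` (~` `]- (6 / 5), 6 / 5[%classic) `|` snd @^-1` (~` `]- (6 / 5), 6 / 5[%classic))).
  apply: measurableI; first exact: measurable_in_box.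
  apply: measurableU; rewrite -[X in measurable X]setTI.
    by apply: measurable_fst => //; apply: measurableC; exact: measurable_itv.
  by apply: measurable_snd => //; apply: measurableC; exact: measurable_itv.
have far (x : R) : 6 / 5 <= `|x| <-> ~ (- (6 / 5) < x < 6 / 5).
  by rewrite -ltr_norml leNgt; split=> /negP.
apply/seteqP; split=> q [bq]; rewrite /= !in_itv/=.
  by move=> fq; split=> //; case: fq => /far h; [left|right].
by move=> fq; split=> //; case: fq => h; [left|right]; apply/far.
Qed.

Lemma measurable_forall_tnth n (A : set cpair) : measurable A ->
  measurable [set t : n.-tuple cpair | forall k, A (tnth t k)].
Proof.
move=> mA.
rewrite (_ : [set t | _] = \bigcap_(k in [set: 'I_n]) ((fun t => tnth t k) @^-1` A)); last first.
  by apply/seteqP; split=> [t h k _|t h k]; [exact: h|exact: (h k Logic.I)].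
apply: fin_bigcap_measurable => // k _.
by rewrite -[X in measurable X]setTI; exact: measurable_tnth.
Qed.

Lemma measurable_boxes n : measurable (boxes n).
Proof. exact: measurable_forall_tnth measurable_in_box. Qed.

Lemma measurable_frames n : measurable (frames n).
Proof. exact: measurable_forall_tnth measurable_in_frame. Qed.

Arguments measurable_boxes n : clear implicits.
Arguments measurable_frames n : clear implicits.

Definition upd n (t : n.-tuple cpair) (k : 'I_n) (q : cpair) : n.-tuple cpair :=
  [tuple if j == k then q else tnth t j | j < n].

Lemma upd_cons0 n (t : n.-tuple cpair) p q :
  upd [tuple of p :: t] ord0 q = [tuple of q :: t].
Proof.
apply: eq_from_tnth => j; rewrite tnth_mktuple.
by case: (unliftP ord0 j) => [i ->|->] /=; rewrite ?tnthS ?tnth0.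
Qed.

Lemma upd_consS n (t : n.-tuple cpair) p q k :
  upd [tuple of p :: t] (lift ord0 k) q = [tuple of p :: upd t k q].
Proof.
apply: eq_from_tnth => j; rewrite tnth_mktuple.
by case: (unliftP ord0 j) => [i ->|->]; rewrite ?tnthS ?tnth0// tnth_mktuple (inj_eq lift_inj).
Qed.

(* The last hypothesis is a mean value inequality in each variable separately. *)
Lemma iterated_bound (K : R) n (phi : n.-tuple cpair -> \bar R) : 0 <= K ->
  measurable_fun setT phi -> (forall t, 0 <= phi t)%E ->
  (forall t k, boxes n t -> in_unit (tnth t k) ->
    forall psi : cpair -> \bar R, measurable_fun setT psi -> (forall q, 0 <= psi q)%E ->
    (forall q, in_frame q -> (phi (upd t k q) <= psi q)%E) ->
    (phi t <= K%:E * \int[mu]_x \int[mu]_y psi (x, y))%E) ->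
  forall t, (forall k, in_unit (tnth t k)) ->
    (phi t <= (K ^+ n)%:E * \int[lebesgueC R n]_(s in frames n) phi s)%E.
Proof.
move=> K0; elim: n phi => [|n IH] phi mphi phi0 H t ut.
  rewrite expr0 mul1e integral_mkcond integral_dirac//; last first.
    exact: measurable_patch (measurable_frames 0) mphi.
  rewrite diracT mul1e (tuple0 t) patchE ifT// inE/= => k.
  by case: k.
case/tupleP: t ut => q t ut.
have uq : in_unit q by have := ut ord0; rewrite tnth0.
have utt k : in_unit (tnth t k) by have := ut (lift ord0 k); rewrite tnthS.
pose phi' (s : n.-tuple cpair) := phi [tuple of q :: s].
have mphi' : measurable_fun setT phi'.
  apply: measurableT_comp mphi _; apply: measurable_cons; first exact: measurable_cst.
  exact: measurable_id.
(* The tail is integrated by induction with the head [q] fixed in the unit square; [step2] then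
   treats the head for each tail [s] in the frames. *)
have step1 : (phi [tuple of q :: t] <=
    (K ^+ n)%:E * \int[lebesgueC R n]_(s in frames n) phi' s)%E.
  apply: (IH phi' mphi' _ _ t utt) => [s|s k bs us psi mpsi psi0 hpsi]; first exact: phi0.
  apply: (H [tuple of q :: s] (lift ord0 k) _ _ psi mpsi psi0).
  - move=> j; case: (unliftP ord0 j) => [i ->|->]; rewrite ?tnthS ?tnth0//.
    exact: in_unit_box.
  - by rewrite tnthS.
  - by move=> p fp; rewrite upd_consS; exact: hpsi.
(* The cut-off is a measurable majorant in the head variable: for a tail in the frames and a head in
   the frame it agrees with [phi]. *)
pose Phi := phi \_ (frames n.+1).
have mPhi : measurable_fun setT Phi.
  exact: measurable_patch (measurable_frames n.+1) mphi.
have Phi0 s : (0 <= Phi s)%E by rewrite /Phi patchE; case: ifP.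
have mI := measurable_integral_consC mPhi Phi0.
have step2 : (\int[lebesgueC R n]_(s in frames n) phi' s <=
    K%:E * \int[lebesgueC R n.+1]_(s in frames n.+1) phi s)%E.
  rewrite [X in (_ <= _ * X)%E]integral_mkcond integral_lebesgueC_cons//.
  rewrite -ge0_integralZl//; last first.
    by move=> s _; apply: integral_ge0 => x _; exact: integral_ge0.
  apply: (@le_trans _ _ (\int[lebesgueC R n]_(s in frames n)
      (K%:E * \int[mu]_x \int[mu]_y Phi (consC (s, x, y))))%E); last first.
    apply: ge0_subset_integral => //; first exact: measurable_frames.
      exact: measurable_funeM.
    move=> s _; rewrite mule_ge0// integral_ge0// => x _; exact: integral_ge0.
  apply: ge0_le_integral => //; first exact: measurable_frames.
  - by move=> s _; exact: phi0.
  - exact: measurable_funTS.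
  - by apply: measurable_funTS; exact: measurable_funeM.
  move=> s fs; rewrite /phi'.
  apply: (H [tuple of q :: s] ord0 _ _ (fun p => Phi (consC (s, p.1, p.2)))).
  - move=> j; case: (unliftP ord0 j) => [i ->|->]; rewrite ?tnthS ?tnth0//.
      exact/in_frame_box.
    exact: in_unit_box.
  - by rewrite tnth0.
  - apply: measurableT_comp mPhi _; apply: measurableT_comp (@measurable_consC R n) _.
    apply: measurable_fun_pair; last exact: measurable_snd.
    by apply: measurable_fun_pair; [exact: measurable_cst|exact: measurable_fst].
  - by [].
  - move=> p fp; rewrite upd_cons0 /Phi patchE ifT; first by case: p {fp}.
    rewrite inE => j; case: (unliftP ord0 j) => [i ->|->].
      by rewrite /consC tnthS; exact: fs.
    by rewrite /consC tnth0/=; case: p fp.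
apply: (le_trans step1); rewrite exprSr EFinM -muleA.
by apply: lee_wpmul2l => //; rewrite lee_fin exprn_ge0.
Qed.

End IteratedBound.

(** * Measurability of open sets in real coordinates *)

Section MeasurableVecC.
Variable R : realType.
Local Notation C := (cplx R).
Local Notation cpair := (cpair R).

Lemma vecCE n (t : n.-tuple cpair) k : vecC t 0 k = pointC (tnth t k).
Proof. by rewrite mxE. Qed.

Definition rat_cube n (a : (n.-tuple (rat * rat)) * rat) : set 'rV[C]_n :=
  [set z | forall k, `|complex.Re (z 0 k) - ratr (tnth a.1 k).1| < ratr a.2 /\
                     `|complex.Im (z 0 k) - ratr (tnth a.1 k).2| < ratr a.2].

Lemma measurable_vecC_cube n (a : (n.-tuple (rat * rat)) * rat) :
  measurable (vecC (n := n) @^-1` rat_cube a).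
Proof.
rewrite (_ : _ @^-1` _ = \bigcap_(k in [set: 'I_n])
  ((fun t => tnth t k) @^-1` (fst @^-1` (ball (ratr (tnth a.1 k).1 : R) (ratr a.2)) `&`
    snd @^-1` (ball (ratr (tnth a.1 k).2 : R) (ratr a.2))))); last first.
  apply/seteqP; split=> t h k.
    by move=> _; have := h k; rewrite vecCE /= /ball/= !(distrC (ratr _)).
  by have := h k Logic.I; rewrite vecCE /= /ball/= !(distrC (ratr _)).
apply: fin_bigcap_measurable => // k _.
rewrite -[X in measurable X]setTI; apply: measurable_tnth => //.
apply: measurableI; rewrite -[X in measurable X]setTI.
  by apply: measurable_fst => //; apply: measurable_ball.
by apply: measurable_snd => //; apply: measurable_ball.
Qed.

(** Writing open sets as countable unions of cubes reduces their measurability to that of products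
    of intervals. *)
Lemma open_rat_cubes n (V : set 'rV[C]_n) : open V ->
  V = \bigcup_(a in [set a | rat_cube a `<=` V]) rat_cube a.
Proof.
move=> oV; apply/seteqP; split=> [z Vz|z [a aV] /aV//].
have /nbhs_rowP[r r0 rV] : nbhs z V by exact: open_nbhs_nbhs.
have [e /andP[e0 er]] : exists e : rat, 0 < (ratr e : R) < r / 4.
  have : 0 < r / 4 by rewrite divr_gt0.
  by move=> /rat_in_itvoo[e]; rewrite in_itv/=; exists e.
have app (x : R) : {q : rat | `|x - ratr q| < ratr e}.
  apply: cid; have : x - ratr e < x + ratr e by lra.
  move=> /rat_in_itvoo[q]; rewrite in_itv/= => /andP[q1 q2]; exists q.
  by rewrite ltr_norml; apply/andP; split; lra.
pose a := ([tuple (projT1 (app (complex.Re (z 0 k))), projT1 (app (complex.Im (z 0 k)))) | k < n], e).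
exists a => [w wa|k]; last by rewrite tnth_mktuple/=; split; case: (app _).
apply: rV => k; have [] := wa k; rewrite tnth_mktuple/=.
case: (app _) => q1 /=; case: (app _) => q2 /=; rewrite !ltr_norml => /andP[? ?] /andP[? ?].
move=> /andP[? ?] /andP[? ?].
apply: (le_lt_trans (cnorm_le_ReIm _)).
have -> : complex.Re (w 0 k - z 0 k) = complex.Re (w 0 k) - complex.Re (z 0 k).
  by case: (w 0 k) (z 0 k) => ? ? [].
have -> : complex.Im (w 0 k - z 0 k) = complex.Im (w 0 k) - complex.Im (z 0 k).
  by case: (w 0 k) (z 0 k) => ? ? [].
have h1 : `|complex.Re (w 0 k) - complex.Re (z 0 k)| < 2 * ratr e.
  by rewrite ltr_norml; apply/andP; split; lra.
have h2 : `|complex.Im (w 0 k) - complex.Im (z 0 k)| < 2 * ratr e.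
  by rewrite ltr_norml; apply/andP; split; lra.
by lra.
Qed.

Lemma measurable_vecC_open n (V : set 'rV[C]_n) : open V ->
  measurable (vecC (n := n) @^-1` V).
Proof.
move=> /open_rat_cubes ->; rewrite preimage_bigcup bigcup_mkcond.
apply: countable_bigcupT_measurable; first exact: countableP.
by move=> a; case: ifP => // _; exact: measurable_vecC_cube.
Qed.

Lemma measurable_borel_open (X : ptopologicalType) (V : set X) : open V ->
  @measurable _ (borel X) V.
Proof. exact: sub_sigma_algebra. Qed.

Lemma continuous_measurable_comp d (T : measurableType d) (U : topologicalType)
    (v : T -> U) (O : set U) (g : U -> R) :
  (forall V, open V -> measurable (v @^-1` V)) -> open O ->
  (forall z, O z -> {for z, continuous g}) ->
  measurable_fun (v @^-1` O) (g \o v).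
Proof.
move=> mv oO cg; apply: (measurability _ (RGenOInfty.measurableE R)) => _ [_ [x ->] <-].
rewrite (_ : _ `&` _ = v @^-1` (O `&` g @^-1` `]x, +oo[%classic)).
  apply: mv; rewrite openE => z [Oz gz].
  apply: filterI; first exact: open_nbhs_nbhs.
  by apply: (cg z Oz); apply: open_nbhs_nbhs; split=> //; exact: interval_open.
by [].
Qed.

End MeasurableVecC.

(** * Compactness and local bounds *)

Section CompactnessCn.
Variable R : realType.
Local Notation C := (cplx R).

Lemma compact_locally_bounded (T : topologicalType) (K : set T) (g : T -> R) :
  compact K ->
  (forall x, K x -> exists V b, nbhs x V /\ forall y, V y -> K y -> g y <= b) ->
  exists b, forall y, K y -> g y <= b.
Proof.
move=> /compact_near_coveringP cK loc.
have [|b0 [_ Hb]] := cK R (+oo%R) (fun b y => K y -> g y <= b) _.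
  move=> x Kx; have [V [b [xV Vb]]] := loc x Kx.
  exists (V, [set b' | b < b']); first by split=> //; exists b; split=> //; exact: num_real.
  by move=> [y b'] [/= Vy bb'] Ky; exact: le_trans (Vb y Vy Ky) (ltW bb').
exists (b0 + 1) => y Ky; apply: (Hb (b0 + 1)) => //; by rewrite ltrDl.
Qed.

Lemma compact_cdisk (a : C) (r : R) : compact [set z : C | cnorm (z - a) <= r].
Proof.
pose f (q : R * R) : C := (q.1 +i* q.2)%C.
pose I1 := `[complex.Re a - r, complex.Re a + r]%classic.
pose I2 := `[complex.Im a - r, complex.Im a + r]%classic.
have cS : compact (f @` (I1 `*` I2)).
  apply: continuous_compact; last by apply: compact_setX; exact: segment_compact.
  apply: continuous_subspaceT => q; apply/continuous_cnormP => e e0.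
  have e2 : 0 < e / 2 by rewrite divr_gt0.
  exists (ball q.1 (e / 2), ball q.2 (e / 2)); first by split; exact: nbhsx_ballx.
  move=> [x y] [bx by_]; apply: (le_lt_trans (cnorm_le_ReIm (f (x, y) - f q))) => /=.
  by move: bx by_; rewrite /ball/= !(distrC _ x) !(distrC _ y); lra.
apply: subclosed_compact cS _.
  rewrite (_ : [set z | _] = (fun z : C => cnorm (z - a)) @^-1` [set x | x <= r]).
    apply: closed_comp; last exact: closed_le.
    move=> z _.
    exact: (continuous_cnorm_comp (ccontinuousB (ccontinuous_id z) (ccontinuous_cst a z))).
  by [].
move=> z /= zr; exists (complex.Re z, complex.Im z); last by case: (z).
have h1 := le_trans (Re_le_cnorm _) zr; have h2 := le_trans (Im_le_cnorm _) zr.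
move: h1 h2; case: z {zr} => x y; case: (a) @I1 @I2 => a1 a2 /=.
rewrite !ler_norml => /andP[? ?] /andP[? ?]; split; rewrite /= in_itv/=; apply/andP; split; lra.
Qed.

Lemma compact_row n (A : 'I_n -> set C) : (forall k, compact (A k)) ->
  compact [set z : 'rV[C]_n | forall k, A k (z 0 k)].
Proof. by move=> cA; exact: (@rV_compact C n A cA). Qed.

Lemma compact_polydisk n (a : 'I_n -> C) (r : R) :
  compact [set z : 'rV[C]_n | forall k, cnorm (z 0 k - a k) <= r].
Proof.
apply: (compact_row (A := fun k => [set w | cnorm (w - a k) <= r])) => k.
exact: compact_cdisk.
Qed.

Lemma compact_polydisk0 n (r : R) : compact [set z : 'rV[C]_n | forall k, cnorm (z 0 k) <= r].
Proof.
have := @compact_polydisk n (fun=> 0) r; congr compact.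
by apply/seteqP; split=> z h k; have := h k; rewrite subr0.
Qed.

End CompactnessCn.

(** * The normal coordinate and the canonical section *)

Section Slices.
Variables (R : realType) (n : nat).
Local Notation C := (cplx R).
Implicit Types (F : 'rV[C]_n -> C) (z w : 'rV[C]_n).

Definition slice z (k : 'I_n) (a : C) : 'rV[C]_n := \row_j (if j == k then a else z 0 j).

Lemma slice_id z k : slice z k (z 0 k) = z.
Proof. by apply/rowP => j; rewrite mxE; case: eqP => [->|]. Qed.

Lemma sliceE z k a j : slice z k a 0 j = if j == k then a else z 0 j.
Proof. by rewrite mxE. Qed.

Lemma slice_shift z k (h s a : C) :
  slice z k (s * (h * 1 + a)) = h *: (s *: 'e_k) + slice z k (s * a).
Proof.
apply/rowP => j; rewrite !mxE eqxx/= mulr1 mulrDr.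
by case: (j == k); rewrite ?mulr1 ?mulr0 ?add0r// [s * h]mulrC.
Qed.

Lemma derive_slice F z k (s a : C) :
  (fun h => h^-1 *: (((fun b => F (slice z k (s * b))) \o shift a) (h *: 1) -
     F (slice z k (s * a)))) =
  (fun h => h^-1 *: ((F \o shift (slice z k (s * a))) (h *: (s *: 'e_k)) -
     F (slice z k (s * a)))).
Proof. by apply/funext => h; rewrite /= -slice_shift. Qed.

Lemma derivable_slice F z k (s a : C) : differentiable F (slice z k (s * a)) ->
  derivable (fun b => F (slice z k (s * b))) a 1.
Proof.
by move=> /(diff_derivable (v := s *: 'e_k)); rewrite /derivable -derive_slice.
Qed.

Lemma derive1_slice F z k (s a : C) :
  'D_1 (fun b => F (slice z k (s * b))) a = 'D_(s *: 'e_k) F (slice z k (s * a)).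
Proof. by rewrite /derive derive_slice. Qed.

End Slices.

Section LocalLowerBound.
Variables (R : realType) (n : nat).
Local Notation C := (cplx R).
Implicit Types (F : 'rV[C]_n.+1 -> C) (z w : 'rV[C]_n.+1).

Definition near_row z w (r : R) := forall k, cnorm (w 0 k - z 0 k) < r.

(* All tangential derivatives vanish, so the normal one does not. *)
Lemma normal_derive_neq0 F z r w : 0 < r -> near_row z w r -> w 0 0 = 0 ->
  (forall w, near_row z w r -> w 0 0 = 0 -> F w = 0) ->
  differentiable F w -> (exists v, 'D_v F w != 0) ->
  forall s : C, s != 0 -> 'D_(s *: 'e_0) F w != 0.
Proof.
move=> r0 wz w0 F0 dF [v Dv] s s0.
have lin (u : 'rV[C]_n.+1) : 'D_u F w = \sum_k u 0 k * 'D_('e_k) F w.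
  rewrite deriveE// {1}(row_sum_delta u) raddf_sum/=; apply: eq_bigr => k _.
  by rewrite linearZ/= deriveE.
have tang (k : 'I_n.+1) : k != 0 -> 'D_('e_k) F w = 0.
  move=> k0; rewrite /derive; apply: cvg_lim; first exact: norm_hausdorff.
  have near0 : \forall h \near (0 : C)^', (fun=> 0) h =
      h^-1 *: ((F \o shift w) (h *: 'e_k) - F w).
    apply/nbhs_cnormP; exists (r - cnorm (w 0 k - z 0 k)); first by rewrite subr_gt0.
    move=> h; rewrite subr0 => hr _ /=; rewrite !F0 ?subr0 ?scaler0//.
      move=> j; rewrite !mxE eqxx/=; have [->|_] := eqVneq j k; last first.
        by rewrite mulr0 add0r.
      rewrite mulr1 -addrA (le_lt_trans (cnormD _ _))//; lra.
    by rewrite !mxE eqxx eq_sym (negbTE k0) mulr0 add0r.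
  by apply: cvg_trans (near_eq_cvg near0) _; exact: cvg_cst.
have De0 : 'D_('e_0) F w != 0.
  apply: contra Dv => /eqP D0; rewrite lin big1// => k _.
  by have [->|k0] := eqVneq k 0; rewrite ?D0 ?tang// mulr0.
rewrite lin (bigD1 0)//= big1 ?addr0; last by move=> k k0; rewrite !mxE (negbTE k0) !mulr0 mul0r.
by rewrite !mxE !eqxx mulr1 mulf_neq0.
Qed.

(** Along the normal line through [w], [v a := F (slice w 0 (S * a))] has its only zero at 0 and it
    is simple, so [k a := v a / a] has no zero. The bound on [|F|^-1] over the compact set [K], away
    from the hypersurface, controls [1 / k] on the frame, and the Cauchy estimate carries it
    inside. *)
Lemma local_lower_bound F z r : 0 < r -> z 0 0 = 0 ->
  (forall w, near_row z w r -> differentiable F w) ->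
  (forall w, near_row z w r -> (F w = 0 <-> w 0 0 = 0)) ->
  (forall w, near_row z w r -> w 0 0 = 0 -> exists v, 'D_v F w != 0) ->
  exists A r' : R, 0 < r' /\ forall w, near_row z w r' -> cnorm (w 0 0) <= A * cnorm (F w).
Proof.
move=> r0 z0 dF F0 DF.
(* The rescaled line uses [|a| <= 2], so normal coordinates stay at most [2 * s = r / 4], within the
   radius [r / 2] of [K]. *)
pose s := r / 8; have s0 : 0 < s by rewrite divr_gt0.
have sr : 8 * s = r by rewrite /s; field.
pose K := [set w : 'rV[C]_n.+1 | forall k, (fun k : 'I_n.+1 =>
   [set a | cnorm (a - z 0 k) <= r / 2] `&` (if k == 0 then [set a : C | s <= cnorm a] else setT)) k (w 0 k)].
have cK : compact K.
  apply: compact_row => k; have [->|k0] := eqVneq k 0; last first.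
    by rewrite setIT; exact: compact_cdisk.
  apply: (@subclosed_compact C _ [set a : C | cnorm (a - z 0 0) <= r / 2]);
    [|exact: compact_cdisk|by move=> a []].
  apply: closedI; first by apply: compact_closed; [exact: norm_hausdorff|exact: compact_cdisk].
  rewrite (_ : [set a | _] = (fun a : C => cnorm a) @^-1` [set x | s <= x]); last by [].
  apply: closed_comp; last exact: closed_ge.
  by move=> a _; exact: (continuous_cnorm_comp (ccontinuous_id a)).
have K_near w : K w -> near_row z w r.
  by move=> Kw k; have [/= h _] := Kw k; apply: (le_lt_trans h); lra.
have K_neq0 w : K w -> F w != 0.
  move=> Kw; apply/eqP => /(F0 w (K_near w Kw)) w0.
  have [_ /=] := Kw 0; rewrite w0 cnorm0; lra.
have [B HB] : exists b, forall w, K w -> cnorm (F w)^-1 <= b.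
  apply: compact_locally_bounded cK _ => w Kw.
  have cF : {for w, continuous F} by apply: differentiable_continuous; exact/dF/K_near.
  have := continuous_cnormP (fun x => (F x)^-1) w.
  move=> [/(_ (ccontinuousV (K_neq0 w Kw) cF)) /(_ 1 ltr01) near1 _].
  exists [set y | cnorm ((F y)^-1 - (F w)^-1) < 1], (cnorm (F w)^-1 + 1); split=> // y /= /ltW h _.
  rewrite -lerBlDl; apply: le_trans h; exact: le_trans (ler_norm _) (ler_cdist _ _).
(* On the frame [|1 / k a| = |a| / |v a| <= 2 * B]; the Cauchy estimate gives the factor 400, and at
   [x0 = w 0 0 / s] the modulus of [1 / k] is [|w 0 0| / (s * |F w|)]. *)
exists (400 * (2 * B) * s), s; split=> // w wz.
have [w00|w00] := eqVneq (w 0 0) 0.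
  (* The sign of [B] is read off at a point of [K], obtained from [w] by setting its normal
     coordinate to [s]. *)
  suff B0 : 0 <= B.
    rewrite w00 cnorm0; apply: mulr_ge0; last exact: cnorm_ge0.
    by apply: mulr_ge0 (ltW s0); apply: mulr_ge0; [exact: ler0n|exact: mulr_ge0].
  pose a : C := (s%:C)%C.
  have Ka : K (slice w 0 a).
    move=> k /=; rewrite sliceE; have [->|k0] := eqVneq k 0.
      by rewrite z0 subr0 /a; split=> /=; rewrite cnorm_real gtr0_norm//; lra.
    by split=> //=; apply: (le_trans (ltW (wz k))); lra.
  exact: le_trans (cnorm_ge0 _) (HB _ Ka).
pose S : C := (s%:C)%C.
have S0 : S != 0 by rewrite -cnorm_gt0 cnorm_real gtr0_norm.
have nS : cnorm S = s by rewrite cnorm_real gtr0_norm.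
pose v (a : C) := F (slice w 0 (S * a)).
have slice_near a : cnorm a <= 2 -> near_row z (slice w 0 (S * a)) r.
  move=> a2 k; rewrite sliceE; have [->|k0] := eqVneq k 0.
    rewrite z0 subr0 cnormM nS; apply: (@le_lt_trans _ _ (s * 2)); first by rewrite ler_pM2l.
    by lra.
  by apply: (lt_trans (wz k)); lra.
have dv a : cnorm a <= 2 -> derivable v a 1.
  by move=> a2; apply: derivable_slice; exact/dF/slice_near.
have n02 : cnorm (0 : C) <= 2 by rewrite cnorm0.
have D0 : 'D_1 v 0 != 0.
  rewrite /v derive1_slice; have near0 := slice_near 0 n02.
  have w0 : slice w 0 (S * 0) 0 0 = 0 by rewrite sliceE eqxx mulr0.
  apply: (normal_derive_neq0 r0 near0 w0) => //.
  - by move=> w' nw' w'0; apply/F0.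
  - exact: dF.
  - exact: DF.
have [cv dkv] := continuous_cauchy_kernel (dv 0 n02).
set k := cauchy_kernel v 0 ('D_1 v 0) in cv dkv.
have v00 : v 0 = 0.
  by apply/F0; [exact: slice_near|rewrite sliceE eqxx mulr0].
have kE a : a != 0 -> k a = v a / a.
  by move=> a0; rewrite /k /cauchy_kernel (negbTE a0) v00 !subr0.
have k_neq0 a : cnorm a <= 2 -> k a != 0.
  move=> a2; have [->|a0] := eqVneq a 0; first by rewrite /k /cauchy_kernel eqxx.
  rewrite kE// mulf_neq0 ?invr_neq0//; apply/eqP => /(F0 _ (slice_near a a2)).
  by rewrite sliceE eqxx => /eqP; rewrite mulf_eq0 (negbTE S0) (negbTE a0).
have box2 := @box_cnorm R.
pose x0 : C := w 0 0 / S.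
have x01 : cnorm x0 <= 1.
  rewrite cnormM cnormV nS ler_pdivrMr// mul1r.
  by have := wz 0; rewrite z0 subr0 => /ltW.
have x02 : cnorm x0 <= 2 by rewrite (le_trans x01)// ler1n.
have x00 : x0 != 0 by rewrite mulf_neq0// invr_neq0.
have := @cauchy_sup R (fun a => (k a)^-1) x0 (2 * B).
move=> /(_ (le_trans (Re_le_cnorm _) x01) (le_trans (Im_le_cnorm _) x01)).
move=> /(_ (fun a ba => ccontinuousV (k_neq0 a (box2 a ba)) (cv a (cderivable_continuous (dv a (box2 a ba)))))).
move=> /(_ (fun a ba a0 => cderivableV (k_neq0 a (box2 a ba)) (dkv a a0 (dv a (box2 a ba))))).
move=> /(_ (cderivableV (k_neq0 x0 x02) (dkv x0 (elimN eqP x00) (dv x0 x02)))).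
have bnd a : box_frame a -> cnorm (k a)^-1 <= 2 * B.
  move=> fa; have /andP[a1 a2] := box_frame_cnorm fa.
  have a0 : a != 0 by rewrite -cnorm_gt0; apply: lt_le_trans a1.
  have Ka : K (slice w 0 (S * a)).
    move=> j /=; rewrite sliceE; have [->|j0] := eqVneq j 0.
      rewrite z0 subr0; split=> /=.
        by apply: (@le_trans _ _ (s * 2)); [rewrite cnormM nS ler_pM2l|lra].
      by rewrite cnormM nS -[X in X <= _]mulr1 ler_pM2l.
    by split=> //=; apply: (le_trans (ltW (wz j))); lra.
  rewrite kE// invf_div cnormM; apply: ler_pM; rewrite ?cnorm_ge0//.
  exact: HB.
move=> /(_ bnd); rewrite kE// invf_div cnormM cnormV cnormM cnormV nS.
have -> : v x0 = F w by rewrite /v /x0 mulrC divfK// slice_id.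
have Fw0 : 0 < cnorm (F w).
  rewrite cnorm_gt0; apply/eqP => /F0 h; move/eqP: w00; apply; apply: h => j.
  by apply: (lt_trans (wz j)); lra.
rewrite ler_pdivrMr// ler_pdivrMr// => h; apply: (le_trans h).
by rewrite mulrAC.
Qed.

End LocalLowerBound.

(** * Charts, holomorphic functions and norms of sections *)

Section Charts.
Variables (R : realType) (n : nat) (X : ptopologicalType) (M : complex_manifold R n X).
Local Notation C := (cplx R).
Implicit Types (c : chart R n X) (x y : X).

Lemma chart_invK c x : chart_dom c x -> chart_inv c (c x) = x.
Proof. by move=> cx; apply: chart_mapK; exact: mem_set. Qed.

Lemma nbhs_chart_dom c x : chart_dom c x -> nbhs x (chart_dom c).
Proof. by move=> cx; apply: open_nbhs_nbhs; split=> //; exact: chart_dom_open. Qed.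

Lemma nbhs_chart_preimage c x A : chart_dom c x -> nbhs (c x) A ->
  nbhs x [set y | chart_dom c y /\ A (c y)].
Proof.
move=> cx cA; apply: filterI; first exact: nbhs_chart_dom.
exact: (chart_map_cont cx).
Qed.

Lemma nbhs_chart_image c x (V : set X) : chart_dom c x -> nbhs x V ->
  nbhs (c x) [set z | exists y, [/\ chart_dom c y, V y & c y = z]].
Proof.
move=> cx xV.
have cod : nbhs (c x) (c @` chart_dom c).
  by apply: open_nbhs_nbhs; split; [exact: chart_cod_open|exists x].
have inv : nbhs (c x) (chart_inv c @^-1` V).
  by apply: (chart_inv_cont (c := c)); [exists x|rewrite chart_invK].
apply: filterS2 cod inv => z [y cy <-]; rewrite /preimage/= chart_invK// => Vy.
by exists y.
Qed.

Lemma holomorphic_continuous (U : set X) (f : X -> C) x :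
  holomorphic_on M U f -> U x -> {for x, continuous f}.
Proof.
move=> hf Ux; have [c Mc cx] := atlas_cover M x.
have cf : {for c x, continuous (f \o chart_inv c)}.
  exact: (differentiable_continuous (hf c x Mc cx Ux)).
have eqf : {near x, (f \o chart_inv c) \o c =1 f}.
  by apply: filterS (nbhs_chart_dom cx) => y cy /=; rewrite chart_invK.
apply: near_eq_continuous eqf _.
exact: (continuous_comp (chart_map_cont cx) cf).
Qed.

Lemma smooth_continuous (U : set X) (g : X -> R) x :
  smooth_on M U g -> U x -> {for x, continuous g}.
Proof.
move=> hg Ux; have [c Mc cx] := atlas_cover M x.
have cg : {for c x, continuous (g \o chart_inv c)}.
  by have [+ _] := hg c Mc 0%N; apply; exists x.
have eqg : {near x, (g \o chart_inv c) \o c =1 g}.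
  by apply: filterS (nbhs_chart_dom cx) => y cy /=; rewrite chart_invK.
apply: near_eq_continuous eqg _.
exact: (continuous_comp (chart_map_cont cx) cg).
Qed.

Lemma chart_image_compact c (K : set 'rV[C]_n) : K `<=` chart_cod c -> compact K ->
  compact [set x | chart_dom c x /\ K (c x)].
Proof.
move=> Kc cK; rewrite (_ : [set x | _] = chart_inv c @` K).
  apply: continuous_compact cK; apply: continuous_in_subspaceT => z /set_mem Kz.
  by apply: chart_inv_cont; exact: Kc.
apply/seteqP; split=> [x [cx Kx]|_ [z Kz <-]].
  by exists (c x) => //; exact: chart_invK.
by have [y cy yz] := Kc z Kz; move: Kz; rewrite -yz chart_invK.
Qed.

Lemma hnormE (L : line_bundle M) (h : lb_metric L) U (s : sect L) i x :
  holomorphic_section U s -> U x -> lb_dom i x ->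
  hnorm h s x = cnorm (s i x) * expR (- weight h i x).
Proof.
move=> [_ trs] Ux ix; rewrite /hnorm (trs (lb_at L x) i x Ux (@lb_atP _ _ _ _ L x) ix).
rewrite (weight_compat h (@lb_atP _ _ _ _ L x) ix) Normc.normcM mulrA.
by congr (_ * _); rewrite mulrC.
Qed.

End Charts.

Section HypersurfaceBound.
Variables (R : realType) (n : nat) (X : ptopologicalType) (M : complex_manifold R n.+1 X).
Local Notation C := (cplx R).
Variables (Sigma : set X) (O : line_bundle M) (S : sect O) (h : lb_metric O).
Hypothesis S_can : canonical_section Sigma S.
Hypothesis h_smooth : smooth_metric h.

(** Off Sigma the section does not vanish and continuity suffices; on Sigma the lower bound for a
    simple zero applies to [S i] in the chart. The weight is continuous, so passing from [|S i|] to
    the norm costs a factor [e^(weight + 1)] near [x]. *)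
Lemma normal_coord_locally_bounded c x : atlas M c -> adapted Sigma c -> chart_dom c x ->
  exists V A, [/\ nbhs x V, 0 <= A & forall y, V y -> cnorm (c y 0 0) <= A * hnorm h S y].
Proof.
move=> Mc ad cx; have [[hS trS] S0 DS] := S_can.
pose i := lb_at O x; have ix : lb_dom i x by exact: lb_atP.
have Di : nbhs x (lb_dom i) by apply: open_nbhs_nbhs; split=> //; exact: lb_dom_open.
have cw : {for x, continuous (weight h i)} by apply: smooth_continuous ix; exact: h_smooth.
have /cvgrPdist_lt/(_ 1 ltr01) near_w := cw.
have hn y : lb_dom i y -> hnorm h S y = cnorm (S i y) * expR (- weight h i y).
  by move=> iy; apply: (@hnormE _ _ _ _ _ _ setT).
have lower y : lb_dom i y -> `|weight h i x - weight h i y| < 1 ->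
    cnorm (S i y) <= expR (weight h i x + 1) * hnorm h S y.
  move=> iy wy; rewrite hn// mulrCA -expRD -[X in X <= _]mulr1 ler_wpM2l ?cnorm_ge0//.
  by rewrite -[X in X <= _]expR0 ler_expR; move: wy; rewrite ltr_norml => /andP[? ?]; lra.
suff [V [A [xV A0 HV]]] : exists V A, [/\ nbhs x V, 0 <= A &
    forall y, V y -> lb_dom i y -> cnorm (c y 0 0) <= A * cnorm (S i y)].
  exists (V `&` (lb_dom i `&` [set y | `|weight h i x - weight h i y| < 1])).
  exists (A * expR (weight h i x + 1)); split.
  - by apply: filterI => //; apply: filterI.
  - by rewrite mulr_ge0 ?expR_ge0.
  - move=> y [Vy [iy wy]]; apply: (le_trans (HV y Vy iy)).
    by rewrite -mulrA ler_wpM2l// lower.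
have [Sx|nSx] := pselect (Sigma x); last first.
  have Si0 : S i x != 0 by apply/eqP => /S0 h0; apply: nSx; exact: h0.
  have cS : {for x, continuous (S i)}.
    by apply: (holomorphic_continuous (hS i)); split.
  pose d := cnorm (S i x) / 2; have d0 : 0 < d by rewrite divr_gt0// cnorm_gt0.
  have /continuous_cnormP/(_ d d0) nearS := cS.
  pose B := cnorm (c x 0 0) + 1; have B0 : 0 <= B by rewrite addr_ge0// cnorm_ge0.
  have nearc : nbhs x [set y | chart_dom c y /\ near_row (c x) (c y) 1].
    by apply: (nbhs_chart_preimage (A := fun w => near_row (c x) w 1) cx); apply/nbhs_rowP; exists 1.
  exists ([set y | chart_dom c y /\ near_row (c x) (c y) 1] `&` [set y | cnorm (S i y - S i x) < d]).
  exists (B / d); split; [exact: filterI|exact: divr_ge0 (ltW d0)|].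
  move=> y [[cy ny] Sy] iy.
  have h1 : cnorm (c y 0 0) <= B.
    have := le_trans (le_trans (ler_norm _) (ler_cdist (c y 0 0) (c x 0 0))) (ltW (ny 0)).
    by rewrite lerBlDl.
  have h2 : d <= cnorm (S i y).
    have := ler_cdist (S i y) (S i x); have : 2 * d = cnorm (S i x) by rewrite /d; field.
    by rewrite ler_norml => ? /andP[? ?]; move: Sy => /= ?; lra.
  by rewrite (le_trans h1)// -mulrA ler_peMr// ler_pdivlMl// mulr1.
pose F := S i \o chart_inv c : 'rV[C]_n.+1 -> C.
have /nbhs_rowP[r r0 Hr] := nbhs_chart_image cx Di.
have cx0 : c x 0 0 = 0.
  have : (Sigma `&` chart_dom c) x by [].
  by rewrite ad => -[].
have [|||A [r' [r'0 HA]]] := @local_lower_bound R n F (c x) r r0 cx0.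
- move=> w /Hr[y [cy iy <-]]; apply: hS => //; by split.
- move=> w /Hr[y [cy iy <-]]; rewrite /F/= chart_invK//.
  have E : (Sigma `&` chart_dom c) y <-> chart_dom c y /\ c y 0 0 = 0 by rewrite ad.
  by split=> [/(S0 i y iy) Sy|c0]; [case: (proj1 E)|apply/(S0 i y iy); case: (proj2 E)].
- move=> w /Hr[y [cy iy <-]] c0; apply: DS => //.
  have : [set x | chart_dom c x /\ c x 0 0 = 0] y by [].
  by rewrite -ad => -[].
exists [set y | chart_dom c y /\ near_row (c x) (c y) r'], `|A|; split=> //.
  by apply: (nbhs_chart_preimage (A := fun w => near_row (c x) w r') cx); apply/nbhs_rowP; exists r'.
move=> y [cy /HA]; rewrite /F/= chart_invK// => Ay iy; apply: (le_trans Ay).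
by rewrite ler_wpM2r ?cnorm_ge0// ler_norm.
Qed.

Lemma polydisk_compact (E : set X) (W : hyp_cover M Sigma E) (j : 'I_(cover_size W)) (r : R) :
  r <= 2 -> compact (polydisk (cover_chart j) (cover_center j) r).
Proof.
move=> r2; have [_ _ cj0] := cover_centerP j.
apply: (@chart_image_compact _ _ _ (cover_chart j)
  [set z | forall k, cnorm (z 0 k - cover_chart j (cover_center j) 0 k) <= r]).
  move=> z zr; apply: cover_polydisk => k; exact: le_trans (zr k) r2.
exact: compact_polydisk.
Qed.

(** The source of the constant [A]: as [hnorm h S] is [e^rho], only rho and the cover enter the
    inequality. *)
Lemma normal_coord_bound (E : set X) (W : hyp_cover M Sigma E) : exists A, 1 <= A /\
  forall (j : 'I_(cover_size W)) x, polydisk (cover_chart j) (cover_center j) 1 x ->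
    cnorm (cover_chart j x 0 0) <= A * hnorm h S x.
Proof.
have hn0 x : 0 <= hnorm h S x by rewrite mulr_ge0 ?expR_ge0//; exact: cnorm_ge0.
have loc (j : 'I_(cover_size W)) : {A : R | forall x,
    polydisk (cover_chart j) (cover_center j) 1 x -> cnorm (cover_chart j x 0 0) <= A * hnorm h S x}.
  apply: cid; set K := polydisk _ _ 1.
  have cK : compact K by apply: polydisk_compact; rewrite ler1n.
  have /compact_near_coveringP cov := cK.
  have [|A0 [_ HA]] := cov R (+oo%R) (fun A x => cnorm (cover_chart j x 0 0) <= A * hnorm h S x) _.
    move=> x [cx _].
    have [V [A [xV A0 HV]]] := normal_coord_locally_bounded (cover_atlas j) (cover_adapted j) cx.
    exists (V, [set A' | A < A']); first by split=> //; exists A; split=> //; exact: num_real.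
    move=> [y A'] [/= Vy AA']; apply: (le_trans (HV y Vy)).
    by rewrite ler_wpM2r// ltW.
  by exists (A0 + 1) => x Kx; apply: (HA (A0 + 1)); rewrite ?ltrDl.
exists (\big[Num.max/1]_(j < cover_size W) projT1 (loc j)); split; first exact: bigmax_ge_id.
move=> j x px; case E0 : (loc j) => [A HA].
apply: (le_trans (HA x px)); rewrite ler_wpM2r//.
have -> : A = projT1 (loc j) by rewrite E0.
exact: (le_bigmax _ (fun j => projT1 (loc j)) j).
Qed.

End HypersurfaceBound.

(** * The volume in charts *)

Lemma conjcE (R : realType) (z : cplx R) : Num.conj z = conjc z.
Proof. by []. Qed.

(** By the spectral theorem the determinant is the product of the eigenvalues, and the k-th
    eigenvalue is the value of the hermitian form at the k-th row of the diagonalizing unitary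
    matrix. *)
Lemma posdef_det_gt0 (R : realType) n (A : 'M[cplx R]_n) :
  A^T = map_mx conjc A ->
  (forall v : 'rV[cplx R]_n, v != 0 -> 0 < (v *m A *m (map_mx conjc v)^T) 0 0) ->
  0 < \det A.
Proof.
move=> hA pA.
have nA : A \is normalmx.
  apply: hermitian_normalmx; apply/is_hermitianmxP; rewrite expr0 scale1r.
  by apply/matrixP => i j; rewrite hA !mxE conjcE conjcK.
have /orthomx_spectralP AE := nA.
set P := spectralmx A in AE; set D := spectral_diag A in AE.
have uP : P \is unitarymx by exact: spectral_unitarymx.
have Pu : P \in unitmx by exact: unitarymx_unit.
have DE k : D 0 k = (row k P *m A *m (map_mx conjc (row k P))^T) 0 0.
  have -> : row k P *m A = D 0 k *: row k P.
    by rewrite {1}AE !mulmxA -row_mul mulmxV// row1 -rowE row_diag_mx -scalemxAl -rowE.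
  rewrite -scalemxAl mxE.
  have -> : row k P *m (map_mx conjc (row k P))^T = 1.
    move/unitarymxP: uP => /matrixP/(_ k k); rewrite !mxE eqxx => PP.
    apply/matrixP => i j; rewrite !ord1 !mxE -PP; apply: eq_bigr => l _.
    by rewrite !mxE.
  by rewrite mxE mulr1.
have -> : \det A = \prod_k D 0 k.
  by rewrite AE !det_mulmx det_inv det_diag mulrC mulrA divrr ?mul1r// -unitmxE.
apply: prodr_gt0 => k _; rewrite DE; apply: pA.
apply/eqP => r0.
have := unitarymxP uP => /matrixP/(_ k k); rewrite !mxE eqxx big1 => [/eqP|l _].
  by rewrite eq_sym oner_eq0.
by have /rowP/(_ l) := r0; rewrite !mxE => ->; rewrite mul0r.
Qed.

Section VolumeComparison.
Variables (R : realType) (n : nat) (X : ptopologicalType) (M : complex_manifold R n X).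
Local Notation C := (cplx R).
Variables (omega : hermitian_metric M) (vol : {measure set (borel X) -> \bar R}).
Hypothesis vol_omega : volume_measure omega vol.

Lemma ccontinuous_ReIm (T : topologicalType) (f : T -> C) t :
  {for t, continuous (fun s => complex.Re (f s))} ->
  {for t, continuous (fun s => complex.Im (f s))} -> {for t, continuous f}.
Proof.
move=> /cvgrPdist_lt cR /cvgrPdist_lt cI; apply/continuous_cnormP => e e0.
have e2 : 0 < e / 2 by rewrite divr_gt0.
apply: filterS2 (cR _ e2) (cI _ e2) => s; rewrite !(distrC (_ (f t))) => h1 h2.
apply: (le_lt_trans (cnorm_le_ReIm _)).
by move: h1 h2; case: (f s) (f t) => [? ?] [? ?] /= *; lra.
Qed.

Lemma ccontinuous_prod (T : topologicalType) (I : Type) (r : seq I) (f : I -> T -> C) t :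
  (forall i, {for t, continuous (f i)}) ->
  {for t, continuous (fun s => \prod_(i <- r) f i s)}.
Proof.
move=> cf; elim: r => [|i r IH].
  have -> : (fun s => \prod_(i <- [::]) f i s) = (fun=> 1).
    by apply/funext => s; rewrite big_nil.
  exact: ccontinuous_cst.
have -> : (fun s => \prod_(i <- i :: r) f i s) = (fun s => f i s * \prod_(i <- r) f i s).
  by apply/funext => s; rewrite big_cons.
exact: (ccontinuousM (cf i) IH).
Qed.

Lemma ccontinuous_sum (T : topologicalType) (I : Type) (r : seq I) (f : I -> T -> C) t :
  (forall i, {for t, continuous (f i)}) ->
  {for t, continuous (fun s => \sum_(i <- r) f i s)}.
Proof.
move=> cf; elim: r => [|i r IH].
  have -> : (fun s => \sum_(i <- [::]) f i s) = (fun=> 0).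
    by apply/funext => s; rewrite big_nil.
  exact: ccontinuous_cst.
have -> : (fun s => \sum_(i <- i :: r) f i s) = (fun s => f i s + \sum_(i <- r) f i s).
  by apply/funext => s; rewrite big_cons.
exact: (ccontinuousD (cf i) IH).
Qed.

Definition vol_density (c : chart R n X) (z : 'rV[C]_n) : R :=
  complex.Re (\det (herm_mx omega c z)).

Lemma vol_density_gt0 c z : atlas M c -> chart_cod c z -> 0 < vol_density c z.
Proof.
move=> Mc cz; have := posdef_det_gt0 (herm_sym omega Mc cz) (fun v => herm_pos omega Mc cz).
by rewrite ltcE => /andP[].
Qed.

Lemma continuous_vol_density c z : atlas M c -> chart_cod c z ->
  {for z, continuous (vol_density c)}.
Proof.
move=> Mc cz; apply: (continuous_Re_comp (f := fun w => \det (herm_mx omega c w))).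
pose term s w := (-1) ^+ (perm.odd_perm s) * \prod_i herm_mx omega c w i (perm.fun_of_perm s i).
apply: (ccontinuous_sum _ (f := term)).
move=> s; apply: (ccontinuousM (ccontinuous_cst ((-1) ^+ (perm.odd_perm s)) z)).
apply: (ccontinuous_prod _ (f := fun i w => herm_mx omega c w i (perm.fun_of_perm s i))) => i.
have [hR hI] := herm_smooth omega i (perm.fun_of_perm s i) Mc.
have [cR _] := hR 0%N; have [cI _] := hI 0%N.
by apply: ccontinuous_ReIm; [exact: cR|exact: cI].
Qed.

Lemma open_chart_inv_preimage (c : chart R n X) (V : set X) : open V ->
  open (chart_cod c `&` chart_inv c @^-1` V).
Proof.
move=> oV; rewrite openE => z [cz Vz]; apply: filterI.
  by apply: open_nbhs_nbhs; split=> //; exact: chart_cod_open.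
by apply: (chart_inv_cont cz); exact: open_nbhs_nbhs.
Qed.

Lemma measurable_chart_inv (c : chart R n X) :
  measurable_fun (vecC (n := n) @^-1` chart_cod c)
    (fun t : n.-tuple (cpair R) => chart_inv c (vecC t) : borel X).
Proof.
apply: (@measurability _ _ _ (borel X) _ _ (@open X)); first by [].
move=> _ [V oV <-].
apply: (@measurable_vecC_open R n (chart_cod c `&` chart_inv c @^-1` V)).
exact: open_chart_inv_preimage.
Qed.

(** The density is continuous and positive, hence at least [B^-1] on [K]. The image of Lebesgue
    measure on [K] under the inverse chart is thus at most [B * vol] on Borel sets, and integration
    preserves the comparison. *)
Lemma volume_lower_bound c (K : set 'rV[C]_n) : atlas M c -> compact K -> K `<=` chart_cod c ->
  measurable (vecC (n := n) @^-1` K) ->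
  exists2 B : R, 0 < B & forall F : borel X -> \bar R,
    measurable_fun setT F -> (forall x, 0 <= F x)%E ->
    (\int[lebesgueC R n]_(t in vecC (n := n) @^-1` K) F (chart_inv c (vecC t)) <=
     B%:E * \int[vol]_x F x)%E.
Proof.
move=> Mc cK Kc mK.
have [B0 HB0] : exists b, forall z, K z -> (vol_density c z)^-1 <= b.
  apply: compact_locally_bounded cK _ => z Kz.
  have d0 := vol_density_gt0 Mc (Kc z Kz).
  have cV : {for z, continuous (fun z => (vol_density c z)^-1)}.
    by apply: continuousV; [exact: lt0r_neq0|exact: continuous_vol_density Mc (Kc z Kz)].
  have /cvgrPdist_lt/(_ 1 ltr01) near1 := cV.
  exists [set w | `|(vol_density c z)^-1 - (vol_density c w)^-1| < 1].
  exists ((vol_density c z)^-1 + 1); split=> // w /=.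
  by rewrite ltr_norml => /andP[h _] _; move: h; clear; lra.
pose B := `|B0| + 1; have B_gt0 : 0 < B by rewrite ltr_wpDl.
have HB z : K z -> B^-1 <= vol_density c z.
  move=> Kz; have d0 := vol_density_gt0 Mc (Kc z Kz).
  rewrite -[leRHS]invrK lef_pV2 ?posrE ?invr_gt0//.
  by apply: (le_trans (HB0 z Kz)); rewrite /B (le_trans (ler_norm _))// lerDl.
exists B => // F mF F0.
pose D := vecC (n := n) @^-1` chart_cod c.
have mD : measurable D by apply: measurable_vecC_open; exact: chart_cod_open.
(* Outside [D] the map takes a default value, which makes it measurable everywhere; the measure
   pushed forward is restricted to [K], where the default does not occur. *)
pose psi : n.-tuple (cpair R) -> borel X := (fun t => chart_inv c (vecC t)) \_ D.
have mpsi : measurable_fun setT psi.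
  by apply/(measurable_restrictT _ mD); exact: measurable_chart_inv.
have psiE t : D t -> psi t = chart_inv c (vecC t) by move=> Dt; rewrite /psi patchE mem_set.
pose m1 := measure_function_pushforward__canonical__measure_function_Measure
  (mrestr (lebesgueC R n) mK) mpsi.
pose m2 := mscale (NngNum (ltW B_gt0)) vol.
have KD t : K (vecC t) -> D t by exact: Kc.
have psiK t : K (vecC t) -> chart_dom c (psi t) /\ c (psi t) = vecC t.
  by move=> Kt; rewrite psiE; [have [y cy <-] := Kc _ Kt; rewrite chart_invK|exact: KD].
have m12 A : measurable A -> (m1 A <= m2 A)%E.
  move=> mA; rewrite /m1 /m2 /= /pushforward /mscale/= /mrestr.
  (* Only this part of [A] is charged by [m1], and it lies in one chart, so that [volume_measure]
     computes its volume. *)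
  pose A' := [set x | chart_dom c x /\ K (c x)] `&` A.
  have preA : vecC (n := n) @^-1` (c @` A') = psi @^-1` A `&` vecC (n := n) @^-1` K.
    apply/seteqP; split=> t.
      move=> [y [[cy Ky] Ay] yt]; have Kt : K (vecC t) by rewrite -yt.
      by split=> //; rewrite /preimage/= (psiE t (KD t Kt)) -yt chart_invK.
    by move=> [At Kt]; have [? cE] := psiK t Kt; exists (psi t); first (split=> //; split=> //; rewrite cE).
  have mpA : measurable (psi @^-1` A `&` vecC (n := n) @^-1` K).
    by apply: measurableI => //; rewrite -[X in measurable X]setTI; exact: (mpsi measurableT A mA).
  have mA' : measurable (A' : set (borel X)).
    apply: measurableI => //; rewrite (_ : [set x | _] = chart_dom c `\` (chart_dom c `&` c @^-1` (~` K))).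
      apply: measurableD; apply: measurable_borel_open; first exact: chart_dom_open.
      rewrite openE => x [cx Kx]; apply: (nbhs_chart_preimage (A := ~` K)) => //.
      apply: open_nbhs_nbhs; split=> //; apply: closed_openC.
      by apply: compact_closed cK; exact: norm_hausdorff.
    apply/seteqP; split=> x; first by move=> [cx Kx]; split=> // -[_ /(_ Kx)].
    by move=> [cx nK]; split=> //; apply: contrapT => nKx; apply: nK.
  apply: (@le_trans _ _ (B%:E * vol A')%E); last first.
    by apply: lee_wpmul2l; [rewrite lee_fin ltW|apply: le_measure; rewrite ?inE// => x []].
  rewrite (vol_omega Mc mA'); last by move=> x [[]].
  rewrite preA -lee_pdivrMl//.
  apply: (@le_trans _ _ (\int[lebesgueC R n]_(t in psi @^-1` A `&` vecC (n := n) @^-1` K) (B^-1)%:E)%E).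
    by rewrite integral_cst.
  apply: ge0_le_integral => //.
  - by move=> t _; rewrite lee_fin invr_ge0 ltW.
  - apply/measurable_EFinP; apply: (@measurable_funS _ _ _ _ D) => //.
      by move=> t [_ /KD].
    apply: (continuous_measurable_comp (g := vol_density c)).
    + exact: measurable_vecC_open.
    + exact: chart_cod_open.
    + by move=> z cz; exact: continuous_vol_density.
  - by move=> t [_ Kt]; rewrite lee_fin; exact: HB.
apply: (@le_trans _ _ (\int[m2]_x F x)%E); last by rewrite ge0_integral_mscale.
apply: (@le_trans _ _ (\int[m1]_x F x)%E); last exact: ge0_le_measure_integral.
rewrite (@ge0_integral_pushforward _ _ _ _ R psi mpsi (mrestr (lebesgueC R n) mK) setT F)//.
rewrite preimage_setT.
apply: (@le_trans _ _ (\int[mrestr (lebesgueC R n) mK]_(t in vecC (n := n) @^-1` K) (F \o psi) t)%E).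
  rewrite le_eqVlt; apply/orP; left; apply/eqP.
  transitivity (\int[lebesgueC R n]_(t in vecC (n := n) @^-1` K) (F \o psi) t)%E.
    by apply: eq_integral => t /set_mem Kt /=; rewrite psiE//; exact: KD.
  by apply: eq_measure_integral => A mA AK; congr (lebesgueC R n _); rewrite (setIidl AK).
apply: ge0_subset_integral => //; last by move=> t _; exact: F0.
exact: measurableT_comp mF mpsi.
Qed.

End VolumeComparison.

(** * The mean value inequality in polydisks *)

Section LocalL2Bound.
Variables (R : realType) (n : nat).
Local Notation C := (cplx R).
Local Notation cpair := (cpair R).
Local Notation box := (@rectangle R (- (7 / 5)) (7 / 5) (- (7 / 5)) (7 / 5)).

Definition L2_const : R := 5 * 10 ^+ 5.

Lemma L2_const_ge0 : 0 <= L2_const.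
Proof. by rewrite mulr_ge0 ?exprn_ge0. Qed.

Definition polydisk2 : set 'rV[C]_n.+1 := [set z | forall k, cnorm (z 0 k) <= 2].

Lemma vecC_upd (t : n.+1.-tuple cpair) k q : vecC (upd t k q) = slice (vecC t) k (pointC q).
Proof. by apply/rowP => j; rewrite !mxE tnth_mktuple; case: ifP. Qed.

Lemma boxes_polydisk2 (t : n.+1.-tuple cpair) : @boxes R n.+1 t -> polydisk2 (vecC t).
Proof. by move=> bt k; rewrite vecCE; exact/box_cnorm/bt. Qed.

Lemma slice_polydisk2 z k a : polydisk2 z -> box a -> polydisk2 (slice z k a).
Proof. by move=> z2 ba j; rewrite sliceE; case: eqP => _; [exact: box_cnorm|exact: z2]. Qed.

Lemma measurable_polydisk2 : measurable (vecC (n := n.+1) @^-1` polydisk2).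
Proof.
rewrite (_ : _ @^-1` _ = ~` (vecC (n := n.+1) @^-1` (~` polydisk2))); last by rewrite preimage_setC setCK.
apply: measurableC; apply: measurable_vecC_open; apply: closed_openC.
apply: compact_closed; first exact: norm_hausdorff.
exact: compact_polydisk0.
Qed.

(* The division by [z_1 ^ m] costs nothing on the frames, where [1 <= |z_1|]. *)
Lemma local_L2_bound (O : set 'rV[C]_n.+1) (f : 'rV[C]_n.+1 -> C) (m : nat) :
  open O -> polydisk2 `<=` O -> (forall z, O z -> {for z, continuous f}) ->
  (forall z k, O z -> derivable (fun b => f (slice z k b)) (z 0 k) 1) ->
  (forall z, polydisk2 z -> z 0 0 = 0 -> exists2 g : C -> C, derivable g 0 1 &
     \forall a \near (0 : C), f (slice z 0 a) = a ^+ m * g a) ->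
  forall z : 'rV[C]_n.+1, (forall k, cnorm (z 0 k) <= 1) ->
  ((cnorm (f z) ^+ 2)%:E <= (L2_const ^+ n.+1 * cnorm (z 0 0) ^+ (2 * m))%:E *
    \int[lebesgueC R n.+1]_(t in vecC (n := n.+1) @^-1` polydisk2)
      (cnorm (f (vecC t)) ^+ 2)%:E)%E.
Proof.
move=> oO PO cf df vf z z1.
(* The open set on which the quotient by the m-th power is continuous. For [m = 0] there is no
   division, and the points with [w 0 0 = 0] have to be kept. *)
pose P := O `&` [set w | m = 0%N \/ w 0 0 != 0].
pose g w : R := cnorm (f w * (w 0 0 ^+ m)^-1) ^+ 2.
have coord_cont (w : 'rV[C]_n.+1) : {for w, continuous (fun w : 'rV[C]_n.+1 => w 0 0)}.
  by move=> A /nbhs_cnormP[r r0 rA]; apply/nbhs_rowP; exists r => // w' h; apply: rA; exact: h.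
have oP : open P.
  rewrite openE => w [Ow w0]; apply: filterI; first exact: open_nbhs_nbhs.
  case: w0 => [m0|w0]; first by apply: filterS filterT => ? _; left.
  have /continuous_cnormP/(_ (cnorm (w 0 0))) := coord_cont w.
  rewrite cnorm_gt0 => /(_ w0); apply: filterS => w' h; right; apply/eqP => w'0.
  by move: h; rewrite w'0 sub0r cnormN ltxx.
have cg w : P w -> {for w, continuous g}.
  move=> [Ow w0].
  have c1 : {for w, continuous (fun w => f w * (w 0 0 ^+ m)^-1)}.
    case: w0 => [m0|w0].
      have -> : (fun w => f w * (w 0 0 ^+ m)^-1) = f.
        by apply/funext => w'; rewrite m0 expr0 invr1 mulr1.
      exact: cf.
    have wm : w 0 0 ^+ m != 0 by rewrite expf_neq0.
    have cX := (ccontinuousX (k := m) (coord_cont w)).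
    have cV := @ccontinuousV R _ (fun w : 'rV[C]_n.+1 => w 0 0 ^+ m) w wm cX.
    exact: (ccontinuousM (cf w Ow) cV).
  have c2 := continuous_cnorm_comp c1.
  exact: (@continuousM R _ _ _ w c2 c2).
pose D := @boxes R n.+1 `&` vecC (n := n.+1) @^-1` P.
have mD : measurable D.
  by apply: measurableI; [exact: measurable_boxes|exact: measurable_vecC_open].
pose phi : n.+1.-tuple cpair -> \bar R := (fun t => (g (vecC t))%:E) \_ D.
have mphi : measurable_fun setT phi.
  apply/(measurable_restrictT _ mD); apply/measurable_EFinP.
  apply: (@measurable_funS _ _ _ _ (vecC (n := n.+1) @^-1` P)) => //.
    exact: measurable_vecC_open.
  by move=> t [].
  exact: (continuous_measurable_comp (@measurable_vecC_open R n.+1) oP cg).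
have phi0 t : (0 <= phi t)%E by rewrite /phi patchE; case: ifP => // _; rewrite lee_fin sqr_ge0.
have phiE t : D t -> phi t = (g (vecC t))%:E by move=> Dt; rewrite /phi patchE mem_set.
have slice_O w k a : polydisk2 w -> box a -> O (slice w k a).
  by move=> w2 ba; apply: PO; exact: slice_polydisk2.
have du w k a : polydisk2 w -> box a -> derivable (fun b => f (slice w k b)) a 1.
  move=> w2 ba; have := df _ k (slice_O w k a w2 ba); rewrite sliceE eqxx.
  have -> // : (fun b => f (slice (slice w k a) k b)) = (fun b => f (slice w k b)).
  by apply/funext => b; congr f; apply/rowP => j; rewrite !mxE; case: (j == k).
have coordwise t k : @boxes R n.+1 t -> in_unit (tnth t k) ->
    forall psi : cpair -> \bar R, measurable_fun setT psi -> (forall q, 0 <= psi q)%E ->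
    (forall q, in_frame q -> (phi (upd t k q) <= psi q)%E) ->
    (phi t <= L2_const%:E * \int[lebesgue_measure]_x \int[lebesgue_measure]_y psi (x, y))%E.
  move=> bt [ux uy] psi mpsi psi0 hpsi.
  have t2 := boxes_polydisk2 bt.
  have RHS0 : (0 <= L2_const%:E *
      \int[lebesgue_measure]_x \int[lebesgue_measure]_y psi (x, y))%E.
    rewrite mule_ge0 ?lee_fin ?L2_const_ge0// integral_ge0// => x _.
    exact: integral_ge0.
  (* Where the quotient is undefined [phi] is 0 and the inequality is trivial. *)
  have [Dt|nDt] := pselect (D t); last by rewrite /phi patchE memNset.
  have bupd q : in_frame q -> @boxes R n.+1 (upd t k q).
    move=> fq j; rewrite /upd tnth_mktuple; case: ifP => _; last exact: bt.
    exact: in_frame_box.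
  suff [u [du0 uE uf]] : exists u : C -> C, [/\ forall a, box a -> derivable u a 1,
      phi t = (cnorm (u (pointC (tnth t k))) ^+ 2)%:E &
      forall q, in_frame q -> ((cnorm (u (pointC q)) ^+ 2)%:E <= phi (upd t k q))%E].
    have btk : box (pointC (tnth t k)) by exact: bt.
    have cu a : box a -> {for a, continuous u}.
      by move=> ba; exact: (cderivable_continuous (du0 a ba)).
    have hu (x y : R) : box_frame (x +i* y)%C -> ((cnorm (u (x +i* y)%C) ^+ 2)%:E <= psi (x, y))%E.
      by move=> fxy; apply: (le_trans (uf (x, y) fxy)); exact: (hpsi (x, y)).
    rewrite uE.
    exact: (@cauchy_L2 R u (pointC (tnth t k)) psi ux uy cu (fun a ba _ => du0 a ba)
      (du0 _ btk) mpsi psi0 hu).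
  (* In a variable other than the first, the divisor is a constant. *)
  have [k0|k0] := eqVneq k 0; last first.
    exists (fun a => f (slice (vecC t) k a) * (vecC t 0 0 ^+ m)^-1); split.
    - move=> a ba; exact: (cderivableM (du _ _ _ t2 ba) (cderivable_cst ((vecC t 0 0 ^+ m)^-1) a)).
    - by rewrite phiE// /g -vecCE slice_id.
    - move=> q fq; rewrite phiE /g ?vecC_upd ?sliceE; first by rewrite eq_sym (negbTE k0).
      split; first exact: bupd.
      rewrite /preimage/= vecC_upd; split; first by apply: slice_O => //; exact: in_frame_box.
      by rewrite /= sliceE [0 == k]eq_sym (negbTE k0); case: Dt => _ [].
  have s2 : polydisk2 (slice (vecC t) 0 0).
    by apply: slice_polydisk2 => //; split=> /=; apply/andP; split; lra.
  have s0 : slice (vecC t) 0 0 0 0 = 0 by rewrite sliceE eqxx.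
  have [h dh hE] := vf _ s2 s0.
  have slice2 (a : C) : slice (slice (vecC t) 0 0) 0 a = slice (vecC t) 0 a.
    by apply/rowP => j; rewrite !mxE; case: (j == 0).
  (* In the first variable, the factor [h] given by the vanishing of [f] fills in the quotient at 0,
     so [u] is derivable on the whole box. *)
  pose u (a : C) := if a == 0 then h 0 else f (slice (vecC t) 0 a) * (a ^+ m)^-1.
  have u_h : {near (0 : C), h =1 u}.
    apply: filterS hE => a; rewrite slice2 /u; case: eqP => [->//|/eqP a0] ->.
    by rewrite mulrAC divff ?mul1r// expf_neq0.
  have uP w : vecC t = w -> P w -> cnorm (u (w 0 0)) ^+ 2 = g w.
    move=> tw [_ Pw]; rewrite /u /g; case: eqP => [w0|_]; last by rewrite tw slice_id.
    case: Pw => [m0|/eqP//]; rewrite m0 expr0 invr1 mulr1 -{1}(slice_id w 0) w0.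
    by have := nbhs_singleton hE; rewrite slice2 m0 expr0 mul1r tw => ->.
  exists u; split.
  - move=> a ba; have [->|a0] := eqVneq a 0; first exact: near_eq_derivable u_h dh.
    have near_a : {near a, (fun b => f (slice (vecC t) 0 b) * (b ^+ m)^-1) =1 u}.
      apply/nbhs_cnormP; exists (cnorm a); first by rewrite cnorm_gt0.
      move=> b ba'; rewrite /u ifF//; apply/eqP => b0.
      by move: ba'; rewrite b0 sub0r cnormN ltxx.
    apply: near_eq_derivable near_a _.
    apply: (cderivableM (du _ _ _ t2 ba) (cderivableV _ (cderivableX (k := m) (cderivable_id a)))).
    exact: expf_neq0.
  - by rewrite phiE// k0 -vecCE (uP (vecC t) erefl)//; case: Dt.
  - move=> q fq.
    have q0 : pointC q != 0.
      rewrite -cnorm_gt0; have /andP[q1 _] := box_frame_cnorm fq.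
      exact: lt_le_trans q1.
    rewrite phiE; first by rewrite /g vecC_upd k0 sliceE eqxx /u (negbTE q0).
    split; first exact: bupd.
    rewrite /preimage/= vecC_upd; split; first by apply: slice_O => //; exact: in_frame_box.
    by right; rewrite k0 sliceE eqxx.
pose t : n.+1.-tuple cpair := [tuple (complex.Re (z 0 k), complex.Im (z 0 k)) | k < n.+1].
have tz : vecC t = z.
  by apply/rowP => k; rewrite vecCE tnth_mktuple /pointC; case: (z 0 k).
have ut k : in_unit (tnth t k).
  rewrite tnth_mktuple; split=> /=; apply: le_trans (z1 k); rewrite ?Re_le_cnorm ?Im_le_cnorm//.
have := iterated_bound L2_const_ge0 mphi phi0 coordwise ut.
have int_le : (\int[lebesgueC R n.+1]_(s in @frames R n.+1) phi s <=
    \int[lebesgueC R n.+1]_(t in vecC (n := n.+1) @^-1` polydisk2) (cnorm (f (vecC t)) ^+ 2)%:E)%E.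
  have mf : measurable_fun (vecC (n := n.+1) @^-1` polydisk2)
      (fun t => (cnorm (f (vecC t)) ^+ 2)%:E).
    apply/measurable_EFinP.
    apply: (@measurable_funS _ _ _ _ (vecC (n := n.+1) @^-1` O)) => //.
      exact: measurable_vecC_open.
      by move=> s; exact: PO.
    apply: (continuous_measurable_comp (@measurable_vecC_open R n.+1) oO
      (g := fun w => cnorm (f w) ^+ 2)).
    move=> w Ow; have c2 := continuous_cnorm_comp (cf w Ow).
    exact: (@continuousM R _ _ _ w c2 c2).
  have frames2 : @frames R n.+1 `<=` vecC (n := n.+1) @^-1` polydisk2.
    by move=> s fs; apply: boxes_polydisk2 => k; exact/in_frame_box/fs.
  apply: (@le_trans _ _ (\int[lebesgueC R n.+1]_(s in @frames R n.+1) (cnorm (f (vecC s)) ^+ 2)%:E)%E).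
    apply: ge0_le_integral => //.
    - exact: measurable_frames.
    - exact: measurable_funTS.
    - apply: measurable_funS mf => //; exact: measurable_polydisk2.
    move=> s fs; rewrite /phi patchE; case: ifP => _; last by rewrite lee_fin sqr_ge0.
    rewrite lee_fin /g cnormM cnormV cnormX ler_pXn2r ?nnegrE ?cnorm_ge0//; last first.
      by rewrite mulr_ge0 ?invr_ge0 ?exprn_ge0 ?cnorm_ge0.
    rewrite ler_piMr ?cnorm_ge0// invf_le1.
      by rewrite exprn_ege1// vecCE; case/andP: (box_frame_cnorm (fs 0)).
    rewrite exprn_gt0//; apply: lt_le_trans ltr01 _.
    by rewrite vecCE; case/andP: (box_frame_cnorm (fs 0)).
  apply: ge0_subset_integral => //; first exact: measurable_frames.
    exact: measurable_polydisk2.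
  by move=> s _; rewrite lee_fin sqr_ge0.
(* On the hypersurface [f z = 0] if [m >= 1]; if [m = 0] the point still belongs to [D] and the
   iterated bound applies. *)
have [z0|z0] := eqVneq (z 0 0) 0.
  have z2 : polydisk2 z by move=> k; apply: (le_trans (z1 k)); rewrite ler1n.
  have [m0|m0] := eqVneq m 0%N; last first.
    have [h _ hE] := vf z z2 z0; have := nbhs_singleton hE.
    have -> : slice z 0 0 = z by rewrite -[RHS](slice_id z 0) z0.
    rewrite expr0n (negbTE m0) mul0r => ->.
    move=> _; rewrite cnorm0 expr2 mul0r mule_ge0//; last first.
      by apply: (@integral_ge0 _ _ R) => s _; rewrite lee_fin sqr_ge0.
    by rewrite lee_fin mulr_ge0 ?exprn_ge0 ?cnorm_ge0 ?L2_const_ge0.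
  have Dt : D t.
    split; first by move=> k; exact/in_unit_box/ut.
    by rewrite /preimage/= tz; split; [exact: PO|left].
  rewrite phiE// tz /g m0 muln0 !expr0 invr1 !mulr1 => h; apply: (le_trans h).
  by apply: lee_wpmul2l => //; rewrite lee_fin exprn_ge0 ?L2_const_ge0.
have Dt : D t.
  split; first by move=> k; exact/in_unit_box/ut.
  rewrite /preimage/= tz; split; last by right.
  by apply: PO => k; apply: (le_trans (z1 k)); rewrite ler1n.
rewrite phiE// tz /g => h.
have zm : 0 < cnorm (z 0 0) ^+ (2 * m) by rewrite exprn_gt0// cnorm_gt0.
have -> : cnorm (f z) ^+ 2 = cnorm (z 0 0) ^+ (2 * m) * cnorm (f z * (z 0 0 ^+ m)^-1) ^+ 2.
  rewrite cnormM cnormV cnormX exprMn exprVn -exprM [(m * 2)%N]mulnC mulrCA divff ?mulr1//.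
  exact: lt0r_neq0.
rewrite mulrC EFinM [X in (_ <= X * _)%E]EFinM -muleA [X in (_ <= X)%E]muleCA muleC.
apply: lee_wpmul2l; first by rewrite lee_fin ltW.
apply: (le_trans h); apply: lee_wpmul2l => //; rewrite lee_fin exprn_ge0 ?L2_const_ge0//.
Qed.

End LocalL2Bound.

(** * Integrals of norms of sections *)

Section NullSets.
Import HBNNSimple.
Context d (T : measurableType d) (R : realType) (mu : {measure set T -> \bar R}).
Variable N : set T.
Hypotheses (mN : measurable N) (N0 : mu N = 0%E).

(* Norms of sections are only measurable off a null set, so integrals are compared
   through their definition as suprema over simple functions. *)
Lemma ge0_le_integral_off_null (f g : T -> \bar R) :
  (forall x, 0 <= f x)%E -> (forall x, 0 <= g x)%E ->
  (forall x, ~ N x -> f x <= g x)%E -> (\int[mu]_x f x <= \int[mu]_x g x)%E.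
Proof.
move=> f0 g0 fg; rewrite ge0_integralTE// (ge0_integralTE _ g0).
apply: ge_ereal_sup => _ [h /= hf <-].
have mNC : measurable (~` N) by exact: measurableC.
(* Cutting the simple function [h] off on [N] keeps its integral and brings it below [g]
   everywhere. *)
pose k := proj_nnsfun h mNC.
have kE x : k x = if x \in ~` N then h x else 0 by rewrite /k -mrestrict patchE.
have -> : sintegral mu h = sintegral mu k.
  have nn (u : {nnsfun T >-> R}) : sintegral mu u = (\int[mu]_x (u x)%:E)%E.
    by rewrite integral_nnsfun// patch_setT.
  rewrite !nn; apply: ge0_ae_eq_integral => //.
  - by apply/measurable_EFinP.
  - by apply/measurable_EFinP.
  - by move=> x _; rewrite lee_fin.
  - by move=> x _; rewrite lee_fin.
  - exists N; split=> // x nx; apply: contrapT => nNx; apply: nx => _.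
    by rewrite kE mem_set.
apply: ereal_sup_ubound; exists k => // x; rewrite kE; case: ifPn => [/set_mem nNx|_].
  exact: le_trans (hf x) (fg x nNx).
exact: g0.
Qed.

Lemma integral_off_null (f g : T -> \bar R) :
  (forall x, ~ N x -> f x = g x) -> (\int[mu]_x f x = \int[mu]_x g x)%E.
Proof.
move=> fg; rewrite integralE [RHS]integralE; congr (_ - _)%E; apply/eqP; rewrite eq_le.
  apply/andP; split; apply: ge0_le_integral_off_null => // x nx;
    by rewrite ?funeposE fg.
apply/andP; split; apply: ge0_le_integral_off_null => // x nx;
  by rewrite ?funenegE fg.
Qed.

(** Integrability is asked of the cut-off of [u] outside [N], which is measurable, while the value
    is that of the integral of [u] itself, as in the Bergman inner product. By [integral_patch_null]
    both integrals agree. *)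
Definition has_integral (u : T -> R) (r : R) :=
  mu.-integrable setT (EFin \o u \_ (~` N)) /\ (\int[mu]_x (u x)%:E = r%:E)%E.

Lemma integral_patch_null (u : T -> R) :
  (\int[mu]_x (u x)%:E = \int[mu]_x (EFin \o u \_ (~` N)) x)%E.
Proof. by apply: integral_off_null => x nNx; rewrite /= patchE mem_set. Qed.

Lemma has_integral_dominated (u v : T -> R) : measurable_fun (~` N) u ->
  (forall x, `|u x| <= v x) -> (\int[mu]_x (v x)%:E < +oo)%E ->
  has_integral u (\int[mu]_x u x).
Proof.
move=> mu_ uv vfin.
have mNC : measurable (~` N) by exact: measurableC.
have iu : mu.-integrable setT (EFin \o u \_ (~` N)).
  apply/integrableP; split; first by apply/measurable_EFinP/(measurable_restrictT _ mNC).
  apply: le_lt_trans vfin; apply: ge0_le_integral_off_null => [x|x|x nx] /=.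
  - by rewrite lee_fin.
  - by rewrite lee_fin (le_trans _ (uv x)).
  - by rewrite lee_fin patchE mem_set.
split=> //; rewrite /Rintegral fineK// integral_patch_null.
exact: integrable_fin_num.
Qed.

Lemma has_integralD u v r s : has_integral u r -> has_integral v s ->
  has_integral (fun x => u x + v x) (r + s).
Proof.
move=> [iu uE] [iv vE].
have E : EFin \o (fun x => u x + v x) \_ (~` N) =
    (EFin \o u \_ (~` N)) \+ (EFin \o v \_ (~` N)).
  by apply/funext => x; rewrite /= !patchE; case: ifP => _; rewrite ?addr0.
split; first by rewrite E; exact: integrableD.
rewrite (integral_patch_null (fun x => u x + v x)) E integralD//.
by rewrite -!integral_patch_null uE vE.
Qed.

Lemma has_integralZ k u r : has_integral u r -> has_integral (fun x => k * u x) (k * r).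
Proof.
move=> [iu uE].
have E : EFin \o (fun x => k * u x) \_ (~` N) =
    (fun x => k%:E * (EFin \o u \_ (~` N)) x)%E.
  by apply/funext => x; rewrite /= -EFinM !patchE; case: ifP => _; rewrite ?mulr0.
split; first by rewrite E; exact: integrableZl.
by rewrite (integral_patch_null (fun x => k * u x)) E integralZl// -integral_patch_null uE.
Qed.

Lemma has_integral_sum (I : eqType) (s : seq I) (u : I -> T -> R) (r : I -> R) :
  (forall i, i \in s -> has_integral (u i) (r i)) ->
  has_integral (fun x => \sum_(i <- s) u i x) (\sum_(i <- s) r i).
Proof.
elim: s => [|i s IH] ui.
  rewrite big_nil (_ : (fun x => _) = cst 0); last by apply/funext => x; rewrite big_nil.
  have E : EFin \o (cst 0 : T -> R) \_ (~` N) = cst 0%E.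
    by apply/funext => x; rewrite /= patchE; case: ifP.
  by split; [rewrite E; exact: integrable0|rewrite (integral_patch_null (cst 0)) E integral0].
rewrite big_cons (_ : (fun x => _) = (fun x => u i x + \sum_(j <- s) u j x)); last first.
  by apply/funext => x; rewrite big_cons.
apply: has_integralD; first by apply: ui; rewrite mem_head.
by apply: IH => j js; apply: ui; rewrite in_cons js orbT.
Qed.

End NullSets.

Lemma continuous_borel_measurable (R : realType) (X : ptopologicalType) (O : set X) (g : X -> R) :
  open O -> (forall x, O x -> {for x, continuous g}) ->
  measurable_fun (O : set (borel X)) (g : borel X -> R).
Proof.
move=> oO cg; apply: (@continuous_measurable_comp R _ (borel X) X id O g _ oO cg).
by move=> V oV; exact: measurable_borel_open.
Qed.

(** * Null sets and measurable weights on the manifold *)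

Section ChartNullSets.
Variables (R : realType) (n : nat) (X : ptopologicalType) (M : complex_manifold R n X).
Local Notation C := (cplx R).
Variables (omega : hermitian_metric M) (vol : {measure set (borel X) -> \bar R}).
Hypothesis vol_omega : volume_measure omega vol.

(** Of a countable base, the open sets lying both in a chart of the atlas and in a trivialization of
    [L] still cover [X]; one such pair is chosen for each. *)
Lemma countable_trivialization (L : line_bundle M) :
  exists (c : nat -> chart R n X) (i : nat -> lb_idx L),
    (forall k, atlas M (c k)) /\
    forall x, exists k, chart_dom (c k) x /\ lb_dom (i k) x.
Proof.
have [B cB [oB fB]] := manifold_second_countable M.
pose D := [set b | B b /\ exists q : chart R n X * lb_idx L,
  [/\ atlas M q.1, b `<=` chart_dom q.1 & b `<=` lb_dom q.2]].
have cD : countable D by apply: sub_countable cB; apply: subset_card_le => b [].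
have covD x : exists2 b, D b & b x.
  have [c Mc cx] := atlas_cover M x.
  have nx : nbhs x (chart_dom c `&` lb_dom (lb_at L x)).
    apply: open_nbhs_nbhs; split; last by split=> //; exact: lb_atP.
    by apply: openI; [exact: chart_dom_open|exact: lb_dom_open].
  have [b [Bb bx] bsub] := fB x _ nx; exists b => //; split=> //.
  by exists (c, lb_at L x); split=> // y /bsub[].
have /pfcard_geP[D0|[g]] := cD.
  by have [b Db _] := covD point; rewrite D0 in Db.
have gD k : {q : chart R n X * lb_idx L |
    [/\ atlas M q.1, g k `<=` chart_dom q.1 & g k `<=` lb_dom q.2]}.
  by apply: cid; have [] : D (g k) by exact: funS.
exists (fun k => (projT1 (gD k)).1), (fun k => (projT1 (gD k)).2); split.
  by move=> k; have [] := projT2 (gD k).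
move=> x; have [b Db bx] := covD x; have [k _ kb] := @surj _ _ _ _ g b Db.
by exists k; have [_ h1 h2] := projT2 (gD k); split; [apply: h1|apply: h2]; rewrite kb.
Qed.

(** A measurable Lebesgue null set containing the image of [A] is pulled back by the real
    coordinates [psi]; the volume of the resulting Borel set is an integral over a null set. *)
Lemma chart_null_set (c : chart R n X) (A : set X) : atlas M c -> A `<=` chart_dom c ->
  (lebesgueC R n).-negligible (vecC (n := n) @^-1` (c @` A)) ->
  exists N : set (borel X), [/\ measurable N, vol N = 0%E & A `<=` N].
Proof.
move=> Mc Ac [Z [mZ Z0 AZ]].
have mD : measurable (chart_dom c : set (borel X)).
  by apply: measurable_borel_open; exact: chart_dom_open.
pose f (k : 'I_n) : borel X -> cpair R :=
  fun x => (((fun x => complex.Re (c x 0 k)) \_ (chart_dom c)) x,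
            ((fun x => complex.Im (c x 0 k)) \_ (chart_dom c)) x).
pose psi (x : borel X) : n.-tuple (cpair R) := [tuple f k x | k < n].
have coord_cont x k : chart_dom c x -> {for x, continuous (fun x => c x 0 k)}.
  move=> cx; apply/continuous_cnormP => e e0.
  have nc : nbhs (c x) [set w | forall k, cnorm (w 0 k - c x 0 k) < e] by apply/nbhs_rowP; exists e.
  have := nbhs_chart_preimage cx nc; apply: filterS => y [_ /(_ k)].
  exact.
have mpsi : measurable_fun setT psi.
  apply/measurable_fun_tnthP => k; rewrite (_ : _ \o _ = f k); last first.
    by apply/funext => x; rewrite /= tnth_mktuple.
  have mRe : measurable_fun (chart_dom c : set (borel X)) ((fun x => complex.Re (c x 0 k)) : borel X -> R).
    apply: continuous_borel_measurable; first exact: chart_dom_open.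
    by move=> x cx; exact: (continuous_Re_comp (coord_cont x k cx)).
  have mIm : measurable_fun (chart_dom c : set (borel X)) ((fun x => complex.Im (c x 0 k)) : borel X -> R).
    apply: continuous_borel_measurable; first exact: chart_dom_open.
    by move=> x cx; exact: (continuous_Im_comp (coord_cont x k cx)).
  by apply: measurable_fun_pair; apply/(measurable_restrictT _ mD).
have psiE x : chart_dom c x -> vecC (psi x) = c x.
  move=> cx; apply/rowP => k; rewrite vecCE tnth_mktuple /f !patchE mem_set// /pointC/=.
  by case: (c x 0 k).
have psi_vecC x t : chart_dom c x -> c x = vecC t -> psi x = t.
  move=> cx cE; apply: eq_from_tnth => k; rewrite tnth_mktuple /f !patchE mem_set// cE vecCE.
  by case: (tnth t k).
pose N : set (borel X) := chart_dom c `&` psi @^-1` Z.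
have mN : measurable N.
  by apply: measurableI => //; rewrite -[X in measurable X]setTI; exact: (mpsi measurableT Z mZ).
exists N; split=> //; last first.
  move=> x Ax; have cx := Ac x Ax; split=> //; apply: AZ.
  by rewrite /preimage/= psiE//; exists x.
rewrite (vol_omega Mc mN); last by move=> x [].
have E : vecC (n := n) @^-1` (c @` N) = Z `&` vecC (n := n) @^-1` chart_cod c.
  apply/seteqP; split=> t.
    move=> [x [cx Zx] xt]; split; last by exists x.
    by move: Zx; rewrite /preimage/= (psi_vecC x t).
  move=> [Zt [x cx xt]]; exists x => //; split=> //.
  by rewrite /preimage/= (psi_vecC x t).
have mcod : measurable (vecC (n := n) @^-1` chart_cod c).
  by apply: measurable_vecC_open; exact: chart_cod_open.
rewrite E; apply: null_set_integral; first exact: measurableI.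
  apply/measurable_EFinP; apply: (@measurable_funS _ _ _ _ (vecC (n := n) @^-1` chart_cod c)) => //.
  apply: (continuous_measurable_comp (g := vol_density omega c)).
  - exact: measurable_vecC_open.
  - exact: chart_cod_open.
  - by move=> z cz; exact: continuous_vol_density.
by apply: (subset_measure0 (measurableI _ _ mZ mcod) mZ) => // t [].
Qed.

End ChartNullSets.

Section HermitianProducts.
Variables (R : realType) (n : nat) (X : ptopologicalType) (M : complex_manifold R n X).
Local Notation C := (cplx R).
Variables (L : line_bundle M).

(** The real part of [a * conjc b]; [him] is its imaginary part. *)
Definition hre (a b : C) : R := complex.Re a * complex.Re b + complex.Im a * complex.Im b.
Definition him (a b : C) : R := complex.Im a * complex.Re b - complex.Re a * complex.Im b.

Lemma mul_conjc_real (a b : C) (r : R) :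
  a * conjc b * (r%:C)%C = ((hre a b * r) +i* (him a b * r))%C.
Proof.
case: a b => a1 a2 [b1 b2]; rewrite /hre /him /=.
by congr (_ +i* _)%C; rewrite /=; ring.
Qed.

(** Changing the trivialization multiplies the product of the components by [|g| ^+ 2], which the
    change of weight compensates. *)
Lemma hinnerE (h : lb_metric L) (s s' : sect L) i x :
  holomorphic_section setT s -> holomorphic_section setT s' -> lb_dom i x ->
  hinner h s s' x = ((hre (s i x) (s' i x) * expR (- weight h i x) ^+ 2) +i*
                     (him (s i x) (s' i x) * expR (- weight h i x) ^+ 2))%C.
Proof.
move=> [_ tr] [_ tr'] ix; rewrite /hinner -mul_conjc_real.
have ax := lb_atP L x; set a := lb_at L x in ax *.
rewrite (tr a i x Logic.I ax ix) (tr' a i x Logic.I ax ix) (weight_compat h ax ix).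
set g := lb_tr a i x; set e := expR _; rewrite -/(cnorm g).
have gg : g * conjc g = ((cnorm g ^+ 2)%:C)%C.
  case: g => g1 g2; rewrite cnormE sqr_sqrtr ?addr_ge0 ?sqr_ge0//.
  by apply/eqP; rewrite eq_complex /=; apply/andP; split; apply/eqP; ring.
have conjM (u v : C) : conjc (u * v) = conjc u * conjc v by rewrite -!conjcE rmorphM.
rewrite conjM exprMn (_ : ((cnorm g ^+ 2 * e ^+ 2)%:C)%C = ((cnorm g ^+ 2)%:C)%C * ((e ^+ 2)%:C)%C); last first.
  by rewrite rmorphM.
rewrite -gg; ring.
Qed.

End HermitianProducts.

Section MeasurableProducts.
Variables (R : realType) (n : nat) (X : ptopologicalType) (M : complex_manifold R n X).
Local Notation C := (cplx R).
Variables (L : line_bundle M).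

Lemma measurable_hre_him (U : set X) (N : set (borel X)) (f g : X -> C) (psi : borel X -> R) :
  open U -> (forall x, U x -> {for x, continuous f}) ->
  (forall x, U x -> {for x, continuous g}) ->
  measurable_fun (U : set (borel X)) psi -> measurable N ->
  measurable_fun (U `&` ~` N : set (borel X)) (fun x : borel X => hre (f x) (g x) * psi x) /\
  measurable_fun (U `&` ~` N : set (borel X)) (fun x : borel X => him (f x) (g x) * psi x).
Proof.
move=> oU cf cg mpsi mN.
have mU : measurable (U : set (borel X)) by exact: measurable_borel_open.
have mRe (u : X -> C) : (forall x, U x -> {for x, continuous u}) ->
    measurable_fun (U : set (borel X)) ((fun x => complex.Re (u x)) : borel X -> R).
  move=> cf'; apply: continuous_borel_measurable => // x Ux.
  exact: (continuous_Re_comp (cf' x Ux)).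
have mIm (u : X -> C) : (forall x, U x -> {for x, continuous u}) ->
    measurable_fun (U : set (borel X)) ((fun x => complex.Im (u x)) : borel X -> R).
  move=> cf'; apply: continuous_borel_measurable => // x Ux.
  exact: (continuous_Im_comp (cf' x Ux)).
split; apply: (@measurable_funS _ _ _ _ (U : set (borel X))) => //; try by move=> x [].
  have m1 := measurable_funM (mRe f cf) (mRe g cg).
  have m2 := measurable_funM (mIm f cf) (mIm g cg).
  exact: (measurable_funM (measurable_funD m1 m2) mpsi).
have m1 := measurable_funM (mIm f cf) (mRe g cg).
have m2 := measurable_funM (mRe f cf) (mIm g cg).
exact: (measurable_funM (measurable_funB m1 m2) mpsi).
Qed.

Variable (omega : hermitian_metric M) (vol : {measure set (borel X) -> \bar R}).
Hypothesis vol_omega : volume_measure omega vol.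

(** Only the weights of [L] in countably many trivializations may fail to be Borel. The null sets
    where they differ from their Borel versions do not involve [p] or the sections, so one [N]
    serves for all. *)
Lemma measurable_hinner (h : lb_metric L) : measurable_weights h ->
  exists N : set (borel X), [/\ measurable N, vol N = 0%E &
    forall p (s s' : sect (lb_pow L p)), holomorphic_section setT s ->
      holomorphic_section setT s' ->
      measurable_fun (~` N) (fun x : borel X => complex.Re (hinner (metric_pow h p) s s' x)) /\
      measurable_fun (~` N) (fun x : borel X => complex.Im (hinner (metric_pow h p) s s' x))].
Proof.
move=> mh; have [c [i [Mc covX]]] := countable_trivialization L.
pose bad k (psi : borel X -> R) :=
  [set x | [/\ chart_dom (c k) x, lb_dom (i k) x & weight h (i k) x <> psi x]].
have psiP k : {psi : borel X -> R | measurable_fun (lb_dom (i k) : set (borel X)) psi /\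
    exists N : set (borel X), [/\ measurable N, vol N = 0%E & bad k psi `<=` N]}.
  apply: cid; have [psi mpsi null] := mh (i k); exists psi; split=> //.
  by apply: (chart_null_set vol_omega (Mc k)) (null _ (Mc k)) => x [].
pose psi k := projT1 (psiP k).
have mpsi k : measurable_fun (lb_dom (i k) : set (borel X)) (psi k) by have [] := projT2 (psiP k).
have NP k : {N : set (borel X) | [/\ measurable N, vol N = 0%E & bad k (psi k) `<=` N]}.
  by apply: cid; have [] := projT2 (psiP k).
pose N := \bigcup_k projT1 (NP k).
have mNk k : measurable (projT1 (NP k)) by have [] := projT2 (NP k).
have mN : measurable N by exact: bigcupT_measurable.
exists N; split=> //.
  apply/(negligibleP vol mN); apply: negligible_bigcup => k.
  by apply/(negligibleP vol (mNk k)); have [] := projT2 (NP k).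
move=> p s s' hs hs'.
pose U k := chart_dom (c k) `&` lb_dom (i k).
have oU k : open (U k) by apply: openI; [exact: chart_dom_open|exact: lb_dom_open].
pose e k (x : borel X) := expR (- (p%:R * psi k x)) ^+ 2.
have me k : measurable_fun (U k : set (borel X)) (e k).
  apply: (@measurable_funS _ _ _ _ (lb_dom (i k) : set (borel X))); last 1 first.
  - apply: measurable_funX; apply: (measurableT_comp (@measurable_expR R)).
    by apply: measurableT_comp => //; apply: measurable_funM => //; exact: mpsi.
  - by apply: measurable_borel_open; exact: lb_dom_open.
  - by move=> x [].
have eq_psi k x : U k x -> ~ N x -> weight h (i k) x = psi k x.
  move=> [cx ix] nNx; apply: contrapT => ne; apply: nNx; exists k => //.
  by have [_ _] := projT2 (NP k); apply.
have cs (u : sect (lb_pow L p)) k : holomorphic_section setT u ->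
    forall x, U k x -> {for x, continuous (u (i k))}.
  by move=> [hs0 _] x [_ ix]; apply: (holomorphic_continuous (hs0 (i k))); split.
have cover : ~` N = \bigcup_k (U k `&` ~` N).
  apply/seteqP; split=> [x nNx|x [k _ []]//].
  by have [k Ukx] := covX x; exists k.
have mUN k : measurable (U k `&` ~` N : set (borel X)).
  by apply: measurableI; [exact: measurable_borel_open|exact: measurableC].
have mk k := @measurable_hre_him (U k) N (s (i k)) (s' (i k)) (e k) (oU k)
  (cs s k hs) (cs s' k hs') (me k) mN.
have hE k x : (U k `&` ~` N) x -> hinner (metric_pow h p) s s' x =
   ((hre (s (i k) x) (s' (i k) x) * e k x) +i* (him (s (i k) x) (s' (i k) x) * e k x))%C.
  move=> [Ukx nNx]; have [_ ix] := Ukx.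
  by rewrite (@hinnerE R n X M (lb_pow L p) (metric_pow h p) s s' (i k) x hs hs' ix) /= (eq_psi k x Ukx nNx).
rewrite cover; split; apply/measurable_fun_bigcup => // k.
  apply: eq_measurable_fun (proj1 (mk k)) => x /set_mem /hE ->; by [].
apply: eq_measurable_fun (proj2 (mk k)) => x /set_mem /hE ->; by [].
Qed.

End MeasurableProducts.

(** * Combinations of sections and orthonormal families *)

Section LinearCombinations.
Variables (R : realType) (n : nat) (X : ptopologicalType) (M : complex_manifold R n X).
Local Notation C := (cplx R).

Lemma holomorphic_on_lin (U : set X) (f g : X -> C) (a : C) :
  holomorphic_on M U f -> holomorphic_on M U g -> holomorphic_on M U (fun x => a * f x + g x).
Proof.
move=> hf hg c x Mc cx Ux.
have df := hf c x Mc cx Ux; have dg := hg c x Mc cx Ux.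
have da : differentiable (cst a : 'rV[C]_n -> C) (c x) by exact: differentiable_cst.
exact: (differentiableD (differentiableM da df) dg).
Qed.

Lemma holomorphic_on_cst (U : set X) (a : C) : holomorphic_on M U (fun=> a).
Proof.
move=> c x _ _ _.
have : differentiable (cst a : 'rV[C]_n -> C) (c x) by exact: differentiable_cst.
exact.
Qed.

Variable L : line_bundle M.

Definition comb (r : seq nat) (a : nat -> C) (B : nat -> sect L) : sect L :=
  fun i x => \sum_(j <- r) a j * B j i x.

Lemma comb_nil a B : comb [::] a B = fun _ _ => 0.
Proof. by apply/funext => i; apply/funext => x; rewrite /comb big_nil. Qed.

Lemma comb_cons j r a B : comb (j :: r) a B = fun i x => a j * B j i x + comb r a B i x.
Proof. by apply/funext => i; apply/funext => x; rewrite /comb big_cons. Qed.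

Lemma holomorphic_section_comb r a B U :
  (forall j, j \in r -> holomorphic_section U (B j)) -> holomorphic_section U (comb r a B).
Proof.
elim: r => [_|j r IH hB].
  by rewrite comb_nil; split=> [i|i k x]; [exact: holomorphic_on_cst|rewrite mulr0].
rewrite comb_cons; have [h1 t1] := hB j (mem_head _ _).
have [|h2 t2] := IH; first by move=> k kr; apply: hB; rewrite in_cons kr orbT.
split=> [i|i k x Ux ix kx]; first exact: holomorphic_on_lin.
by rewrite (t1 i k)// (t2 i k)// mulrDr !mulrA [a j * _]mulrC.
Qed.

End LinearCombinations.

Lemma vanishes_to_order_comb (R : realType) (n : nat) (X : ptopologicalType)
    (M : complex_manifold R n.+1 X) (Sigma : set X) (L : line_bundle M) r a
    (B : nat -> sect L) k :
  (forall j, j \in r -> vanishes_to_order Sigma (B j) k) ->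
  vanishes_to_order Sigma (comb r a B) k.
Proof.
elim: r => [_|j r IH vB] c i Mc adc.
  rewrite comb_nil; exists (fun=> 0); first exact: holomorphic_on_cst.
  by move=> x _ _; rewrite mulr0.
rewrite comb_cons; have [g1 h1 e1] := vB j (mem_head _ _) c i Mc adc.
have [|g2 h2 e2] := IH _ c i Mc adc; first by move=> l lr; apply: vB; rewrite in_cons lr orbT.
exists (fun x => a j * g1 x + g2 x); first exact: holomorphic_on_lin.
by move=> x cx ix; rewrite e1// e2// mulrDr mulrCA.
Qed.

Section HreAlgebra.
Variable R : realType.
Local Notation C := (cplx R).

Lemma hre_diag (a : C) : hre a a = cnorm a ^+ 2.
Proof. by rewrite cnormE sqr_sqrtr ?addr_ge0 ?sqr_ge0// /hre -!expr2. Qed.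

Lemma hre_mul (a b a' b' : C) : hre (a * b) (a' * b') = hre a a' * hre b b' - him a a' * him b b'.
Proof. by case: a b a' b' => ? ? [? ?] [? ?] [? ?]; rewrite /hre /him /=; ring. Qed.

Lemma hreDl (a b c : C) : hre (a + b) c = hre a c + hre b c.
Proof. by case: a b c => ? ? [? ?] [? ?]; rewrite /hre /=; ring. Qed.

Lemma hreDr (a b c : C) : hre c (a + b) = hre c a + hre c b.
Proof. by case: a b c => ? ? [? ?] [? ?]; rewrite /hre /=; ring. Qed.

Lemma hre_sum (I : Type) (r : seq I) (u : I -> C) :
  hre (\sum_(j <- r) u j) (\sum_(j <- r) u j) = \sum_(j <- r) \sum_(k <- r) hre (u j) (u k).
Proof.
have hl c (s : seq I) : hre (\sum_(j <- s) u j) c = \sum_(j <- s) hre (u j) c.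
  elim: s => [|j s IH]; first by rewrite !big_nil /hre !mul0r addr0.
  by rewrite !big_cons hreDl IH.
have hr c (s : seq I) : hre c (\sum_(j <- s) u j) = \sum_(j <- s) hre c (u j).
  elim: s => [|j s IH]; first by rewrite !big_nil /hre !mulr0 addr0.
  by rewrite !big_cons hreDr IH.
by rewrite hl; apply: eq_bigr => j _; rewrite hr.
Qed.

Lemma hre_him_le (a b : C) :
  `|hre a b| <= hre a a + hre b b /\ `|him a b| <= hre a a + hre b b.
Proof.
case: a b => a1 a2 [b1 b2]; rewrite /hre /him /=.
have [p1 p2 p3 p4] := And4 (sqr_ge0 (a1 + b1)) (sqr_ge0 (a1 - b1)) (sqr_ge0 (a2 + b2)) (sqr_ge0 (a2 - b2)).
have [q1 q2 q3 q4] := And4 (sqr_ge0 (a1 + b2)) (sqr_ge0 (a1 - b2)) (sqr_ge0 (a2 + b1)) (sqr_ge0 (a2 - b1)).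
have [s1 s2 s3 s4] := And4 (sqr_ge0 a1) (sqr_ge0 a2) (sqr_ge0 b1) (sqr_ge0 b2).
by split; rewrite ler_norml; apply/andP; split; lra.
Qed.

End HreAlgebra.

Section Orthonormal.
Variables (R : realType) (n : nat) (X : ptopologicalType) (M : complex_manifold R n.+1 X).
Local Notation C := (cplx R).
Variables (L : line_bundle M) (h : lb_metric L) (vol : {measure set (borel X) -> \bar R}).
Variable N : set (borel X).
Hypotheses (mN : measurable N) (N0 : vol N = 0%E).
Hypothesis mH : forall s s' : sect L, holomorphic_section setT s -> holomorphic_section setT s' ->
  measurable_fun (~` N) (fun x : borel X => complex.Re (hinner h s s' x)) /\
  measurable_fun (~` N) (fun x : borel X => complex.Im (hinner h s s' x)).

Lemma hinner_at (s s' : sect L) x : let i := lb_at L x in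
  hinner h s s' x = ((hre (s i x) (s' i x) * expR (- weight h i x) ^+ 2) +i*
                     (him (s i x) (s' i x) * expR (- weight h i x) ^+ 2))%C.
Proof. by rewrite /= /hinner -mul_conjc_real. Qed.

Lemma hnorm_hinner (s : sect L) x : hnorm h s x ^+ 2 = complex.Re (hinner h s s x).
Proof. by rewrite hinner_at /= hre_diag /hnorm exprMn. Qed.

Lemma hinner_le (s s' : sect L) x :
  `|complex.Re (hinner h s s' x)| <= hnorm h s x ^+ 2 + hnorm h s' x ^+ 2 /\
  `|complex.Im (hinner h s s' x)| <= hnorm h s x ^+ 2 + hnorm h s' x ^+ 2.
Proof.
rewrite !hnorm_hinner !hinner_at /=; set i := lb_at L x; set e := _ ^+ 2.
have e0 : 0 <= e by exact: sqr_ge0.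
clearbody e; have [h1 h2] := hre_him_le (s i x) (s' i x).
by rewrite !normrM (ger0_norm e0) -mulrDl; split; rewrite ler_wpM2r.
Qed.

(** The squared norm expands into real and imaginary parts of the products of the [B j]. Each is
    dominated by the sum of two squared norms, hence integrable, so the values given by
    orthonormality may be added. *)
Lemma orthonormal_comb_norm (r : seq nat) (a : nat -> C) (B : nat -> sect L) : uniq r ->
  (forall j, j \in r -> bergman_space vol h (B j)) ->
  (forall j k, j \in r -> k \in r -> bergman_inner vol h (B j) (B k) = (j == k)%:R) ->
  (\int[vol]_x (hnorm h (comb r a B) x ^+ 2)%:E = (\sum_(j <- r) cnorm (a j) ^+ 2)%:E)%E.
Proof.
move=> ur sB oB.
have diag j : j \in r -> has_integral vol N (fun x => hnorm h (B j) x ^+ 2)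
    (\int[vol]_x (hnorm h (B j) x ^+ 2)).
  move=> jr; have [hB fB] := sB j jr.
  apply: (has_integral_dominated mN N0 (v := fun x => hnorm h (B j) x ^+ 2)) => //.
    by have [+ _] := mH hB hB; apply: eq_measurable_fun => x _; rewrite hnorm_hinner.
  by move=> x; rewrite ger0_norm// sqr_ge0.
have cross j k : j \in r -> k \in r ->
    has_integral vol N (fun x => complex.Re (hinner h (B j) (B k) x)) (j == k)%:R /\
    has_integral vol N (fun x => complex.Im (hinner h (B j) (B k) x)) 0.
  move=> jr kr; have [hj _] := sB j jr; have [hk _] := sB k kr.
  have [_ fin] := has_integralD mN N0 (diag j jr) (diag k kr).
  have fin' : (\int[vol]_x (hnorm h (B j) x ^+ 2 + hnorm h (B k) x ^+ 2)%:E < +oo)%E.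
    by rewrite fin ltry.
  have [mR mI] := mH hj hk.
  have iR := has_integral_dominated mN N0 mR (fun x => proj1 (hinner_le (B j) (B k) x)) fin'.
  have iI := has_integral_dominated mN N0 mI (fun x => proj2 (hinner_le (B j) (B k) x)) fin'.
  have := oB j k jr kr; rewrite /bergman_inner => E.
  have ER : \int[vol]_x complex.Re (hinner h (B j) (B k) x) = (j == k)%:R.
    by have := congr1 (@complex.Re R) E; rewrite /=; case: (j == k).
  have EI : \int[vol]_x complex.Im (hinner h (B j) (B k) x) = 0.
    by have := congr1 (@complex.Im R) E; rewrite /=; case: (j == k).
  by rewrite -{1}ER -EI.
have [_] : has_integral vol N (fun x => \sum_(j <- r) \sum_(k <- r)
    (hre (a j) (a k) * complex.Re (hinner h (B j) (B k) x) +
     (- him (a j) (a k)) * complex.Im (hinner h (B j) (B k) x)))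
    (\sum_(j <- r) \sum_(k <- r) (hre (a j) (a k) * (j == k)%:R + (- him (a j) (a k)) * 0)).
  apply: (has_integral_sum mN N0) => j jr; apply: (has_integral_sum mN N0) => k kr.
  have [iR iI] := cross j k jr kr.
  by apply: (has_integralD mN N0); apply: (has_integralZ mN N0).
have -> : \sum_(j <- r) \sum_(k <- r) (hre (a j) (a k) * (j == k)%:R + (- him (a j) (a k)) * 0)
    = \sum_(j <- r) cnorm (a j) ^+ 2.
  apply: eq_big_seq => j jr; rewrite (bigD1_seq j)//= eqxx mulr1 mulr0 addr0 big1 ?addr0 ?hre_diag//.
  by move=> k /negbTE kj; rewrite eq_sym kj !mulr0 addr0.
move=> <-; apply: eq_integral => x _; congr EFin.
rewrite hnorm_hinner hinner_at /= /comb hre_sum mulr_suml; apply: eq_bigr => j _.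
rewrite mulr_suml; apply: eq_bigr => k _; rewrite hinner_at /= hre_mul; ring.
Qed.

End Orthonormal.

(** * The kernel bound *)

Section SliceCalculus.
Variables (R : realType) (n : nat).
Local Notation C := (cplx R).
Implicit Types (F : 'rV[C]_n.+1 -> C) (z : 'rV[C]_n.+1).

Lemma near_slice z k (P : 'rV[C]_n.+1 -> Prop) :
  (\forall w \near z, P w) -> \forall b \near z 0 k, P (slice z k b).
Proof.
move=> /nbhs_rowP[r r0 rP]; apply/nbhs_cnormP; exists r => // b br.
by apply: rP => j; rewrite sliceE; case: eqP => [->//|_]; rewrite subrr cnorm0.
Qed.

Lemma derivable_slice1 F z k : differentiable F z ->
  derivable (fun b => F (slice z k b)) (z 0 k) 1.
Proof.
move=> dF; have := @derivable_slice R n.+1 F z k 1 (z 0 k).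
have -> : (fun b => F (slice z k (1 * b))) = (fun b => F (slice z k b)).
  by apply/funext => b; rewrite mul1r.
by rewrite mul1r slice_id; exact.
Qed.

Lemma differentiable_div F1 F2 z : differentiable F1 z -> differentiable F2 z ->
  F2 z != 0 -> differentiable (fun w => F1 w * (F2 w)^-1) z.
Proof. move=> d1 d2 nz; exact: (differentiableM d1 (differentiableV d2 nz)). Qed.

End SliceCalculus.

(** * Coefficients of sections in a frame *)

Section FrameDivision.
Variables (R : realType) (n : nat) (X : ptopologicalType) (M : complex_manifold R n.+1 X).
Local Notation C := (cplx R).
Variables (L : line_bundle M) (p : nat) (c : chart R n.+1 X) (s : sect (lb_pow L p)) (e : sect L).
Hypotheses (Mc : atlas M c) (hs : holomorphic_section setT s).
Hypothesis he : holomorphic_frame (chart_dom c) e.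

Definition frame_coef (z : 'rV[C]_n.+1) : C :=
  let y := chart_inv c z in s (lb_at L y) y * (e (lb_at L y) y ^+ p)^-1.

Lemma frame_neq0 i y : chart_dom c y -> lb_dom i y -> e i y != 0.
Proof. by move=> cy iy; exact: (proj2 he). Qed.

(** Both [s] and the p-th power of [e] transform by the p-th power of the transition function, which
    cancels in the quotient; any trivialization may thus be used near a point. *)
Lemma frame_coefE i y : chart_dom c y -> lb_dom i y ->
  frame_coef (c y) = s i y * (e i y ^+ p)^-1.
Proof.
move=> cy iy; rewrite /frame_coef chart_invK//.
have ay := lb_atP L y; set a := lb_at L y in ay *.
have [[_ tre] _] := he; have [_ trs] := hs.
have ne := frame_neq0 cy ay.
rewrite (trs a i y Logic.I ay iy) (tre a i y cy ay iy) /=.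
have g0 : lb_tr a i y != 0 by move: ne; rewrite (tre a i y cy ay iy) mulf_eq0 => /norP[].
by rewrite exprMn invfM mulrACA divff ?mul1r// expf_neq0.
Qed.

Lemma frame_coef_near i y : chart_dom c y -> lb_dom i y ->
  \forall z \near c y, exists w, [/\ chart_dom c w, lb_dom i w, c w = z &
    frame_coef z = s i w * (e i w ^+ p)^-1].
Proof.
move=> cy iy.
have ni : nbhs y (lb_dom i) by apply: open_nbhs_nbhs; split=> //; exact: lb_dom_open.
apply: filterS (nbhs_chart_image cy ni) => z [w [cw iw wz]].
by exists w; split=> //; rewrite -wz (frame_coefE cw iw).
Qed.

Lemma frame_pow_differentiable i y : chart_dom c y -> lb_dom i y ->
  differentiable ((fun x => e i x ^+ p) \o chart_inv c : 'rV[C]_n.+1 -> C) (c y).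
Proof.
by move=> cy iy; apply: (holomorphic_onX p (proj1 (proj1 he) i)) => //; split.
Qed.

Lemma frame_coef_local i y : chart_dom c y -> lb_dom i y ->
  differentiable (fun z => s i (chart_inv c z) * (e i (chart_inv c z) ^+ p)^-1) (c y) /\
  {near c y, (fun z => s i (chart_inv c z) * (e i (chart_inv c z) ^+ p)^-1) =1 frame_coef}.
Proof.
move=> cy iy; split.
  apply: (@differentiable_div R n (s i \o chart_inv c) ((fun x => e i x ^+ p) \o chart_inv c)).
  - by apply: (proj1 hs i c y Mc cy); split.
  - exact: frame_pow_differentiable.
  - by rewrite /= chart_invK// expf_neq0// frame_neq0.
apply: filterS (frame_coef_near cy iy) => z [w [cw iw <- ->]].
by rewrite chart_invK.
Qed.

Lemma frame_coef_continuous y : chart_dom c y -> {for c y, continuous frame_coef}.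
Proof.
move=> cy; have [d eqf] := frame_coef_local cy (lb_atP L y).
exact: near_eq_continuous eqf (differentiable_continuous d).
Qed.

Lemma frame_coef_derivable y k : chart_dom c y ->
  derivable (fun b => frame_coef (slice (c y) k b)) (c y 0 k) 1.
Proof.
move=> cy; have [d eqf] := frame_coef_local cy (lb_atP L y).
have dk := derivable_slice1 (k := k) d.
by apply: near_eq_derivable dk; exact: near_slice eqf.
Qed.

Lemma frame_coef_vanishing Sigma m y : adapted Sigma c -> vanishes_to_order Sigma s m ->
  chart_dom c y -> c y 0 0 = 0 ->
  exists2 g : C -> C, derivable g 0 1 &
    \forall a \near (0 : C), frame_coef (slice (c y) 0 a) = a ^+ m * g a.
Proof.
move=> ad vs cy c0; have iy := lb_atP L y; set i := lb_at L y in iy.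
have [g hg sg] := vs c i Mc ad.
pose G z := g (chart_inv c z) * (e i (chart_inv c z) ^+ p)^-1.
have dG : differentiable G (c y).
  apply: (@differentiable_div R n (g \o chart_inv c) ((fun x => e i x ^+ p) \o chart_inv c)).
  - by apply: (hg c y Mc cy); split.
  - exact: frame_pow_differentiable.
  - by rewrite /= chart_invK// expf_neq0// frame_neq0.
exists (fun a => G (slice (c y) 0 a)); first by have := derivable_slice1 (k := 0) dG; rewrite c0.
have := near_slice 0 (frame_coef_near cy iy); rewrite c0; apply: filterS => a.
move=> [w [cw iw wa ->]]; rewrite sg// /G -wa chart_invK// mulrA.
by rewrite wa sliceE eqxx.
Qed.

Variable h : lb_metric L.

Lemma hnorm_frame_coef y : chart_dom c y ->
  hnorm (metric_pow h p) s y = cnorm (frame_coef (c y)) * expR (- (p%:R * frame_weight h e y)).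
Proof.
move=> cy; have ay := lb_atP L y; rewrite (frame_coefE cy ay) /hnorm /frame_weight /=.
rewrite -/(cnorm (s (lb_at L y) y)) /hnorm -/(cnorm (e (lb_at L y) y)).
have ne := frame_neq0 cy ay; have e0 : 0 < cnorm (e (lb_at L y) y) by rewrite cnorm_gt0.
rewrite mulrN opprK expRM_natl lnK ?posrE ?mulr_gt0 ?expR_gt0//.
rewrite cnormM cnormV cnormX exprMn [in RHS]mulrA mulfVK; last first.
  by rewrite expf_neq0// gt_eqF.
by rewrite -mulrN expRM_natl.
Qed.

End FrameDivision.

(** * The pointwise bound for one section *)

Section SectionBound.
Variables (R : realType) (n : nat) (X : ptopologicalType) (M : complex_manifold R n.+1 X).
Local Notation C := (cplx R).
Variables (Sigma E : set X) (W : hyp_cover M Sigma E).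

(** The point is that the set under [sup] is bounded: locally the frame weight is
    [weight h i - ln |e j i|], with bounded first term and continuous second one, and the polydisk
    of radius 2 is compact. *)
Lemma frame_weight_le (L : line_bundle M) (h : lb_metric L) (e : 'I_(cover_size W) -> sect L) j y :
  locally_bounded_weights h -> frames_over e ->
  polydisk (cover_chart j) (cover_center j) 2 y ->
  `|frame_weight h (e j) y| <= metric_sup h e.
Proof.
move=> lb he py.
have ubd : has_ubound [set `|frame_weight h (e j) w|
    | w in polydisk (cover_chart j) (cover_center j) 2].
  have cK : compact (polydisk (cover_chart j) (cover_center j) 2) by exact: polydisk_compact.
  have [|b Hb] := compact_locally_bounded (g := fun w => `|frame_weight h (e j) w|) cK.
    move=> x [cx _]; have ix := lb_atP L x; set i := lb_at L x in ix.
    have [V [b [xV Vb]]] := lb i x ix.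
    have [[hole tre] ne] := he j.
    have e0 y' : chart_dom (cover_chart j) y' -> lb_dom i y' -> 0 < cnorm (e j i y').
      by move=> cy iy; rewrite cnorm_gt0; exact: ne.
    have ce : {for x, continuous (e j i)} by apply: (holomorphic_continuous (hole i)); split.
    have cln : {for x, continuous (fun y => ln (cnorm (e j i y)))}.
      apply: (continuous_comp (continuous_cnorm_comp ce)).
      by apply: continuous_ln; exact: e0.
    have /cvgrPdist_lt/(_ 1 ltr01) near_ln := cln.
    pose l0 := `|ln (cnorm (e j i x))|.
    exists (V `&` ((lb_dom i `&` chart_dom (cover_chart j)) `&`
      [set y | `|ln (cnorm (e j i x)) - ln (cnorm (e j i y))| < 1])), (b + (l0 + 1)); split.
      apply: filterI => //; apply: filterI near_ln.
      apply: open_nbhs_nbhs; split=> //.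
      by apply: openI; [exact: lb_dom_open|exact: chart_dom_open].
    move=> w [Vw [[iw cw] lw]] _; rewrite /frame_weight.
    rewrite (@hnormE _ _ _ _ _ h (chart_dom (cover_chart j)) (e j) i w (proj1 (he j)) cw iw).
    rewrite lnM ?posrE ?expR_gt0 ?e0// expRK normrN.
    apply: (le_trans (ler_normD _ _)); rewrite normrN addrC lerD//; first exact: Vb.
    have lw' : `|ln (cnorm (e j i x)) - ln (cnorm (e j i w))| < 1 by exact: lw.
    have := lerB_dist (ln (cnorm (e j i w))) (ln (cnorm (e j i x))).
    by rewrite distrC => /le_lt_trans/(_ lw'); rewrite ltrBlDl /l0 => /ltW.
  by exists b => _ [w pw <-]; exact: Hb.
apply: (@le_trans _ _ (sup [set `|frame_weight h (e j) w|
    | w in polydisk (cover_chart j) (cover_center j) 2])).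
  by apply: ub_le_sup => //; exists y.
exact: (le_bigmax _ (fun j => sup [set `|frame_weight h (e j) w|
    | w in polydisk (cover_chart j) (cover_center j) 2]) j).
Qed.

Variables (omega : hermitian_metric M) (vol : {measure set (borel X) -> \bar R}).
Hypothesis vol_omega : volume_measure omega vol.

Lemma polydisk2_cod (j : 'I_(cover_size W)) : @polydisk2 R n `<=` chart_cod (cover_chart j).
Proof.
move=> z z2; apply: cover_polydisk => k; have [_ _ ->] := cover_centerP j.
by rewrite mxE subr0; exact: z2.
Qed.

Lemma polydiskE (j : 'I_(cover_size W)) r x : polydisk (cover_chart j) (cover_center j) r x <->
  chart_dom (cover_chart j) x /\ forall k, cnorm (cover_chart j x 0 k) <= r.
Proof.
have [_ _ c0] := cover_centerP j.
by split=> -[cx h]; split=> // k; have := h k; rewrite c0 mxE subr0.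
Qed.

(** The constant is the product of the mean value constant and the volume constant of the chart,
    hence is found before the bundle, its metric, the frames, the power and the order of
    vanishing. *)
Lemma section_bound_at (j : 'I_(cover_size W)) : exists2 B : R, 0 <= B &
  forall (L : line_bundle M) (h : lb_metric L) (e : 'I_(cover_size W) -> sect L) (p m : nat)
    (s : sect (lb_pow L p)),
    locally_bounded_weights h -> frames_over e ->
    holomorphic_section setT s -> vanishes_to_order Sigma s m ->
  forall x, polydisk (cover_chart j) (cover_center j) 1 x ->
  ((hnorm (metric_pow h p) s x ^+ 2)%:E <=
    (B * cnorm (cover_chart j x 0 0) ^+ (2 * m) * expR (4 * p%:R * metric_sup h e))%:E *
    \int[vol]_y (hnorm (metric_pow h p) s y ^+ 2)%:E)%E.
Proof.
set c := cover_chart j; have Mc : atlas M c by exact: cover_atlas.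
have mK := @measurable_polydisk2 R n.
have cK : compact (@polydisk2 R n) by exact: compact_polydisk0.
have [B B0 HB] := volume_lower_bound vol_omega Mc cK (@polydisk2_cod j) mK.
exists (L2_const R ^+ n.+1 * B).
  by rewrite mulr_ge0 ?exprn_ge0 ?L2_const_ge0// ltW.
move=> L h e p m s lb he hs vs x px.
set N := metric_sup h e; pose f := frame_coef c s (e j); have hej := he j.
have wN y : polydisk c (cover_center j) 2 y -> `|frame_weight h (e j) y| <= N.
  exact: frame_weight_le.
(* The cost of one comparison of weights for squared norms. It is paid twice, at [x] and under the
   integral, which makes the exponent 4. *)
pose k := expR (2 * p%:R * N); have k0 : 0 < k by exact: expR_gt0.
pose Kx := polydisk c (cover_center j) 2.
have mKx : measurable (Kx : set (borel X)).
  rewrite -[Kx]setCK; apply: measurableC; apply: measurable_borel_open; apply: closed_openC.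
  by apply: compact_closed; [exact: (manifold_hausdorff M)|exact: polydisk_compact].
(* Cut off so as to be Borel on all of [X], as the volume comparison requires. *)
pose F : borel X -> \bar R := (fun y : borel X => (cnorm (f (c y)) ^+ 2)%:E) \_ Kx.
have mF : measurable_fun setT F.
  apply/(measurable_restrictT _ mKx).
  apply: (@measurable_funS _ _ _ _ (chart_dom c : set (borel X))).
  - by apply: measurable_borel_open; exact: chart_dom_open.
  - by move=> y [].
  - apply/measurable_EFinP; apply: (@continuous_borel_measurable R X _ (fun y => cnorm (f (c y)) ^+ 2)).
      exact: chart_dom_open.
    move=> y cy; have cf := frame_coef_continuous Mc hs hej cy.
    have c2 := continuous_cnorm_comp (continuous_comp (chart_map_cont cy) cf).
    exact: (@continuousM R _ _ _ y c2 c2).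
have F0 y : (0 <= F y)%E by rewrite /F patchE; case: ifP => // _; rewrite lee_fin sqr_ge0.
have hn y : chart_dom c y ->
    hnorm (metric_pow h p) s y ^+ 2 = cnorm (f (c y)) ^+ 2 * expR (- (2 * p%:R * frame_weight h (e j) y)).
  move=> cy; rewrite (hnorm_frame_coef hs hej h cy) exprMn; congr (_ * _).
  by rewrite -expRM_natl; congr expR; ring.
have cmp y : Kx y -> - (2 * p%:R * frame_weight h (e j) y) <= 2 * p%:R * N /\
    - (2 * p%:R * N) <= - (2 * p%:R * frame_weight h (e j) y).
  move=> /wN; rewrite ler_norml => /andP[h1 h2].
  have p0 : 0 <= 2 * p%:R :> R by rewrite mulr_ge0.
  by split; [rewrite -mulrN ler_wpM2l// lerNl|rewrite lerN2 ler_wpM2l].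
have Kx1 : Kx x.
  have [cx hx] := px; split=> // l; apply: (le_trans (hx l)); exact: ler1n.
have int_F : (\int[vol]_y F y <= k%:E * \int[vol]_y (hnorm (metric_pow h p) s y ^+ 2)%:E)%E.
  rewrite -lee_pdivrMl// -ge0_integralZl//; last by rewrite lee_fin invr_ge0 ltW.
  (* With the empty null set this is monotonicity of the integral without measurability, which the
     norm of [s] need not have. *)
  apply: (@ge0_le_integral_off_null _ (borel X) R vol set0 measurable0 (measure0 vol)).
  - by move=> y; rewrite mule_ge0// lee_fin invr_ge0 ltW.
  - by move=> y; rewrite lee_fin sqr_ge0.
  move=> y _; rewrite /F patchE; case: ifPn => [/set_mem Ky|_]; last first.
    by rewrite mule0 lee_fin sqr_ge0.
  have [cy _] := Ky; rewrite -EFinM lee_fin hn// mulrC ler_wpM2l ?sqr_ge0//.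
  by rewrite /k -expRN ler_expR; have [] := cmp y Ky.
have cf z : chart_cod c z -> {for z, continuous f}.
  by move=> [y cy <-]; exact: (frame_coef_continuous Mc hs hej cy).
have df z l : chart_cod c z -> derivable (fun b => f (slice z l b)) (z 0 l) 1.
  by move=> [y cy <-]; exact: (frame_coef_derivable Mc hs hej (k := l) cy).
have vf z : polydisk2 z -> z 0 0 = 0 -> exists2 g : C -> C, derivable g 0 1 &
     \forall a \near (0 : C), f (slice z 0 a) = a ^+ m * g a.
  move=> /(@polydisk2_cod j)[y cy <-] c0.
  exact: (frame_coef_vanishing Mc hs hej (cover_adapted j) vs cy c0).
have [cx x1] := proj1 (polydiskE j 1 x) px.
have main := @local_L2_bound R n (chart_cod c) f m (@chart_cod_open _ _ _ c) (@polydisk2_cod j)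
  cf df vf (c x) x1.
have eqF : (\int[lebesgueC R n.+1]_(t in vecC (n := n.+1) @^-1` @polydisk2 R n)
      (cnorm (f (vecC t)) ^+ 2)%:E =
    \int[lebesgueC R n.+1]_(t in vecC (n := n.+1) @^-1` @polydisk2 R n)
      F (chart_inv c (vecC t)))%E.
  apply: eq_integral => t /set_mem Kt; have [y cy yt] := @polydisk2_cod j _ Kt.
  rewrite -yt chart_invK// /F patchE ifT//; apply/mem_set/(polydiskE j 2 y); split=> // l.
  by have := Kt l; rewrite -yt.
rewrite {}eqF in main.
have hx : hnorm (metric_pow h p) s x ^+ 2 <= k * cnorm (f (c x)) ^+ 2.
  by rewrite hn// mulrC ler_wpM2r ?sqr_ge0// /k ler_expR; have [] := cmp x Kx1.
apply: (@le_trans _ _ (k * cnorm (f (c x)) ^+ 2)%:E); first by rewrite lee_fin.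
set z0 := cnorm _ ^+ (2 * m); have z00 : 0 <= z0 by rewrite exprn_ge0 ?cnorm_ge0.
have -> : L2_const R ^+ n.+1 * B * z0 * expR (4 * p%:R * N) = k * (L2_const R ^+ n.+1 * z0) * (B * k).
  have -> : expR (4 * p%:R * N) = k * k by rewrite /k -expRD; congr expR; ring.
  ring.
rewrite [X in (X <= _)%E]EFinM [X in (_ <= X * _)%E]EFinM [X in (_ <= X * _ * _)%E]EFinM -!muleA.
apply: lee_wpmul2l; first by rewrite lee_fin ltW.
apply: (le_trans main); apply: lee_wpmul2l.
  by rewrite lee_fin mulr_ge0// exprn_ge0// L2_const_ge0.
apply: (le_trans (HB F mF F0)); rewrite EFinM -muleA; apply: lee_wpmul2l => //.
by rewrite lee_fin ltW.
Qed.

End SectionBound.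

(** * From one section to the kernel *)

Section KernelBound.
Variables (R : realType) (n : nat) (X : ptopologicalType) (M : complex_manifold R n.+1 X).
Local Notation C := (cplx R).
Variables (Sigma : set X) (O : line_bundle M) (S : sect O) (hSigma : lb_metric O).
Hypotheses (S_can : canonical_section Sigma S) (hSigma_smooth : smooth_metric hSigma).
Variables (E : set X) (W : hyp_cover M Sigma E).

Lemma expeR_log_norm x : expeR (log_norm hSigma S x) = (hnorm hSigma S x)%:E.
Proof.
apply/eqP; rewrite lneK_eq lee_fin mulr_ge0 ?expR_ge0//; exact: cnorm_ge0.
Qed.

Lemma hnorm_ge0 (L : line_bundle M) (h : lb_metric L) s x : 0 <= hnorm h s x.
Proof. by rewrite mulr_ge0 ?expR_ge0//; exact: cnorm_ge0. Qed.

Lemma cnorm_conj (a : C) : cnorm (conjc a) = cnorm a.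
Proof. by case: a => a b; rewrite !cnormE /= sqrrN. Qed.

(* The combination of the basis sections with the conjugates of their values at
   [x] as coefficients is extremal at [x]. *)
Lemma partial_kernel_bound (L : line_bundle M) (h : lb_metric L)
    (vol : {measure set (borel X) -> \bar R}) (N : set (borel X)) (K : R) x
    (r : seq nat) (B : nat -> sect L) :
  measurable N -> vol N = 0%E ->
  (forall s s' : sect L, holomorphic_section setT s -> holomorphic_section setT s' ->
    measurable_fun (~` N) (fun x : borel X => complex.Re (hinner h s s' x)) /\
    measurable_fun (~` N) (fun x : borel X => complex.Im (hinner h s s' x))) ->
  uniq r -> (forall j, j \in r -> bergman_space vol h (B j)) ->
  (forall j k, j \in r -> k \in r -> bergman_inner vol h (B j) (B k) = (j == k)%:R) ->
  0 <= K ->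
  (forall a, ((hnorm h (comb r a B) x ^+ 2)%:E <=
    K%:E * \int[vol]_y (hnorm h (comb r a B) y ^+ 2)%:E)%E) ->
  \sum_(j <- r) hnorm h (B j) x ^+ 2 <= K.
Proof.
move=> mN N0 mH ur sB oB K0 HK; set i := lb_at L x.
(* The combination has norm [tau * w] at [x] and squared L^2 norm [tau]; the bound
   [(tau * w) ^+ 2 <= K * tau] is then divided by [tau], the case [tau = 0] being trivial. *)
pose a j := conjc (B j i x); pose tau := \sum_(j <- r) cnorm (B j i x) ^+ 2.
pose w := expR (- weight h i x).
have := HK a; rewrite (orthonormal_comb_norm mN N0 mH a ur sB oB).
have -> : \sum_(j <- r) cnorm (a j) ^+ 2 = tau.
  by apply: eq_bigr => j _; rewrite cnorm_conj.
have tau0 : 0 <= tau by apply: sumr_ge0 => j _; rewrite sqr_ge0.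
have -> : hnorm h (comb r a B) x = tau * w.
  rewrite /hnorm -/i -/w; congr (_ * _); rewrite -/(cnorm _) -[RHS]ger0_norm// -cnorm_real.
  congr cnorm; rewrite /comb /tau rmorph_sum/=; apply: eq_bigr => j _.
  rewrite -hre_diag /a; case: (B j i x) => u v; rewrite /hre.
  by apply/eqP; rewrite eq_complex /=; apply/andP; split; apply/eqP; ring.
have -> : \sum_(j <- r) hnorm h (B j) x ^+ 2 = tau * w ^+ 2.
  by rewrite mulr_suml; apply: eq_bigr => j _; rewrite /hnorm exprMn.
rewrite -EFinM lee_fin => hle.
move: tau0; rewrite le_eqVlt => /orP[/eqP <-|tau_gt0]; first by rewrite mul0r.
rewrite -(ler_pM2r tau_gt0); apply: le_trans hle.
by rewrite le_eqVlt; apply/orP; left; apply/eqP; ring.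
Qed.

(** The volume constant [D], a maximum over the charts of the cover, is kept apart from [A], because
    it has to be chosen after [omega]. *)
Lemma kernel_estimate : exists2 A : R, 1 <= A &
  forall (omega : hermitian_metric M) (vol : {measure set (borel X) -> \bar R}),
    volume_measure omega vol ->
  exists2 D : R, 1 <= D &
  forall (L : line_bundle M) (h : lb_metric L),
    measurable_weights h -> locally_bounded_weights h ->
  forall (e : 'I_(cover_size W) -> sect L), frames_over e ->
  forall (t : R) (p : nat) (J : set nat) (B : nat -> sect (lb_pow L p)),
    orthonormal_basis vol (metric_pow h p) (restricted_space vol h Sigma t (p := p)) J B ->
  forall x, cover_set W x ->
    (kernel_function (metric_pow h p) J B x <=
     (D * (A * hnorm hSigma S x) ^+ (2 * Num.truncn (t * p%:R)) *
      expR (4 * p%:R * metric_sup h e))%:E)%E.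
Proof.
have [A [A1 HA]] := normal_coord_bound S_can hSigma_smooth W.
exists A => // omega vol vol_omega.
have secB (j : 'I_(cover_size W)) := cid2 (section_bound_at vol_omega j).
exists (\big[Num.max/1]_(j < cover_size W) projT1 (secB j)); first exact: bigmax_ge_id.
move=> L h mw lb e he t p J B [BH oB _] x [j _ px].
have [N [mN N0 mH]] := measurable_hinner vol_omega mw.
set m := Num.truncn _; set nS := hnorm hSigma S x; set D := \big[_/_]_(_ < _) _.
have DB : projT1 (secB j) <= D by exact: (le_bigmax _ (fun j => projT1 (secB j)) j).
case: (secB j) DB => Bj /= Bj0 HB DB.
pose K := Bj * cnorm (cover_chart j x 0 0) ^+ (2 * m) * expR (4 * p%:R * metric_sup h e).
have K0 : 0 <= K by rewrite !mulr_ge0 ?expR_ge0// exprn_ge0 ?cnorm_ge0.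
have KD : K <= D * (A * nS) ^+ (2 * m) * expR (4 * p%:R * metric_sup h e).
  rewrite ler_wpM2r ?expR_ge0//; apply: ler_pM => //; first by rewrite exprn_ge0 ?cnorm_ge0.
  apply: lerXn2r; rewrite ?nnegrE ?cnorm_ge0//; last exact: HA.
  by rewrite mulr_ge0 ?hnorm_ge0//; apply: le_trans A1.
apply: (@le_trans _ _ K%:E); last by rewrite lee_fin.
(* The kernel is a supremum of finite sums, each of them bounded through one section of the space;
   completeness of the basis does not enter. *)
rewrite /kernel_function /esum; apply: ge_ereal_sup => _ [F [finF FJ] <-].
rewrite fsbig_finite// sumEFin lee_fin.
have memF k : k \in finmap.enum_fset (fset_set F) -> J k.
  by rewrite in_fset_set// => /set_mem /FJ.
apply: (partial_kernel_bound mN N0 (mH p)) => //.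
- exact: finmap.fset_uniq.
- by move=> k /memF /BH[].
- by move=> k l /memF Jk /memF Jl; exact: oB.
move=> a; apply: HB => //.
  by apply: holomorphic_section_comb => k /memF /BH[[]].
by apply: vanishes_to_order_comb => k /memF /BH[].
Qed.

End KernelBound.

(** * Scaling the frames *)

Section FrameScaling.
Variables (R : realType) (n : nat) (X : ptopologicalType) (M : complex_manifold R n.+1 X).
Variables (Sigma E : set X) (W : hyp_cover M Sigma E) (L : line_bundle M) (h : lb_metric L).
Variables (e : 'I_(cover_size W) -> sect L) (a : R).
Hypotheses (he : frames_over e) (a0 : 0 < a) (lb : locally_bounded_weights h).

Lemma frames_over_scale : frames_over (fun j => scale_sect a (e j)).
Proof.
move=> j; have [[hole tre] ne] := he j; split.
  split=> [i|i k x cx ix kx]; last by rewrite /scale_sect (tre i k x)// mulrCA.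
  have := holomorphic_on_lin (a%:C)%C (hole i) (@holomorphic_on_cst _ _ _ M _ 0).
  congr holomorphic_on; apply/funext => x; rewrite /scale_sect.
  by rewrite addr0.
move=> i x cx ix; rewrite mulf_neq0 ?ne//.
by apply/eqP => /(congr1 (@complex.Re R)) /= a00; move: a0; rewrite a00 ltxx.
Qed.

(** Scaling subtracts [ln a] from the frame weight, and looking at the centre of one polydisk is
    enough. *)
Lemma metric_sup_scale (j : 'I_(cover_size W)) :
  ln a - metric_sup h e <= metric_sup h (fun j => scale_sect a (e j)).
Proof.
have py : polydisk (cover_chart j) (cover_center j) 2 (cover_center j).
  have [_ cy _] := cover_centerP j; split=> // k; rewrite subrr.
  by rewrite -/(cnorm 0) cnorm0.
have h1 := frame_weight_le lb he py.
have := frame_weight_le lb frames_over_scale py.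
have [_ cy _] := cover_centerP j; have iy := lb_atP L (cover_center j).
have [_ ne] := he j.
have -> : frame_weight h (scale_sect a (e j)) (cover_center j) =
    frame_weight h (e j) (cover_center j) - ln a.
  rewrite /frame_weight /hnorm /scale_sect -!/(cnorm _) cnormM cnorm_real (gtr0_norm a0) -mulrA.
  rewrite lnM ?posrE//; first by rewrite opprD addrC.
  by rewrite mulr_gt0 ?expR_gt0// cnorm_gt0 ne.
move: h1; rewrite !ler_norml => /andP[? ?] /andP[? ?]; lra.
Qed.

End FrameScaling.

(** * Existence of covers *)

Section LocalCharts.
Variables (R : realType) (n : nat) (X : ptopologicalType) (M : complex_manifold R n.+1 X).
Local Notation C := (cplx R).
Local Notation row := 'rV[C]_n.+1.

Definition open_polydisk (r : R) : set row := [set z | forall k, cnorm (z 0 k) < r].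

Lemma open_near_row z r : open [set w : row | near_row z w r].
Proof.
rewrite openE => y yr.
have coord (k : 'I_n.+1) : \forall w \near y, cnorm ((w : row) 0 k - z 0 k) < r.
  apply/nbhs_rowP; exists (r - cnorm (y 0 k - z 0 k)); first by rewrite subr_gt0.
  move=> w wy; have := cnormD (w 0 k - y 0 k) (y 0 k - z 0 k); rewrite addrA subrK => h.
  by apply: (le_lt_trans h); rewrite -ltrBrDr.
exact: (@filter_forall _ _ (fun (k : 'I_n.+1) (w : row) => cnorm (w 0 k - z 0 k) < r) (nbhs y)).
Qed.

Lemma open_open_polydisk r : open (open_polydisk r).
Proof.
have := @open_near_row 0 r; congr open.
by apply/seteqP; split=> w h k; have := h k; rewrite mxE subr0.
Qed.

Lemma affine_differentiable (a : C) (b z : row) : differentiable (fun w : row => a *: w + b) z.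
Proof.
have d1 : differentiable (fun w : row => w) z by exact: (ex_diff (is_diff_def := is_diff_id z)).
have d2 : differentiable (cst b : row -> row) z by exact: differentiable_cst.
exact: (differentiableD (differentiableZ a d1) d2).
Qed.

Section PolydiskChart.
Variables (c : chart R n.+1 X) (x : X) (r : R).
Hypotheses (Mc : atlas M c) (cx : chart_dom c x) (r_gt0 : 0 < r).
Hypothesis ball_cod : forall w, near_row (c x) w r -> chart_cod c w.

Local Notation s := ((3 / r)%:C)%C.
Local Notation s' := ((r / 3)%:C)%C.

(** The chart [c] is restricted to a polydisk of radius [r] about [x] and rescaled to radius 3,
    which leaves room for the closed polydisk of radius 2. *)
Definition pchart_dom := [set y | chart_dom c y /\ near_row (c x) (c y) r].
Definition pchart_map y : row := s *: c y + - (s *: c x).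
Definition pchart_inv (z : row) := chart_inv c (s' *: z + c x).

Let ss' : s' * s = 1.
Proof. by rewrite -rmorphM/= mulrA divfK ?pnatr_eq0// divff ?gt_eqF//. Qed.

Let cnorm_s a : cnorm (s * a) = 3 / r * cnorm a.
Proof. by rewrite cnormM cnorm_real ger0_norm// divr_ge0// ltW. Qed.

Lemma pchart_coord y k : pchart_map y 0 k = s * (c y 0 k - c x 0 k).
Proof. by rewrite !mxE mulrBr. Qed.

Lemma pchart_affine y : s' *: pchart_map y + c x = c y.
Proof. by rewrite scalerBr !scalerA ss' !scale1r subrK. Qed.

Lemma pchart_mapP y : chart_dom c y -> pchart_dom y <-> open_polydisk 3 (pchart_map y).
Proof.
move=> cy; have eq_lt k : (cnorm (c y 0 k - c x 0 k) < r) = (cnorm (pchart_map y 0 k) < 3).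
  by rewrite pchart_coord cnorm_s mulrAC ltr_pdivrMr// ltr_pM2l.
split=> [[_ h] k|h]; first by rewrite -eq_lt; exact: h.
by split=> // k; rewrite eq_lt; exact: h.
Qed.

Lemma pchart_image : pchart_map @` pchart_dom = open_polydisk 3.
Proof.
apply/seteqP; split=> [_ [y py <-]|z z3]; first by apply/pchart_mapP => //; case: py.
have sz : near_row (c x) (s' *: z + c x) r.
  move=> k; rewrite !mxE addrK cnormM cnorm_real ger0_norm ?divr_ge0 1?ltW//.
  by rewrite mulrAC ltr_pdivrMr// ltr_pM2l.
have [y cy yE] := ball_cod sz.
exists y; first by split=> //; rewrite yE.
have s'0 : s' != 0.
  by apply/eqP => s0; have := ss'; rewrite s0 mul0r => /eqP; rewrite eq_sym oner_eq0.
apply: (can_inj (scalerK s'0)).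
by apply: (addIr (c x)); rewrite pchart_affine.
Qed.

Lemma pchart_mapK : {in pchart_dom, cancel pchart_map pchart_inv}.
Proof. by move=> y /set_mem[cy _]; rewrite /pchart_inv pchart_affine chart_invK. Qed.

Lemma pchart_dom_open : open pchart_dom.
Proof.
rewrite openE => y [cy ny].
have near_c : nbhs (c y) [set w | near_row (c x) w r].
  by apply: open_nbhs_nbhs; split=> //; exact: open_near_row.
exact: nbhs_chart_preimage cy near_c.
Qed.

Lemma pchart_cod_open : open (pchart_map @` pchart_dom).
Proof. by rewrite pchart_image; exact: open_open_polydisk. Qed.

Lemma pchart_map_cont y : pchart_dom y -> {for y, continuous pchart_map}.
Proof.
move=> [cy _]; have ca := differentiable_continuous (affine_differentiable s (- (s *: c x)) (c y)).
exact: (continuous_comp (chart_map_cont cy) ca).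
Qed.

Lemma pchart_inv_cont z : (pchart_map @` pchart_dom) z -> {for z, continuous pchart_inv}.
Proof.
move=> [y [cy _] <-].
have ca := differentiable_continuous (affine_differentiable s' (c x) (pchart_map y)).
have cc : {for s' *: pchart_map y + c x, continuous (chart_inv c)}.
  by rewrite pchart_affine; apply: chart_inv_cont; exists y.
exact: (continuous_comp ca cc).
Qed.

Definition pchart : chart R n.+1 X := Chart pchart_dom_open pchart_cod_open
  pchart_mapK pchart_map_cont pchart_inv_cont.

Lemma pchart_center : pchart_dom x /\ pchart x = 0.
Proof.
split; last by rewrite /= /pchart_map subrr.
by split=> // k; rewrite subrr cnorm0.
Qed.

Lemma pchart_atlas : atlas M pchart.
Proof.
apply: atlas_maximal => c' Mc'; split=> y /= dy c'y.
  have [cy _] := dy.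
  have dt := atlas_compatible Mc Mc' cy c'y.
  have da := affine_differentiable s (- (s *: c x)) (transition c c' (c' y)).
  exact: (differentiable_comp dt da).
have [cy _] := c'y.
have da := affine_differentiable s' (c x) (pchart_map y).
have dt := atlas_compatible Mc' Mc dy cy; rewrite -(pchart_affine y) in dt.
exact: (differentiable_comp da dt).
Qed.

Lemma pchart_adapted Sigma : Sigma x -> adapted Sigma c -> adapted Sigma pchart.
Proof.
move=> Sx ad.
have E y : (Sigma y /\ chart_dom c y) <-> (chart_dom c y /\ c y 0 0 = 0).
  by rewrite -[_ /\ chart_dom c y]/((Sigma `&` chart_dom c) y) ad.
have [_ cx0] := proj1 (E x) (conj Sx cx).
have s0 : s != 0 by apply/eqP => s0; have := ss'; rewrite s0 mulr0 => /eqP; rewrite eq_sym oner_eq0.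
apply/seteqP; split=> y /=; rewrite pchart_coord cx0 subr0.
  by move=> [Sy [cy ny]]; have [_ ->] := proj1 (E y) (conj Sy cy); rewrite mulr0.
move=> [[cy ny] /eqP]; rewrite mulf_eq0 (negbTE s0)/= => /eqP c0.
by have [Sy _] := proj2 (E y) (conj cy c0).
Qed.

End PolydiskChart.

End LocalCharts.

(** * Polydisk charts are Stein and contractible *)

Section PolydiskDomains.
Variables (R : realType) (n : nat) (X : ptopologicalType) (M : complex_manifold R n.+1 X).
Local Notation C := (cplx R).
Local Notation row := 'rV[C]_n.+1.
Variable c : chart R n.+1 X.
Hypotheses (Mc : atlas M c) (cod3 : chart_cod c = @open_polydisk R n 3).

Lemma chart_coord_holomorphic k : holomorphic_on M (chart_dom c) (fun y => c y 0 k).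
Proof.
move=> c' y Mc' c'y cy; have dt := atlas_compatible Mc Mc' cy c'y.
have dk := @differentiable_coord C 1 n.+1 (transition c c' (c' y)) 0 k.
exact: (differentiable_comp dt dk).
Qed.

Lemma chart_coord_lt3 y k : chart_dom c y -> cnorm (c y 0 k) < 3.
Proof. by move=> cy; have : chart_cod c (c y) by [exists y]; rewrite cod3; exact. Qed.

(** The coordinates are holomorphic, so any bound for them on [K] holds on the hull. A bound for
    [(3 - |c y 0 k|)^-1] on [K] turns the strict inequality into a uniform gap. *)
Lemma polydisk_hull_bound K : K `<=` chart_dom c -> compact K ->
  exists2 b : R, b < 3 & holomorphic_hull M (chart_dom c) K `<=`
    [set y | chart_dom c y /\ forall k, cnorm (c y 0 k) <= b].
Proof.
move=> Kc cK.
have bk (k : 'I_n.+1) : {b : R | b < 3 & forall y, K y -> cnorm (c y 0 k) <= b}.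
  apply: cid2.
  have [|b Hb] := compact_locally_bounded (g := fun y => (3 - cnorm (c y 0 k))^-1) cK.
    move=> y Ky; have cy := Kc y Ky.
    have cn := continuous_cnorm_comp (holomorphic_continuous (@chart_coord_holomorphic k) cy).
    have h3 : 0 < 3 - cnorm (c y 0 k) by rewrite subr_gt0 chart_coord_lt3.
    pose d := (3 - cnorm (c y 0 k)) / 2; have d0 : 0 < d by rewrite divr_gt0.
    have /cvgrPdist_lt/(_ d d0) near_d := cn.
    exists [set w | `|cnorm (c y 0 k) - cnorm (c w 0 k)| < d], d^-1; split=> // w /= wd _.
    rewrite lef_pV2 ?posrE//; last first.
      by move: wd; rewrite ltr_norml => /andP[+ _]; move: d0; rewrite /d; lra.
    by move: wd; rewrite ltr_norml => /andP[+ _]; move: d0; rewrite /d; lra.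
  have b1 : 0 < `|b| + 1 by rewrite ltr_wpDl.
  exists (3 - (`|b| + 1)^-1); first by rewrite ltrBlDr ltrDl invr_gt0.
  move=> y Ky; have h3 : 0 < 3 - cnorm (c y 0 k) by rewrite subr_gt0 (chart_coord_lt3 k (Kc y Ky)).
  have h : (`|b| + 1)^-1 <= 3 - cnorm (c y 0 k).
    rewrite -[leRHS]invrK lef_pV2 ?posrE ?invr_gt0//.
    by apply: (le_trans (Hb y Ky)); rewrite (le_trans (ler_norm _))// lerDl.
  by move: h; clear; lra.
exists (\big[Num.max/0]_(k < n.+1) s2val (bk k)).
  by apply: bigmax_lt => // k _; exact: (s2valP (bk k)).
move=> y [cy hy]; split=> // k.
apply: (@le_trans _ _ (s2val (bk k))); last exact: (le_bigmax _ (fun k => s2val (bk k)) k).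
apply: (hy _ (@chart_coord_holomorphic k)) => w Kw.
exact: (s2valP' (bk k)).
Qed.

Lemma polydisk_stein : stein M (chart_dom c).
Proof.
split; first exact: chart_dom_open.
  move=> K Kc cK; have [b b3 Hb] := polydisk_hull_bound Kc cK.
  set P := [set y | _] in Hb.
  have cP : compact P.
    apply: (@chart_image_compact _ _ _ c [set z : row | forall k, cnorm (z 0 k) <= b]).
      by move=> z zb; rewrite cod3 => k; exact: le_lt_trans (zb k) b3.
    exact: compact_polydisk0.
  apply: (subclosed_compact _ cP Hb) => y hy.
  have [cy yb] : P y.
    apply: (compact_closed (manifold_hausdorff M) cP).
    exact: closure_subset Hb y hy.
  (* The hull is closed: a value of [|f|] above [r] at a limit point would persist at nearby points
     of the hull. *)
  split=> // f hf r fr; rewrite leNgt; apply/negP => rf.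
  have cn := continuous_cnorm_comp (holomorphic_continuous hf cy).
  have /cvgrPdist_lt/(_ (cnorm (f y) - r)) := cn.
  rewrite subr_gt0 => /(_ rf) near_r.
  have [w [[cw hw] /= wr]] := hy _ near_r.
  have := hw f hf r fr; rewrite -/(cnorm (f w)) => h.
  by move: wr; rewrite ltr_norml => /andP[_]; move: h; lra.
move=> x y cx cy xy.
have : c x <> c y by move=> e; apply: xy; rewrite -(chart_invK cx) e chart_invK.
move=> ne; have [k nk] : exists k, c x 0 k <> c y 0 k.
  by apply: contrapT => h; apply: ne; apply/rowP => k; apply: contrapT => nk; apply: h; exists k.
by exists (fun y => c y 0 k) => //; exact: chart_coord_holomorphic.
Qed.

Lemma polydisk_contractible x : chart_dom c x -> c x = 0 -> contractible R (chart_dom c).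
Proof.
move=> cx c0; pose H (q : R * X) := chart_inv c (((1 - q.1)%:C)%C *: c q.2).
have Hcod t y : 0 <= t <= 1 -> chart_dom c y -> chart_cod c (((1 - t)%:C)%C *: c y).
  move=> /andP[t0 t1] cy; rewrite cod3 => k; rewrite mxE cnormM cnorm_real ger0_norm ?subr_ge0//.
  by apply: le_lt_trans (chart_coord_lt3 k cy); rewrite ler_piMl ?cnorm_ge0// gerBl.
exists x, H; split=> //.
- apply: continuous_in_subspaceT => -[t y] /set_mem[/= t01 cy].
  have c1 : {for (t, y), continuous (fun q : R * X => ((1 - q.1)%:C)%C : C)}.
    apply/continuous_cnormP => e e0.
    have near_t : \forall u \near t, `|u - t| < e.
      by apply/nbhs_ballP; exists e => // u; rewrite /ball/= distrC.
    exists ([set u | `|u - t| < e], setT); first by split=> //; exact: filterT.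
    move=> [u v] /= [ut _].
    have -> : ((1 - u)%:C)%C - ((1 - t)%:C)%C = (((t - u))%:C)%C :> C.
      by apply/eqP; rewrite eq_complex /=; apply/andP; split; apply/eqP; ring.
    by rewrite cnorm_real distrC.
  have near_c2 (P : set X) : nbhs y P -> \forall q \near (t, y), P q.2.
    by move=> yP; exists (setT, P); [split=> //; exact: filterT|move=> [u v] []].
  have ck k : {for (t, y), continuous (fun q : R * X => ((1 - q.1)%:C)%C * c q.2 0 k : C)}.
    have c2 : {for (t, y), continuous (fun q : R * X => c q.2 0 k)}.
      have /continuous_cnormP cyk := holomorphic_continuous (@chart_coord_holomorphic k) cy.
      by apply/continuous_cnormP => e e0; exact: near_c2 (cyk e e0).
    exact: (ccontinuousM c1 c2).
  pose G (q : R * X) : row := ((1 - q.1)%:C)%C *: c q.2.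
  have cz : {for (t, y), continuous G}.
    move=> A /nbhs_rowP[r r0 rA].
    have nk (k : 'I_n.+1) : \forall q \near (t, y),
        cnorm (G q 0 k - G (t, y) 0 k) < r.
      have /continuous_cnormP/(_ r r0) := ck k; apply: filterS => q.
      by rewrite !mxE.
    have nall : \forall q \near (t, y), forall k, cnorm (G q 0 k - G (t, y) 0 k) < r.
      exact: (@filter_forall _ _ (fun (k : 'I_n.+1) (q : R * X) =>
        cnorm (G q 0 k - G (t, y) 0 k) < r) (nbhs (t, y))).
    have nA : \forall q \near (t, y), A (G q).
      by apply: filterS nall => q h; apply: rA => k; exact: h.
    exact: nA.
  have ci := chart_inv_cont (Hcod t y t01 cy).
  exact: (continuous_comp cz ci).
- move=> t y t01 cy; have [w cw wE] := Hcod t y t01 cy.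
  by rewrite /H/= -wE chart_invK.
- by move=> y cy; rewrite /H /= subr0 scale1r chart_invK.
- by move=> y cy; rewrite /H /= subrr scale0r -c0 chart_invK.
Qed.

End PolydiskDomains.

Section CoverExistence.
Variables (R : realType) (n : nat) (X : ptopologicalType) (M : complex_manifold R n.+1 X).
Local Notation C := (cplx R).
Variables (Sigma E : set X).
Hypotheses (Sigma_hyp : smooth_hypersurface M Sigma) (E_compact : compact E).

Lemma adapted_polydisk (L : line_bundle M) x : Sigma x -> exists c : chart R n.+1 X,
  [/\ atlas M c, chart_dom c x, c x = 0, adapted Sigma c &
      chart_cod c = @open_polydisk R n 3 /\ chart_dom c `<=` lb_dom (lb_at L x)].
Proof.
move=> Sx; have [c [Mc cx ad]] := proj2 Sigma_hyp x Sx.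
have nx : nbhs x (lb_dom (lb_at L x)).
  by apply: open_nbhs_nbhs; split; [exact: lb_dom_open|exact: lb_atP].
have /nbhs_rowP[r r0 Hr] := nbhs_chart_image cx nx.
have ball_cod w : near_row (c x) w r -> chart_cod c w.
  by move=> /Hr[y [cy _ <-]]; exists y.
exists (pchart r0 ball_cod); have [px p0] := pchart_center cx r0 ball_cod.
split=> //.
- exact: pchart_atlas.
- exact: pchart_adapted.
- split; first exact: pchart_image.
  move=> y [cy ny]; have [w [cw iw wy]] := Hr _ ny.
  by rewrite -(chart_invK cy) -wy chart_invK.
Qed.

Lemma cover_exists (L : line_bundle M) :
  exists (W : hyp_cover M Sigma E) (e : 'I_(cover_size W) -> sect L), frames_over e.
Proof.
have cK : compact (Sigma `&` E).
  by rewrite setIC; apply: compact_closedI => //; case: Sigma_hyp.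
have [cc Hcc] : exists cc : X -> chart R n.+1 X, forall x, Sigma x ->
  [/\ atlas M (cc x), chart_dom (cc x) x, cc x x = 0, adapted Sigma (cc x) &
      chart_cod (cc x) = @open_polydisk R n 3 /\ chart_dom (cc x) `<=` lb_dom (lb_at L x)].
  have ex x : {c | Sigma x -> [/\ atlas M c, chart_dom c x, c x = 0, adapted Sigma c &
      chart_cod c = @open_polydisk R n 3 /\ chart_dom c `<=` lb_dom (lb_at L x)]}.
    apply: cid; have [Sx|nSx] := pselect (Sigma x).
      by have [c Hc] := adapted_polydisk L Sx; exists c.
    by have [c _ _] := atlas_cover M x; exists c.
  by exists (fun x => projT1 (ex x)) => x; exact: (projT2 (ex x)).
(* Extracting the finite subcover from the open unit polydisks makes the closed ones a neighborhood
   of the compact set. *)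
pose V x := [set y | chart_dom (cc x) y /\ @open_polydisk R n 1 (cc x y)].
have oV x : open (V x).
  rewrite openE => y [cy y1]; apply: nbhs_chart_preimage => //.
  by apply: open_nbhs_nbhs; split=> //; exact: open_open_polydisk.
have := cK; rewrite compact_cover => /(_ X (Sigma `&` E) V) [||F FD Fcov].
- by move=> x _; exact: oV.
- move=> x [Sx Ex]; exists x => //; have [_ cx c0 _ _] := Hcc x Sx; split=> // k.
  by rewrite c0 mxE cnorm0.
pose r := finmap.enum_fset F; pose cen (j : 'I_(size r)) := tnth (in_tuple r) j.
have Sc j : Sigma (cen j).
  have cF : cen j \in r by exact: mem_tnth.
  by have := FD _ cF; rewrite inE => -[].
have cmem y : (Sigma `&` E) y -> exists j, V (cen j) y.
  move=> /Fcov[x xF Vx]; have xr : x \in r by exact: xF.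
  have [j jx] : exists j, cen j = x.
    by have /tnthP[j ->] : x \in in_tuple r by []; exists j.
  by exists j; rewrite jx.
pose ch j := cc (cen j).
have chP j := Hcc (cen j) (Sc j).
have atl j : atlas M (ch j) by have [] := chP j.
have cod j : chart_cod (ch j) = @open_polydisk R n 3 by have [_ _ _ _ []] := chP j.
have cenP j : [/\ Sigma (cen j), chart_dom (ch j) (cen j) & ch j (cen j) = 0].
  by have [] := chP j; split.
have st j : stein M (chart_dom (ch j)) by exact: polydisk_stein.
have ctr j : contractible R (chart_dom (ch j)).
  by have [_ cj c0 _ _] := chP j; exact: (polydisk_contractible (atl j) (cod j) cj c0).
have pd j (z : 'rV[C]_n.+1) : (forall k, Normc.normc (z 0 k - ch j (cen j) 0 k) <= 2) -> chart_cod (ch j) z.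
  have [_ _ c0] := cenP j; rewrite c0 cod => z2 k; have := z2 k; rewrite mxE subr0 -/(cnorm _) => h.
  by apply: (le_lt_trans h); rewrite ltr_nat.
have ad j : adapted Sigma (ch j) by have [] := chP j.
have cv : Sigma `&` E `<=` \bigcup_j chart_dom (ch j).
  by move=> y /cmem[j [cy _]]; exists j.
have nb : Sigma `&` E `<=` (\bigcup_j polydisk (ch j) (cen j) 1)°.
  move=> y /cmem[j Vy]; apply: (@filterS _ (nbhs y) _ (V (cen j))).
    move=> w [cw w1]; exists j => //; split=> // k; have [_ _ c0] := cenP j.
    by rewrite c0 mxE subr0; apply: ltW; exact: w1.
  by apply: open_nbhs_nbhs; split.
exists (Cover atl st ctr cenP pd ad cv nb).
(* Each chart was chosen inside a trivialization of [L]; the frame is the local frame of that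
   trivialization, whose components are transition functions. *)
exists (fun j i y => lb_tr i (lb_at L (cen j)) y) => j /=.
have sub : chart_dom (ch j) `<=` lb_dom (lb_at L (cen j)) by have [_ _ _ _ []] := chP j.
split; first split.
- move=> i c x Mc cx [chx ix]; apply: (@lb_tr_holo _ _ _ _ L i (lb_at L (cen j)) c x Mc cx).
  by split=> //; exact: sub.
- by move=> i k x /sub jx ix kx; rewrite lb_trM.
- move=> i x /sub jx ix; apply/eqP => t0.
  have := lb_trM ix jx ix; rewrite t0 mul0r lb_tr1// => /eqP.
  by rewrite eq_sym oner_eq0.
Qed.

End CoverExistence.

(* The constant [A] of the first bound depends only on [log_norm hSigma S] and
   on the cover: it is chosen before the metric [omega], the bundle [L], its
   metric [h], [t] and [p].  That bound holds for every [p >= 1] once the given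
   frames are multiplied by a suitable constant [a].  The second bound holds for
   the given frames when [t * p >= 1], with a constant that may also depend on
   [omega]. *)
Theorem theorem3p4 (R : realType) (n : nat) (X : ptopologicalType)
    (M : complex_manifold R n.+1 X)
    (Sigma : set X) (Sigma_hyp : smooth_hypersurface M Sigma)
    (O : line_bundle M) (S : sect O) (S_can : canonical_section Sigma S)
    (hSigma : lb_metric O) (hSigma_smooth : smooth_metric hSigma)
    (E : set X) (E_compact : compact E)
    (rho_lt0 : exists V : set X,
      [/\ open V, E `<=` V &
          forall x, V x -> (log_norm hSigma S x < 0)%E]) :
  (forall L : line_bundle M,
     exists (W : hyp_cover M Sigma E) (e : 'I_(cover_size W) -> sect L),
       frames_over e) /\
  (forall W : hyp_cover M Sigma E, exists A : R, 1 <= A /\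
     forall (omega : hermitian_metric M)
       (vol : {measure set (borel X) -> \bar R}), volume_measure omega vol ->
     forall (L : line_bundle M) (h : lb_metric L),
       measurable_weights h -> locally_bounded_weights h ->
     forall e : 'I_(cover_size W) -> sect L, frames_over e ->
     exists a : R, 0 < a /\
     forall (t : R) (p : nat), 0 < t -> (1 <= p)%N ->
       kernel_bound (log_norm hSigma S) vol h (fun j => scale_sect a (e j)) A t p) /\
  (forall (W : hyp_cover M Sigma E) (omega : hermitian_metric M)
       (vol : {measure set (borel X) -> \bar R}), volume_measure omega vol ->
     exists A : R, 1 <= A /\
     forall (L : line_bundle M) (h : lb_metric L),
       measurable_weights h -> locally_bounded_weights h ->
     forall e : 'I_(cover_size W) -> sect L, frames_over e ->
     forall (t : R) (p : nat), 0 < t -> (1 <= p)%N -> 1 <= t * p%:R ->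
       kernel_bound (log_norm hSigma S) vol h e A t p).
Proof.
split; first exact: cover_exists.
have fin (A hn D K : R) k : ((A%:E * hn%:E) ^+ k * K%:E = ((A * hn) ^+ k * K)%:E)%E.
  by rewrite -EFinM -EFin_expe -EFinM.
split=> W; have [A A1 HA] := kernel_estimate S_can hSigma_smooth W; last first.
  move=> omega vol vol_omega; have [D D1 HD] := HA omega vol vol_omega.
  (* As [t * p >= 1], the exponent is positive, and [D >= 1] is at most its own power. *)
  exists (A * D); split; first exact: mulr_ege1.
  move=> L h mw lb e he t p t0 p1 tp1 J B BJ x Wx.
  apply: (le_trans (HD L h mw lb e he t p J B BJ x Wx)).
  rewrite expeR_log_norm fin// lee_fin ler_wpM2r ?expR_ge0//.
  have nS := hnorm_ge0 hSigma S x; have A0 : 0 <= A by exact: le_trans A1.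
  have -> : A * D * hnorm hSigma S x = D * (A * hnorm hSigma S x) by ring.
  rewrite [leRHS]exprMn ler_wpM2r//; first by rewrite exprn_ge0// mulr_ge0.
  have m1 : (0 < 2 * Num.truncn (t * p%:R))%N by rewrite muln_gt0/= truncn_gt0.
  by rewrite -[leLHS]expr1 ler_weXn2l.
exists A; split=> // omega vol vol_omega; have [D D1 HD] := HA omega vol vol_omega.
have D0 : 0 < D by exact: lt_le_trans D1.
move=> L h mw lb e he; pose N := metric_sup h e.
(* The scaled frames have [metric_sup] at least [2 * N + ln D - N = N + ln D]; multiplied by
   [4 * p], this exceeds [4 * p * N] by at least [ln D]. *)
exists (expR (2 * N + ln D)); split; first exact: expR_gt0.
move=> t p t0 p1 J B BJ x Wx.
apply: (le_trans (HD L h mw lb e he t p J B BJ x Wx)).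
have nS := hnorm_ge0 hSigma S x; have A0 : 0 <= A by exact: le_trans A1.
rewrite expeR_log_norm fin// lee_fin mulrAC mulrC ler_wpM2l//.
  by rewrite exprn_ge0// mulr_ge0.
have [j _ _] := Wx.
have := metric_sup_scale he (expR_gt0 (2 * N + ln D)) lb j; rewrite expRK -/N => hN.
have lD : 0 <= ln D by rewrite ln_ge0.
have pR : 1 <= p%:R :> R by rewrite ler1n.
rewrite -[D in leLHS]lnK ?posrE// -expRD ler_expR.
set N' := metric_sup _ _ in hN *.
have hN' : N + ln D <= N' by move: hN; clear; lra.
have : 4 * p%:R * (N + ln D) <= 4 * p%:R * N' by rewrite ler_wpM2l// mulr_ge0.
have : 1 * ln D <= 4 * p%:R * ln D by rewrite ler_wpM2r//; move: pR; clear; lra.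
by rewrite mulrDr; clear; lra.
Qed.
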